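(* Let the general setting given in the context hold. Assume that $\sigma\in\mathcal{C}_{\mathrm{locLip}}(\mathbb{R},\mathbb{R})$ (locally Lipschitz), and that one of the following holds. (A) $F(t,\cdot):X\times H\to W$ is weakly continuous for a.e. $t\in(0,T)$ (in this case it is understood that $F(t,\cdot,\cdot)$ is well defined on $X\times H$ and that the requirements on $F$ in the setting hold for its restriction to $X\times V$). (B) $V\hookrightarrow\hookrightarrow H$, $H\hookrightarrow W^*$, and for almost all $t\in(0,T)$, whenever $(w_k)_k\subset V$, $w\in V$, $(\lambda_k)_k\subset X$, $\lambda\in X$ satisfy $(w_k,\lambda_k)\rightharpoonup(w,\lambda)$ in $H\times X$ and $\liminf_{k}\langle F(t,\lambda_k,w_k),w_k-w\rangle_{W,W^*}\ge0$, then $\langle F(t,\lambda,w),w-v\rangle_{W,W^*}\ge\limsup_{k}\langle F(t,\lambda_k,w_k),w_k-v\rangle_{W,W^*}$ for all $v\in W^*$. Assume that $\mathcal{R}_1:X\times\mathbb{R}^m\times U_0\times\mathcal{V}\to[0,\infty]$ and $\mathcal{R}_2:\Theta\to[0,\infty]$ are nonnegative, weakly lower semi-continuous and such that the sublevel sets of $(\lambda,\alpha,u_0,u,\theta)\mapsto\mathcal{R}_1(\lambda,\alpha,u_0,u)+\mathcal{R}_2(\theta)$ are weakly precompact. For parameters $\beta^e,\beta^M>0$ and data $(y^k)_k\in\mathcal{Y}^K$ consider the problem $$(P)\quad\min_{\substack{(\lambda^k,\alpha^k,u_0^k,u^k)_k\subset X\times\mathbb{R}^m\times U_0\times\mathcal{V}\\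 \theta\in\Theta}}\sum_{k=1}^K\Big(\beta^e\|e(\lambda^k,\alpha^k,u_0^k,u^k,\theta)\|^2_{\mathcal{W}\times H}+\beta^M\|Mu^k-y^k\|^2_{\mathcal{Y}}+\mathcal{R}_1(\lambda^k,\alpha^k,u_0^k,u^k)\Big)+\mathcal{R}_2(\theta).$$ Let $((y^\dagger)^k)_k\in\mathcal{Y}^K$ and assume that there exist $(\hat\lambda^k,\hat\alpha^k,\hat u_0^k,\hat u^k)_k\subset X\times\mathbb{R}^m\times U_0\times\mathcal{V}$ and $\hat\theta\in\Theta$ such that $e(\hat\lambda^k,\hat\alpha^k,\hat u_0^k,\hat u^k,\hat\theta)=0$, $M\hat u^k=(y^\dagger)^k$, $\mathcal{R}_1(\hat\lambda^k,\hat\alpha^k,\hat u_0^k,\hat u^k)<\infty$ for all $k$, and $\mathcal{R}_2(\hat\theta)<\infty$. Then, for any sequence $(y_n)_n=(y_n^1,\dots,y_n^K)_n$ in $\mathcal{Y}^K$ with $\delta_n^2:=\sum_{k=1}^K\|y_n^k-(y^\dagger)^k\|^2_{\mathcal{Y}}\to0$ and parameters $\beta_n^e,\beta_n^M>0$ such that $$\beta_n^e\to\infty,\qquad\beta_n^M\to\infty,\qquad\beta_n^M\delta_n^2\to0\qquad(n\to\infty),$$ any sequence of solutions $((\lambda_n^k,\alpha_n^k,(u_0^k)_n,u_n^k)_k,\theta_n)_n$ of $(P)$ with parameters $\beta_n^e,\beta_n^M$ and data $y_n$ admits a weakly convergent subsequence, and any limit of such a subsequence is a solution to $$(P^\dagger)\quad\min_{\substack{(\lambda^k,\alpha^k,u_0^k,u^k)_k\subset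 X\times\mathbb{R}^m\times U_0\times\mathcal{V}\\ \theta\in\Theta}}\sum_{k=1}^K\mathcal{R}_1(\lambda^k,\alpha^k,u_0^k,u^k)+\mathcal{R}_2(\theta)\quad\text{s.t. for all }k:\ e(\lambda^k,\alpha^k,u_0^k,u^k,\theta)=0,\ \ Mu^k=(y^\dagger)^k.$$ If, further, the solution to $(P^\dagger)$ is unique, then the entire sequence $((\lambda_n^k,\alpha_n^k,(u_0^k)_n,u_n^k)_k,\theta_n)_n$ converges weakly to the solution of $(P^\dagger)$.
   Context: General setting. $\Omega\subset\mathbb{R}^d$ is a bounded Lipschitz domain, $T>0$, $m,K\in\mathbb{N}$. $\hookrightarrow$ denotes a continuous embedding, $\hookrightarrow\hookrightarrow$ a compact embedding. $X$ and $U_0$ are reflexive Banach spaces; $V,W,Y,\tilde V,H$ are separable reflexive Banach spaces, with $$U_0\hookrightarrow H\hookrightarrow W,\quad V\hookrightarrow H\hookrightarrow\tilde V,\quad V\hookrightarrow Y,\quad V\hookrightarrow\hookrightarrow L^{\hat p}(\Omega)\hookrightarrow W\ \text{ for some }\hat p\in[1,\infty),$$ and either $L^{\hat p}(\Omega)\hookrightarrow\tilde V$ or $\tilde V\hookrightarrow L^{\hat p}(\Omega)$. The function $F:(0,T)\times X\times V\to W$ is such that for each fixed $\lambda\in X$, $F(\cdot,\lambda,v)$ is measurable for all $v\in V$ and $F(t,\lambda,\cdot)$ is continuous for a.e. $t\in(0,T)$; moreover, for a.e. $t$ and all $\lambda\in X$, $v\in V$, $\|F(t,\lambda,v)\|_W\le\mathcal{B}(\|\lambda\|_X,\|v\|_H)(\gamma(t)+\|v\|_V)$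 for some $\gamma\in L^2(0,T)$ and some $\mathcal{B}:\mathbb{R}^2\to\mathbb{R}$ such that $b\mapsto\mathcal{B}(a,b)$ is increasing for each $a\in\mathbb{R}$. Set $\mathcal{V}=L^2(0,T;V)\cap H^1(0,T;\tilde V)$ with $\|u\|_{\mathcal V}^2=\int_0^T\|u(t)\|_V^2+\|\dot u(t)\|_{\tilde V}^2\,dt$, $\mathcal{W}=L^2(0,T;W)$, $\mathcal{Y}=L^2(0,T;Y)$ with their usual norms. $M\in\mathcal{L}(\mathcal{V},\mathcal{Y})$ is a bounded linear (measurement) operator. It is assumed that $\mathcal{V}\hookrightarrow L^\infty((0,T)\times\Omega)$ and $\mathcal{V}\hookrightarrow C(0,T;H)$. The time derivative $\frac{d}{dt}$ is understood to map $\mathcal{V}$ continuously into $\mathcal{W}$. $F$ also denotes the induced Nemytskii operator $F:X\times\mathcal{V}\to\mathcal{W}$, $[F(\lambda,u)](t)=F(t,\lambda,u(t))$. Neural networks. A neural network of depth $L$ with fixed architecture $(n_i)_{i=0}^L$, here $n_0=m+1$, $n_L=1$, is $\mathcal{N}_\theta=L_{\theta_L}\circ\dots\circ L_{\theta_1}$, where $L_{\theta_l}(z)=\sigma(\omega^lz+\beta^l)$ for $l<L$ and $L_{\theta_L}(z)=\omega^Lz+\beta^L$, with $\omega^l\in\mathcal{L}(\mathbb{R}^{n_{l-1}},\mathbb{R}^{n_l})$, $\beta^l\in\mathbb{R}^{n_l}$, $\theta_l=(\omega^l,\beta^l)$, and $\sigma:\mathbb{R}\to\mathbb{R}$ applied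 componentwise. $\Theta$ is the finite dimensional space of all parameters $\theta=(\theta_1,\dots,\theta_L)$. For $\alpha\in\mathbb{R}^m$, $u\in\mathcal{V}$, $[\mathcal{N}_\theta(\alpha,u)](t,x)=\mathcal{N}_\theta(\alpha,u(t,x))$ defines a Nemytskii operator with values in $\mathcal{W}$. PDE operator. $e:X\times\mathbb{R}^m\times U_0\times\mathcal{V}\times\Theta\to\mathcal{W}\times H$, $e(\lambda,\alpha,u_0,u,\theta)=(\dot u-F(\lambda,u)-\mathcal{N}_\theta(\alpha,u),\,u(0)-u_0)$. Weak continuity means continuity with respect to weak convergence (of sequences) in both domain and image space. *)

(* Defs.v *)
From HB Require Import structures.
From mathcomp Require Import all_boot all_order all_algebra.
From mathcomp Require Import all_classical all_reals all_analysis measurable_realfun.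
Set Implicit Arguments.
Unset Strict Implicit.
Unset Printing Implicit Defensive.
Import Order.TTheory GRing.Theory Num.Theory.
Import numFieldNormedType.Exports.
Local Open Scope classical_set_scope.
Local Open Scope ring_scope.

(* The image of a sigma-finite measure under f; the left inverse g is what makes
   the image sigma-finite. *)
Section Pushforward.
Context d1 d2 (T1 : measurableType d1) (T2 : measurableType d2) (R : realType).

Definition transport (mu : {sigma_finite_measure set T1 -> \bar R})
    (f : T1 -> T2) (g : T2 -> T1) (mf : measurable_fun setT f)
    (mg : measurable_fun setT g) (fK : cancel f g) : set T2 -> \bar R :=
  pushforward mu f.

Context (mu : {sigma_finite_measure set T1 -> \bar R})
  (f : T1 -> T2) (g : T2 -> T1) (mf : measurable_fun setT f)
  (mg : measurable_fun setT g) (fK : cancel f g).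
Local Notation nu := (transport mu mf mg fK).

Let nu0 : nu set0 = 0%E.
Proof. by rewrite /transport /pushforward preimage_set0 measure0. Qed.

Let nu_ge0 A : (0 <= nu A)%E.
Proof. exact: measure_ge0. Qed.

Let nu_sigma_additive : semi_sigma_additive nu.
Proof.
move=> F mF tF mUF; rewrite /transport /pushforward preimage_bigcup.
apply: measure_semi_sigma_additive.
- by move=> n; rewrite -[X in measurable X]setTI; exact: mf.
- apply/trivIsetP => /= i j _ _ ij; rewrite -preimage_setI.
  by move/trivIsetP : tF => /(_ _ _ _ _ ij) ->//; rewrite preimage_set0.
- by rewrite -preimage_bigcup -[X in measurable X]setTI; exact: mf.
Qed.

HB.instance Definition _ :=
  isMeasure.Build _ _ _ nu nu0 nu_ge0 nu_sigma_additive.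

Let nu_sigma_finite : sigma_finite setT nu.
Proof.
have [F FT mF] := sigma_finiteT mu.
exists (fun i => g @^-1` F i); first by rewrite -preimage_bigcup -FT preimage_setT.
move=> i; have [mFi Fioo] := mF i; split.
  by rewrite -[X in measurable X]setTI; exact: mg.
rewrite /transport /pushforward -comp_preimage.
by rewrite (_ : g \o f = id) ?preimage_id//; apply/funext => x /=; rewrite fK.
Qed.

HB.instance Definition _ := Measure_isSigmaFinite.Build _ _ _ nu nu_sigma_finite.

End Pushforward.

(* The product measure, packaged as a sigma-finite measure. *)
Section Product.
Context d1 d2 (T1 : measurableType d1) (T2 : measurableType d2) (R : realType)
  (m1 : {sigma_finite_measure set T1 -> \bar R})
  (m2 : {sigma_finite_measure set T2 -> \bar R}).

Definition product_sfm : set (T1 * T2) -> \bar R := (m1 \x m2)%E.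

HB.instance Definition _ := Measure.on product_sfm.

Let product_sfm_sigma_finite : sigma_finite setT product_sfm.
Proof.
have /sigma_finiteP[F [TF ndF Foo]] := sigma_finiteT m1.
have /sigma_finiteP[G [TG ndG Goo]] := sigma_finiteT m2.
exists (fun n => F n `*` G n).
  rewrite -setXTT TF TG predeqE => -[x y]; split.
    move=> [/= [n _ Fnx] [k _ Gky]]; exists (maxn n k) => //; split.
    - by move: x Fnx; exact/subsetPset/ndF/leq_maxl.
    - by move: y Gky; exact/subsetPset/ndG/leq_maxr.
  by move=> [n _ []/= ? ?]; split; exists n.
move=> k; have [? ?] := Foo k; have [? ?] := Goo k.
split; first exact: measurableX.
by rewrite /product_sfm product_measure1E// lte_mul_pinfty// ge0_fin_numE.
Qed.

HB.instance Definition _ :=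
  Measure_isSigmaFinite.Build _ _ _ product_sfm product_sfm_sigma_finite.

End Product.

Section LebesgueRn.
Context (R : realType).
Local Notation mR := (measurableTypeR R).

Section cons.
Context (n : nat).
Definition tcons (x : mR * n.-tuple mR) : n.+1.-tuple mR := [tuple of x.1 :: x.2].
Definition tuncons (t : n.+1.-tuple mR) : mR * n.-tuple mR :=
  (thead t, [tuple of behead t]).

Lemma tconsK : cancel tcons tuncons.
Proof.
by move=> [a t]; rewrite /tcons /tuncons /=; congr pair; apply/val_inj.
Qed.

Lemma measurable_tcons : measurable_fun setT tcons.
Proof. exact: measurable_cons. Qed.

Lemma measurable_tuncons : measurable_fun setT tuncons.
Proof.
apply/measurable_fun_pairP; split; first exact: measurable_tnth.
exact: measurable_behead.
Qed.
End cons.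

Fixpoint lebesgue_tuple (n : nat) : {sigma_finite_measure set (n.-tuple mR) -> \bar R} :=
  match n with
  | 0 => dirac (nil_tuple mR)
  | n'.+1 => transport
     (product_sfm (@lebesgue_measure R) (lebesgue_tuple n'))
     (@measurable_tcons n') (@measurable_tuncons n') (@tconsK n')
  end.

Context (n : nat).
(* R^n with its Borel sigma-algebra. *)
Definition Rn : Type := g_sigma_algebraType (@open 'rV[R]_n).
HB.instance Definition _ := Measurable.on Rn.

Definition Rn_of_tuple (t : n.-tuple mR) : Rn := \row_(i < n) tnth t i.
Definition tuple_of_Rn (x : Rn) : n.-tuple mR := [tuple (x : 'rV[R]_n) ord0 i | i < n].

Lemma Rn_of_tupleE t a i : (Rn_of_tuple t : 'rV[R]_n) a i = tnth t i.
Proof. exact: mxE. Qed.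

Lemma Rn_of_tupleK : cancel Rn_of_tuple tuple_of_Rn.
Proof. by move=> t; apply: eq_from_tnth => i; rewrite tnth_mktuple mxE. Qed.

Lemma open_measurable_Rn (U : set Rn) : open (U : set 'rV[R]_n) -> measurable U.
Proof. exact: sub_sigma_algebra. Qed.

Lemma measurable_tuple_of_Rn : measurable_fun setT tuple_of_Rn.
Proof.
apply/measurable_fun_tnthP => i /=.
apply: (measurability _ (RGenOpens.measurableE R)).
move=> _ [_ [a [b ->] <-]]; rewrite setTI; apply: open_measurable_Rn.
rewrite (_ : _ @^-1` _ = (fun x : 'rV[R]_n => x ord0 i) @^-1` `]a, b[%classic).
  by apply: open_comp; [move=> x _; exact: coord_continuous|exact: interval_open].
by apply/seteqP; split => x /=; rewrite tnth_mktuple.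
Qed.

Lemma measurable_Rn_of_tuple : measurable_fun setT Rn_of_tuple.
Proof.
apply: (@measurability _ _ _ Rn setT Rn_of_tuple (@open 'rV[R]_n)) => //.
move=> _ [U oU <-]; rewrite setTI.
pose c (q : 'rV[rat]_n * nat) : 'rV[R]_n := map_mx ratr q.1.
pose B q := ball (c q) q.2.+1%:R^-1.
pose D := [set q | B q `<=` U].
have -> : Rn_of_tuple @^-1` U =
    \bigcup_q (if q \in D then Rn_of_tuple @^-1` B q else set0).
  apply/seteqP; split=> [t /= Ut|t [q _] /=]; last first.
    by case: ifPn => //; rewrite inE => Dq; exact: Dq.
  have /nbhs_ballP[e /= e0 eU] : nbhs (Rn_of_tuple t : 'rV[R]_n) U.
    exact: open_nbhs_nbhs.
  have [k ke] : exists k, k.+1%:R^-1 < e / 2 :> R.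
    have [k _ /(_ _ (leqnn k))] := near_infty_natSinv_lt (PosNum (divr_gt0 e0 (ltr0n _ 2))).
    by exists k.
  have r0 : 0 < k.+1%:R^-1 :> R by rewrite invr_gt0.
  have /choice[q qP] : forall i : 'I_n, exists p : rat,
      `|ratr p - tnth t i| < k.+1%:R^-1.
    move=> i; have : tnth t i - k.+1%:R^-1 < tnth t i + k.+1%:R^-1 by rewrite ltrD2l gtrN.
    move=> /rat_in_itvoo[p]; rewrite in_itv/= => /andP[p1 p2].
    by exists p; rewrite ltr_distl p1 p2.
  have tB : B (\row_i q i, k) (Rn_of_tuple t).
    by split=> // a i; rewrite /ball/= !mxE; exact: qP.
  exists (\row_i q i, k) => //.
  rewrite ifT//; rewrite inE => y By; apply: eU.
  apply: (@ball_splitr _ _ (c (\row_i q i, k))).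
    by apply: le_ball (ltW ke) _ tB.
  by apply: le_ball (ltW ke) _ By.
apply: countable_bigcupT_measurable => // q.
case: ifPn => // _.
rewrite (_ : _ @^-1` _ = \bigcap_(i in [set: 'I_n])
    ((@tnth n mR) ^~ i) @^-1` ball (c q ord0 i) q.2.+1%:R^-1).
  apply: fin_bigcap_measurable => // i _.
  rewrite -[X in measurable X]setTI; apply: measurable_tnth => //.
  by apply: open_measurable; apply: ball_open; rewrite invr_gt0.
apply/seteqP; split=> t.
  by move=> [_ h] i _; have := h ord0 i; rewrite Rn_of_tupleE.
move=> h; split; first by rewrite invr_gt0 ltr0n.
by move=> a i; rewrite Rn_of_tupleE [a]ord1; exact: h.
Qed.

Definition lebesgue_Rn : {sigma_finite_measure set Rn -> \bar R} :=
  transport (lebesgue_tuple n) measurable_Rn_of_tuple measurable_tuple_of_Rn Rn_of_tupleK.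
End LebesgueRn.

Arguments product_sfm {d1 d2 T1 T2 R}.

(* A domain is locally, near each boundary point and after a change of
   orthonormal coordinates Q, the set lying above the graph of a Lipschitz
   function of the d - 1 coordinates other than the i-th one. *)
Definition bounded_lipschitz_domain (R : realType) (d : nat)
    (Omega : set 'rV[R]_d) : Prop :=
  [/\ open Omega, Omega !=set0, connected Omega, bounded_set Omega &
      forall x, (closure Omega `\` Omega) x ->
        exists (r : R) (Q : 'M[R]_d) (i : 'I_d) (g : 'rV[R]_d.-1 -> R^o),
          [/\ 0 < r, Q *m Q^T = 1%:M, exists k : R, k.-lipschitz g &
              Omega `&` ball x r =
              [set y | g (col' i (y *m Q)) < (y *m Q) ord0 i] `&` ball x r]].

Lemma bounded_lipschitz_domain_measurable (R : realType) (d : nat)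
    (Omega : set 'rV[R]_d) :
  bounded_lipschitz_domain Omega -> measurable (Omega : set (Rn R d)).
Proof. by case=> oO _ _ _ _; exact: open_measurable_Rn. Qed.

(* Spaces of functions are handled, as usual, through representatives: a space
   is a set of members of an ambient vector space together with a (semi)norm,
   and two members are the same element when the norm of their difference is 0
   (for Lebesgue and Bochner spaces: when they agree almost everywhere). *)
Record fspace (R : realType) := FSpace {
  carrier :> lmodType R ;
  member : set carrier ;
  snorm : carrier -> \bar R }.
Arguments member {R} f _.
Arguments snorm {R} f _.

Section Spaces.
Context {R : realType}.
Implicit Types A B : fspace R.

Definition same A (x y : A) : Prop := snorm A (x - y) = 0%E.

Definition nspace (E : normedModType R) : fspace R :=
  @FSpace R E setT (fun x => `|x|%:E).

Definition bounded_linear A B (f : A -> B) : Prop :=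
  [/\ forall x, member A x -> member B (f x),
      forall (a : R) x y, member A x -> member A y ->
        same (f (a *: x + y)) (a *: f x + f y) &
      exists C : R, forall x, member A x ->
        (snorm B (f x) <= C%:E * snorm A x)%E].

Definition embedding A B (j : A -> B) : Prop :=
  bounded_linear j /\
  forall x, member A x -> snorm B (j x) = 0%E -> snorm A x = 0%E.

Definition increasing_index (s : nat -> nat) : Prop :=
  {homo s : i j / (i < j)%N}.

Definition compact_embedding A B (j : A -> B) : Prop :=
  embedding j /\
  forall (x_ : nat -> A) (C : R),
    (forall n, member A (x_ n) /\ (snorm A (x_ n) <= C%:E)%E) ->
    exists (s : nat -> nat) (y : B),
      [/\ increasing_index s, member B y &
          snorm B (j (x_ (s n)) - y) @[n --> \oo] --> 0%E].

Definition dual A : fspace R :=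
  @FSpace R (A -> R^o)
    [set phi | @bounded_linear A (nspace R^o) phi]
    (fun phi => ereal_sup
       [set `|phi x|%:E | x in [set x | member A x /\ (snorm A x <= 1)%E]]).

Definition reflexive_space (E : normedModType R) : Prop :=
  forall Phi, member (dual (dual (nspace E))) Phi ->
    exists x : E, forall phi, member (dual (nspace E)) phi -> Phi phi = phi x.

Definition separable_space (E : normedModType R) : Prop :=
  exists2 D : set E, countable D & dense D.

Definition weak_cvg A (x_ : nat -> A) (x : A) : Prop :=
  [/\ forall n, member A (x_ n), member A x &
      forall phi, member (dual A) phi ->
        phi (x_ n) @[n --> \oo] --> (phi x : R^o)].

Definition weakly_continuous A B (f : A -> B) : Prop :=
  forall x_ x, weak_cvg x_ x -> weak_cvg (f \o x_) (f x).

Definition weakly_lsc A (f : A -> \bar R) : Prop :=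
  forall x_ x, weak_cvg x_ x -> (f x <= limn_einf (f \o x_))%E.

(* Sequential form; in reflexive spaces it agrees with relative weak compactness
   by the Eberlein-Smulian theorem. *)
Definition weakly_precompact_sublevels A (f : A -> \bar R) : Prop :=
  forall (c : R) (x_ : nat -> A),
    (forall n, member A (x_ n) /\ (f (x_ n) <= c%:E)%E) ->
    exists (s : nat -> nat) (x : A), increasing_index s /\ weak_cvg (x_ \o s) x.

(* x minimizes J over the members of A satisfying the constraint P *)
Definition minimizer A (P : set A) (J : A -> \bar R) (x : A) : Prop :=
  [/\ member A x, P x & forall y, member A y -> P y -> (J x <= J y)%E].

Definition prod_space A B : fspace R :=
  @FSpace R (A * B)%type
    [set x | member A x.1 /\ member B x.2]
    (fun x => sqrte (snorm A x.1 ^+ 2 + snorm B x.2 ^+ 2)%E).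

Definition power_space (K : nat) A : fspace R :=
  @FSpace R ('I_K -> A)
    [set x | forall k, member A (x k)]
    (fun x => sqrte (\sum_(k < K) snorm A (x k) ^+ 2)%E).

End Spaces.

Section Bochner.
Context {R : realType}.
Local Notation leb := (@lebesgue_measure R).
Implicit Types (E : normedModType R) (T : R).

Definition simple_fun E (s : R -> E) : Prop :=
  finite_set (range s) /\
  forall v, measurable (s @^-1` [set v] : set (measurableTypeR R)).

Definition simple_integral E T (s : R -> E) : E :=
  \sum_(v \in range s) fine (leb (`]0, T[ `&` s @^-1` [set v])) *: v.

Definition ae_limit E T (s_ : nat -> R -> E) (f : R -> E) : Prop :=
  {ae leb, forall t, t \in `]0, T[ -> s_ n t @[n --> \oo] --> f t}.

(* Limits almost everywhere, so that measurability is up to Lebesgue null sets. *)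
Definition strongly_measurable E T (f : R -> E) : Prop :=
  exists2 s_ : nat -> R -> E, (forall n, simple_fun (s_ n)) & ae_limit T s_ f.

Definition bochner_integral E T (f : R -> E) (I : E) : Prop :=
  exists s_ : nat -> R -> E,
    [/\ forall n, simple_fun (s_ n), ae_limit T s_ f,
        (\int[leb]_(t in `]0%R, T[) `|f t - s_ n t|%:E)%E @[n --> \oo] --> 0%E &
        simple_integral T (s_ n) @[n --> \oo] --> I].

Definition test_function T (phi : R -> R) : Prop :=
  (forall n x, derivable (derive1n n phi) x 1) /\
  exists a b, [/\ 0 < a, b < T & forall x, phi x != 0 -> a <= x <= b].

Definition weak_derivative E T (f g : R -> E) : Prop :=
  forall phi, test_function T phi -> exists I : E,
    bochner_integral T (fun t => derive1 phi t *: f t) I /\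
    bochner_integral T (fun t => phi t *: g t) (- I).

Definition sq_integral E T (f : R -> E) : \bar R :=
  (\int[leb]_(t in `]0%R, T[) (`|f t| ^+ 2)%:E)%E.

(* L^2(0,T;E) *)
Definition L2 T E : fspace R :=
  @FSpace R (R -> E)
    [set f | strongly_measurable T f /\ (sq_integral T f < +oo)%E]
    (fun f => sqrte (sq_integral T f)).

Definition time_derivative E T (f : R -> E) : R -> E :=
  xget (fun=> 0) [set g | member (L2 T E) g /\ weak_derivative T f g].

(* L^2(0,T;V) \cap H^1(0,T;E), with V embedded into E by j *)
Definition L2H1 T (V E : normedModType R) (j : V -> E) : fspace R :=
  @FSpace R (R -> V)
    [set u | member (L2 T V) u /\
       exists g, member (L2 T E) g /\ weak_derivative T (j \o u) g]
    (fun u => sqrte (sq_integral T u + sq_integral T (time_derivative T (j \o u)))%E).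

(* C([0,T];E) *)
Definition Cspace T E : fspace R :=
  @FSpace R (R -> E)
    [set c | {within `[0, T], continuous c}]
    (fun c => ereal_sup [set `|c t|%:E | t in `[0, T]]).

Definition Lp_space d (Z : measurableType d) (mu : {measure set Z -> \bar R})
    (p : \bar R) : fspace R :=
  @FSpace R (Z -> R^o) [set f | f \in Lfun mu p] (fun f => 'N[mu]_p [EFin \o f])%E.

End Bochner.

Section NeuralNetworks.
Context {R : realType}.

(* Parameters of a network with input width i, hidden widths hs and output
   width 1; its depth is (size hs).+1. *)
Fixpoint params (i : nat) (hs : seq nat) : normedModType R :=
  match hs with
  | [::] => ('M[R]_(1, i) * 'cV[R]_1)%type
  | j :: hs' => (('M[R]_(j, i) * 'cV[R]_j) * params j hs')%type
  end.

Fixpoint network (sigma : R -> R) (i : nat) (hs : seq nat) :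
    params i hs -> 'cV[R]_i -> R :=
  match hs with
  | [::] => fun theta z => (theta.1 *m z + theta.2) ord0 ord0
  | j :: hs' => fun theta z =>
      network sigma theta.2 (map_mx sigma (theta.1.1 *m z + theta.1.2))
  end.

End NeuralNetworks.

(* Lebesgue measure restricted to Omega, and to ]0,T[ x Omega. *)
Definition lebesgue_on (R : realType) (d : nat) (Omega : set 'rV[R]_d)
    (OmegaP : bounded_lipschitz_domain Omega) :
    {measure set (Rn R d) -> \bar R} :=
  mrestr (lebesgue_Rn R d) (bounded_lipschitz_domain_measurable OmegaP).

Definition lebesgue_cylinder (R : realType) (T : R) (d : nat)
    (Omega : set 'rV[R]_d) (OmegaP : bounded_lipschitz_domain Omega) :
    {measure set (measurableTypeR R * Rn R d) -> \bar R} :=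
  mrestr (product_sfm (@lebesgue_measure R) (lebesgue_Rn R d))
    (measurableX (measurable_itv `]0, T[)
       (bounded_lipschitz_domain_measurable OmegaP)).

(* The embeddings j_AB : A -> B are part of the data; since all of them stand
   for one identification of functions, those between the same two spaces are
   required to agree. *)
Record setting (R : realType) := Setting {
  dimn : nat ;
  dimn_gt0 : (0 < dimn)%N ;
  Omega : set 'rV[R]_dimn ;
  OmegaP : bounded_lipschitz_domain Omega ;
  horizon : R ;
  horizon_gt0 : 0 < horizon ;
  phat : R ;
  phat_ge1 : 1 <= phat ;

  sX : completeNormedModType R ;
  sU0 : completeNormedModType R ;
  sV : completeNormedModType R ;
  sW : completeNormedModType R ;
  sY : completeNormedModType R ;
  sVt : completeNormedModType R ;
  sH : completeNormedModType R ;
  X_reflexive : reflexive_space sX ;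
  U0_reflexive : reflexive_space sU0 ;
  V_reflexive : reflexive_space sV ;
  W_reflexive : reflexive_space sW ;
  Y_reflexive : reflexive_space sY ;
  Vt_reflexive : reflexive_space sVt ;
  H_reflexive : reflexive_space sH ;
  V_separable : separable_space sV ;
  W_separable : separable_space sW ;
  Y_separable : separable_space sY ;
  Vt_separable : separable_space sVt ;
  H_separable : separable_space sH ;

  Lphat : fspace R := Lp_space (lebesgue_on OmegaP) phat%:E ;
  j_U0H : sU0 -> sH ;
  j_HW : sH -> sW ;
  j_VH : sV -> sH ;
  j_HVt : sH -> sVt ;
  j_VY : sV -> sY ;
  j_VL : sV -> Lphat ;
  j_LW : Lphat -> sW ;
  j_U0H_embedding : @embedding R (nspace sU0) (nspace sH) j_U0H ;
  j_HW_embedding : @embedding R (nspace sH) (nspace sW) j_HW ;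
  j_VH_embedding : @embedding R (nspace sV) (nspace sH) j_VH ;
  j_HVt_embedding : @embedding R (nspace sH) (nspace sVt) j_HVt ;
  j_VY_embedding : @embedding R (nspace sV) (nspace sY) j_VY ;
  j_VL_compact : @compact_embedding R (nspace sV) Lphat j_VL ;
  j_LW_embedding : @embedding R Lphat (nspace sW) j_LW ;
  j_VLW : forall v, j_LW (j_VL v) = j_HW (j_VH v) ;
  L_vs_Vt :
    (exists2 j, @embedding R Lphat (nspace sVt) j &
       forall v, j (j_VL v) = j_HVt (j_VH v)) \/
    (exists2 j, @embedding R (nspace sVt) Lphat j &
       forall v, @same R Lphat (j (j_HVt (j_VH v))) (j_VL v)) ;

  Vcal : fspace R := L2H1 horizon (j_HVt \o j_VH) ;
  Wcal : fspace R := L2 horizon sW ;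
  Ycal : fspace R := L2 horizon sY ;

  sM : Vcal -> Ycal ;
  sM_bounded_linear : bounded_linear sM ;

  (* u |-> ((t, x) |-> u(t,x)) *)
  space_time : Vcal -> Lp_space (lebesgue_cylinder horizon OmegaP) +oo%E ;
  space_time_embedding : embedding space_time ;
  space_timeE : forall u, member Vcal u ->
    {ae @lebesgue_measure R, forall t, t \in `]0, horizon[ ->
      {ae lebesgue_on OmegaP, forall x, space_time u (t, x) = j_VL (u t) x}} ;

  (* the representative of u that is continuous into H, for initial values *)
  cont_rep : Vcal -> Cspace horizon sH ;
  cont_rep_embedding : embedding cont_rep ;
  cont_repE : forall u, member Vcal u ->
    {ae @lebesgue_measure R, forall t, t \in `]0, horizon[ ->
      cont_rep u t = j_VH (u t)} ;

  (* d/dt : Vcal -> Wcal, the derivative being that of u as a W-valued function *)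
  ddt : Vcal -> Wcal ;
  ddt_bounded_linear : bounded_linear ddt ;
  ddtE : forall u, member Vcal u ->
    weak_derivative horizon (j_HW \o j_VH \o u) (ddt u) ;

  sF : R -> sX -> sV -> sW ;
  sF_measurable : forall la v, strongly_measurable horizon (fun t => sF t la v) ;
  sF_continuous : forall la,
    {ae @lebesgue_measure R, forall t, t \in `]0, horizon[ ->
      continuous (sF t la)} ;
  sF_growth : exists (B : R -> R -> R) (gamma : R -> R),
    [/\ forall a, {homo B a : b1 b2 / b1 <= b2},
        member (L2 horizon R^o) gamma &
        {ae @lebesgue_measure R, forall t, t \in `]0, horizon[ ->
          forall la v,
            `|sF t la v| <= B `|la| `|j_VH v| * (gamma t + `|v|)}]
}.

Arguments Lphat {R}.
Arguments Vcal {R}.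
Arguments Wcal {R}.
Arguments Ycal {R}.

Section Problem.
Context {R : realType} (S : setting R).
Local Notation X := (nspace (sX S)).
Local Notation W := (nspace (sW S)).
Local Notation H := (nspace (sH S)).
Local Notation T := (horizon S).
Local Notation leb := (@lebesgue_measure R).

(* FH is F on the larger domain X x H. *)
Definition weakly_continuous_nonlinearity : Prop :=
  exists FH : R -> prod_space X H -> W,
    (forall t la v, t \in `]0, T[ -> sF t la v = FH t (la, j_VH v)) /\
    {ae leb, forall t, t \in `]0, T[ -> weakly_continuous (FH t)}.

(* j_HWs is the embedding of H into W^*, so that j_HWs h w = <w, h>_{W,W^*}. *)
Definition pseudomonotone_nonlinearity : Prop :=
  @compact_embedding R (nspace (sV S)) H (@j_VH R S) /\
  exists2 j_HWs : H -> dual W, embedding j_HWs &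
    {ae leb, forall t, t \in `]0, T[ ->
      forall (w_ : nat -> sV S) (w : sV S) (la_ : nat -> sX S) (la : sX S),
        weak_cvg (A := prod_space H X)
          (fun k => (j_VH (w_ k), la_ k)) (j_VH w, la) ->
        (0 <= limn_einf (fun k =>
           (j_HWs (j_VH (w_ k - w)) (sF t (la_ k) (w_ k)))%:E))%E ->
        forall v, member (dual W) v ->
          (limn_esup (fun k =>
             ((j_HWs (j_VH (w_ k)) - v : _ -> _) (sF t (la_ k) (w_ k)))%:E)
           <= ((j_HWs (j_VH w) - v : _ -> _) (sF t la w))%:E)%E}.

Context (m K : nat) (sigma : R -> R) (hs : seq nat).

Definition Theta : fspace R := nspace (params (m + 1) hs).

(* X x R^m x U_0 x Vcal *)
Definition state_space : fspace R :=
  prod_space (prod_space (prod_space X (nspace 'cV[R]_m)) (nspace (sU0 S))) (Vcal S).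

Definition variables : fspace R := prod_space (power_space K state_space) Theta.

(* For almost every t the inner function belongs to L^phat(Omega), since u is
   essentially bounded. *)
Definition network_op (theta : Theta) (alpha : 'cV[R]_m) (u : Vcal S) : Wcal S :=
  fun t => @j_LW R S (fun x =>
    network sigma theta (col_mx alpha (@space_time R S u (t, x))%:M)).

Definition F_op (la : sX S) (u : Vcal S) : Wcal S := fun t => sF t la (u t).

Definition pde_op (q : state_space) (theta : Theta) : prod_space (Wcal S) H :=
  let: (la, alpha, u0, u) := q in
  (@ddt R S u - F_op la u - network_op theta alpha u,
   @cont_rep R S u 0 - j_U0H u0).

Context (R1 : state_space -> \bar R) (R2 : Theta -> \bar R).

Definition objective (betae betaM : R) (y : 'I_K -> Ycal S) (z : variables) : \bar R :=
  (\sum_(k < K) (betae%:E * snorm _ (pde_op (z.1 k) z.2) ^+ 2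
     + betaM%:E * snorm (Ycal S) (@sM R S (z.1 k).2 - y k)%R ^+ 2
     + R1 (z.1 k)) + R2 z.2)%E.

Definition solves_P (betae betaM : R) (y : 'I_K -> Ycal S) (z : variables) : Prop :=
  minimizer setT (objective betae betaM y) z.

Definition fits_exactly (ydag : 'I_K -> Ycal S) (z : variables) : Prop :=
  forall k, same (pde_op (z.1 k) z.2) 0 /\ @same R (Ycal S) (@sM R S (z.1 k).2) (ydag k).

Definition solves_Pdagger (ydag : 'I_K -> Ycal S) (z : variables) : Prop :=
  minimizer (fits_exactly ydag) (fun z => \sum_(k < K) R1 (z.1 k) + R2 z.2)%E z.

End Problem.

(* Main.v *)
Require Import Defs.
From HB Require Import structures.
From mathcomp Require Import all_boot all_order all_algebra.
From mathcomp Require Import all_classical all_reals all_analysis.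
From mathcomp Require Import measurable_realfun ess_sup_inf.
From mathcomp Require Import ring lra zify.
Set Implicit Arguments.
Unset Strict Implicit.
Unset Printing Implicit Defensive.
Import Order.TTheory GRing.Theory Num.Theory.
Import numFieldNormedType.Exports.
Local Open Scope classical_set_scope.
Local Open Scope ring_scope.

(** The terms multiplied by the diverging parameters are bounded, by comparison
with an exact solution, so the PDE and observation residuals of the solutions
vanish, and everything rests on the weak closedness of the constraints.

Let [u_n] converge weakly in [Vcal]. Evaluation of the continuous representative
gives [u_n(t) -> u(t)] weakly in [H] for almost every [t]; with the compact
embedding of [V] into [L^phat], an Ehrling inequality and the bound in
[L^2(0,T;V)], a subsequence satisfies [u_n(t) -> u(t)] strongly in [L^phat] for
almost every [t]. Since [u_n] is also essentially bounded, the network terms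
converge pointwise in [W]. The derivatives converge weakly in [L^2(0,T;W)], and
such a weak limit is determined by weak limits pointwise in time, so it remains
to find the pointwise weak limit of [F(t,lambda_n,u_n(t))]. Under (A) it is
immediate. Under (B), [u_n(t) -> u(t)] strongly in [H], and
[F(t,lambda_n,u_n(t))] is, up to the residual and the network term, a derivative
bounded in [L^2(0,T;W)]; hence [<F(t,lambda_n,u_n(t)), u_n(t) - u(t)>] tends to 0
for almost every [t] along a subsequence, and pseudomonotonicity applies. *)

(** * Seminorms and weak convergence *)

Section SeminormedSpaces.
Context {R : realType}.
Implicit Types A B : fspace R.

(** An [fspace] carries no axioms, and the norm of [Vcal] contains a weak derivative picked by
    [xget], so the seminorm axioms for [Vcal] would first require uniqueness of weak derivatives.
    The arguments rely instead on three facts about [Vcal]: closure under linear combinations,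
    nonnegativity of the norm, and the vanishing of the norm of 0, which comes from the embedding
    into L^oo. Bounds are obtained after a bounded linear map into a space that is proved
    [seminormed]: L^2, L^p, C([0,T];H) or a normed space.

    Measurability is the second obstacle. Integrals of nonnegative functions are lower integrals,
    insensitive to null sets; measurability is recovered through representatives that are everywhere
    limits of simple functions, and for the residual of the equation only through its norm.

    Subsequences can be extracted freely in the closedness proofs, because each constraint concerns
    the weak limit alone, which all subsequences share. *)

Record seminormed A : Prop := Seminormed {
  member0 : member A 0 ;
  member_lin : forall (a : R) x y,
    member A x -> member A y -> member A (a *: x + y) ;
  snorm_fin : forall x, member A x -> snorm A x \is a fin_num ;
  snormD : forall x y, member A x -> member A y ->
    (snorm A (x + y) <= snorm A x + snorm A y)%E ;
  snormZ : forall (a : R) x, member A x ->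
    (snorm A (a *: x) = `|a|%:E * snorm A x)%E }.

Definition nrm A (x : A) : R := fine (snorm A x).

Section Seminorm.
Variables (A : fspace R) (sA : seminormed A).
Implicit Types x y : A.

Lemma memberD x y : member A x -> member A y -> member A (x + y).
Proof. by move=> mx my; rewrite -[x]scale1r; exact: member_lin. Qed.

Lemma memberZ (a : R) x : member A x -> member A (a *: x).
Proof. by move=> mx; rewrite -[_ *: _]addr0; apply: member_lin => //; exact: member0. Qed.

Lemma memberB x y : member A x -> member A y -> member A (x - y).
Proof. by move=> mx my; apply: memberD => //; rewrite -scaleN1r; exact: memberZ. Qed.

Lemma nrmE x : member A x -> snorm A x = (nrm x)%:E.
Proof. by move=> mx; rewrite fineK// snorm_fin. Qed.

Lemma nrmZ (a : R) x : member A x -> nrm (a *: x) = `|a| * nrm x.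
Proof.
move=> mx; apply: EFin_inj.
by rewrite -(nrmE (memberZ a mx)) EFinM -nrmE// snormZ.
Qed.

Lemma nrmD x y : member A x -> member A y -> nrm (x + y) <= nrm x + nrm y.
Proof.
move=> mx my; rewrite -lee_fin EFinD -!nrmE//; last exact: memberD.
exact: snormD.
Qed.

Lemma nrm0 : nrm (0 : A) = 0.
Proof. by rewrite -(scale0r (0 : A)) nrmZ ?normr0 ?mul0r//; exact: member0. Qed.

Lemma nrmN x : member A x -> nrm (- x) = nrm x.
Proof. by move=> mx; rewrite -scaleN1r nrmZ// normrN1 mul1r. Qed.

Lemma nrm_ge0 x : member A x -> 0 <= nrm x.
Proof.
move=> mx; have mN : member A (- x) by rewrite -scaleN1r; exact: memberZ.
have := nrmD mx mN; rewrite subrr nrm0 nrmN// => h.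
by move: h; rewrite -mulr2n pmulrn_lge0.
Qed.

Lemma snorm0 : snorm A 0 = 0%E.
Proof. by rewrite nrmE ?nrm0//; exact: member0. Qed.

Lemma snorm_eq0D x y : member A x -> member A y ->
  snorm A y = 0%E -> snorm A (x + y) = snorm A x.
Proof.
move=> mx my y0; have ny : nrm y = 0 by rewrite /nrm y0.
rewrite !nrmE//; last exact: memberD.
congr EFin; apply/eqP; rewrite eq_le; apply/andP; split.
  by rewrite (le_trans (nrmD mx my))// ny addr0.
have /(memberZ (-1)) mN := my; rewrite scaleN1r in mN.
by rewrite -{1}[x](addrK y) (le_trans (nrmD (memberD mx my) mN))// nrmN// ny addr0.
Qed.

End Seminorm.

(** * Norming functionals for a seminorm *)

Section HahnBanach.
Variables (A : fspace R) (sA : seminormed A) (x0 : A).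
Hypothesis mx0 : member A x0.

(** Linear functionals on subspaces, as graphs dominated by the seminorm. Domination already makes a
    graph single-valued, since two values at one point differ by a value at 0. The last clause is
    conditional because the empty graph, as the union of the empty chain, must qualify for Zorn's
    lemma. *)
Let partial (G : set (A * R)) :=
  [/\ forall (a : R) u v, G u -> G v -> G (a *: u.1 + v.1, a * u.2 + v.2),
      forall u, G u -> member A u.1 /\ u.2 <= nrm u.1 &
      forall u, G u -> G (x0, nrm x0)].

Let line : set (A * R) := [set u | exists t : R, u = (t *: x0, t * nrm x0)].

Let partial_line : partial line.
Proof.
split.
- move=> a _ _ [t ->] [s ->]; exists (a * t + s) => /=.
  by rewrite scalerA scalerDl mulrDl mulrA.
- move=> _ [t ->] /=; split; first exact: memberZ.
  by rewrite nrmZ// ler_wpM2r ?nrm_ge0// ler_norm.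
- by move=> _ _; exists 1; rewrite scale1r mul1r.
Qed.

Let maximal_partial : exists2 G, partial G &
  G (x0, nrm x0) /\ forall G', G `<=` G' -> partial G' -> G' `<=` G.
Proof.
have [|G [PG maxG]] := @Zorn_bigcup _ partial.
  move=> F FP totF; split.
  - move=> a u v [G FG Gu] [G' FG' Gv].
    have [GG'|G'G] := totF _ _ FG FG'.
      by exists G' => //; have [h _ _] := FP _ FG'; apply: h => //; exact: GG'.
    by exists G => //; have [h _ _] := FP _ FG; apply: h => //; exact: G'G.
  - by move=> u [G FG Gu]; have [_ h _] := FP _ FG; exact: h.
  - by move=> u [G FG Gu]; exists G => //; have [_ _ h] := FP _ FG; exact: h Gu.
(* Zorn's lemma could return the empty graph, but that one lies strictly below [line]. *)
have [[u Gu]|G0] := pselect (exists u, G u); last first.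
  have Gline : G `<` line.
    split; first by move=> u Gu; exfalso; apply: G0; exists u.
    move=> h; apply: G0; exists (x0, nrm x0); apply: h.
    by exists 1; rewrite scale1r mul1r.
  by exfalso; exact: (maxG _ Gline).
exists G => //; split; first by have [_ _ h] := PG; exact: h Gu.
move=> G' GG' PG'; apply: contrapT => nG'G; apply: (maxG G') => //.
Qed.

(** One-dimensional extension: by the triangle inequality every u.2 - |u.1 - v| is at most every
    |w.1 + v| - w.2, so the supremum [c] of the former is an admissible value at v. Maximality then
    puts the extended graph inside G. *)
Let partial_total G : partial G -> G (x0, nrm x0) ->
  (forall G', G `<=` G' -> partial G' -> G' `<=` G) ->
  forall v, member A v -> exists r, G (v, r).
Proof.
move=> PG Gx0 maxG v mv; have [Glin Gdom _] := PG.
have G0 : G (0, 0).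
  by have := Glin (-1) _ _ Gx0 Gx0; rewrite /= scaleN1r mulN1r !addNr.
have GZ (t : R) u : G u -> G (t *: u.1, t * u.2).
  by move=> Gu; have := Glin t _ _ Gu G0; rewrite /= !addr0.
pose E := [set u.2 - nrm (u.1 - v) | u in G].
have Eub u : G u -> ubound E (nrm (u.1 + v) - u.2).
  move=> Gu _ [w Gw <-]; have [mu _] := Gdom _ Gu; have [mw _] := Gdom _ Gw.
  rewrite lerBrDr addrAC lerBlDr.
  have := Glin 1 _ _ Gu Gw; rewrite scale1r mul1r => /Gdom[/= _ h].
  rewrite addrC (le_trans h)//.
  have -> : u.1 + w.1 = (u.1 + v) + (w.1 - v) by rewrite addrACA subrr addr0.
  by apply: nrmD => //; [exact: memberD|exact: memberB].
have hE : has_sup E.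
  split; [exists (0 - nrm (0 - v)); exists (0, 0)|] => //.
  by exists (nrm (x0 + v) - nrm x0); exact: Eub Gx0.
pose c := sup E.
have cle u : G u -> u.2 + c <= nrm (u.1 + v).
  by move=> Gu; rewrite -lerBrDl; apply: (ge_sup hE.1); exact: Eub.
have lec u : G u -> u.2 - c <= nrm (u.1 - v).
  by move=> Gu; rewrite lerBlDl -lerBlDr; apply: (sup_upper_bound hE); exists u.
pose G' := [set w : A * R | exists u (t : R), G u /\ w = (u.1 + t *: v, u.2 + t * c)].
have GG' : G `<=` G'.
  by move=> [x r] Gu; exists (x, r), 0; split => //=; rewrite scale0r mul0r !addr0.
exists c; apply: (maxG G') => //; last first.
  by exists (0, 0), 1; split => //=; rewrite scale1r mul1r !add0r.
split; last by move=> _ _; exact: GG'.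
- move=> a _ _ [u [t [Gu ->]]] [w [s [Gw ->]]].
  exists (a *: u.1 + w.1, a * u.2 + w.2), (a * t + s); split; first exact: Glin.
  rewrite /=; congr pair; last by ring.
  by rewrite scalerDr scalerA scalerDl addrACA.
- move=> _ [u [t [Gu ->]]] /=; have [mu dom] := Gdom _ Gu.
  split; first by apply: memberD => //; exact: memberZ.
  have [t0|t0|->] := ltgtP t 0; last by rewrite scale0r mul0r !addr0.
  + have Nt0 : 0 < - t by rewrite oppr_gt0.
    have := lec _ (GZ (- t)^-1 _ Gu); rewrite /= => h.
    have -> : u.1 + t *: v = (- t) *: ((- t)^-1 *: u.1 - v).
      by rewrite scalerBr scalerA divff ?gt_eqF// scale1r scaleNr opprK.
    have -> : u.2 + t * c = (- t) * ((- t)^-1 * u.2 - c).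
      by rewrite mulrBr mulrA divff ?gt_eqF// mul1r mulNr opprK.
    rewrite nrmZ ?gtr0_norm// ?ler_pM2l//.
    by apply: memberB => //; exact: memberZ.
  + have := cle _ (GZ t^-1 _ Gu); rewrite /= => h.
    have -> : u.1 + t *: v = t *: (t^-1 *: u.1 + v).
      by rewrite scalerDr scalerA divff ?gt_eqF// scale1r.
    have -> : u.2 + t * c = t * (t^-1 * u.2 + c).
      by rewrite mulrDr mulrA divff ?gt_eqF// mul1r.
    rewrite nrmZ ?gtr0_norm// ?ler_pM2l//.
    by apply: memberD => //; exact: memberZ.
Qed.

Lemma hahn_banach : exists phi : A -> R^o,
  [/\ forall (a : R) x y, member A x -> member A y ->
        phi (a *: x + y) = a * phi x + phi y,
      forall x, member A x -> `|phi x| <= nrm x &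
      phi x0 = nrm x0].
Proof.
have [G PG [Gx0 maxG]] := maximal_partial.
have Gtot := partial_total PG Gx0 maxG.
have [Glin Gdom _] := PG.
have Guniq x r s : G (x, r) -> G (x, s) -> r <= s.
  move=> Gr Gs; have := Glin (-1) _ _ Gs Gr; rewrite /= scaleN1r addNr mulN1r.
  by move=> /Gdom[/= _]; rewrite nrm0// addrC subr_le0.
pose phi x : R^o := xget 0 [set r | G (x, r)].
have Gphi x : member A x -> G (x, phi x).
  by move=> /Gtot[r Gr]; rewrite /phi; case: xgetP => [_ -> //|/(_ r)].
have phiE x r : G (x, r) -> phi x = r.
  move=> Gr; have [/= mx _] := Gdom _ Gr; have Gp := Gphi _ mx.
  by apply/eqP; rewrite eq_le !(Guniq x).
exists phi; split; last exact: phiE.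
  by move=> a x y mx my; apply: phiE; exact: Glin (Gphi _ mx) (Gphi _ my).
have le x : member A x -> phi x <= nrm x by move=> /Gphi/Gdom[].
move=> x mx; rewrite ler_norml le// andbT lerNl.
have mN : member A (- x) by rewrite -scaleN1r; exact: memberZ.
rewrite -(nrmN sA mx) (le_trans _ (le _ mN))//.
have phi0 : phi 0 = 0.
  apply: phiE; have := Glin (-1) _ _ Gx0 Gx0.
  by rewrite /= scaleN1r mulN1r !addNr.
suff -> : phi (- x) = - phi x by [].
apply: phiE; have := Glin (-1) _ _ (Gphi _ mx) (Gphi _ (member0 sA)).
by rewrite /= scaleN1r mulN1r phi0 !addr0.
Qed.

End HahnBanach.

Lemma dual_bound A (phi : A -> R^o) : seminormed A -> member (dual A) phi ->
  exists2 C : R, 0 <= C & forall x, member A x -> `|phi x| <= C * nrm x.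
Proof.
move=> sA [_ _ [C hC]]; exists (Num.max C 0); first by rewrite le_max lexx orbT.
move=> x mx; have := hC x mx; rewrite /= (nrmE sA)// -EFinM lee_fin => /le_trans; apply.
by rewrite ler_wpM2r ?nrm_ge0// le_max lexx.
Qed.

Lemma dual_lin A (phi : A -> R^o) : member (dual A) phi ->
  forall (a : R) x y, member A x -> member A y ->
    phi (a *: x + y) = a * phi x + phi y.
Proof.
move=> [_ lin _] a x y mx my; have := lin a x y mx my.
rewrite /same /= => -[] /eqP; rewrite normr_eq0 subr_eq0 => /eqP.
exact.
Qed.

Lemma dualP A (phi : A -> R^o) :
  (forall (a : R) x y, member A x -> member A y ->
     phi (a *: x + y) = a * phi x + phi y) ->
  (exists C : R, forall x, member A x -> (`|phi x|%:E <= C%:E * snorm A x)%E) ->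
  member (dual A) phi.
Proof.
move=> lin bd; split => // a x y mx my.
by rewrite /same/= lin// subrr normr0.
Qed.

Lemma dual_sub A (phi : A -> R^o) x y : member (dual A) phi ->
  member A x -> member A y -> phi (x - y) = phi x - phi y.
Proof.
move=> dphi mx my.
by rewrite addrC -scaleN1r dual_lin// mulN1r addrC.
Qed.

(** Functionals cannot distinguish representatives of one element; this is how uniqueness up to
    [same] pins down a weak limit. *)
Lemma dual_same A (phi : A -> R^o) x y : member (dual A) phi ->
  member A x -> member A y -> member A (x - y) -> same x y -> phi x = phi y.
Proof.
move=> dphi mx my mxy xy0; apply/eqP; rewrite -subr_eq0 -(dual_sub dphi mx my).
have [_ _ [C /(_ _ mxy)]] := dphi; rewrite xy0 mule0 lee_fin normr_le0; exact.
Qed.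

Lemma dual_separates A : seminormed A -> forall x, member A x ->
  exists2 phi, member (dual A) phi &
    phi x = nrm x /\ forall y, member A y -> `|phi y| <= nrm y.
Proof.
move=> sA x mx; have [phi [lin bd phix]] := hahn_banach sA mx.
exists phi => //; apply: dualP => //; exists 1 => y my.
by rewrite mul1e (nrmE sA)// lee_fin; exact: bd.
Qed.

Lemma dual_eq0 A x : seminormed A -> member A x ->
  (forall phi, member (dual A) phi -> phi x = 0) -> snorm A x = 0%E.
Proof.
move=> sA mx h; have [phi dphi [phix _]] := dual_separates sA mx.
by rewrite (nrmE sA)// -phix h.
Qed.

End SeminormedSpaces.

(** * The uniform boundedness principle *)

Section UniformBoundedness.
Context {R : realType}.
Variables (A : fspace R) (sA : seminormed A).

Lemma norm_add_or_sub (a b : R) : `|b| <= `|a + b| \/ `|b| <= `|a - b|.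
Proof.
case: (lerP `|b| `|a + b|) => [|h]; first by left.
right; have : `|2 * b| <= `|a + b| + `|a - b|.
  by rewrite (_ : 2 * b = (a + b) - (a - b)); [exact: ler_normB|ring].
rewrite normrM ger0_norm// => h2; lra.
Qed.

Lemma geometric_third (k : nat) : 3^-1 ^+ k.+1 = 3^-1 * 3^-1 ^+ k :> R.
Proof. by rewrite exprS. Qed.

(* Gliding hump: [phi] is a signed series of the functionals [3^-k psi_k], where
   [psi_k] norms a point of norm at least [k 3^k] and the sign is chosen so that
   the k-th partial sum does not cancel. *)
Lemma uniform_boundedness (x_ : nat -> A) : (forall n, member A (x_ n)) ->
  (forall phi, member (dual A) phi -> exists C : R, forall n, `|phi (x_ n)| <= C) ->
  exists2 C : R, 0 < C & forall n, nrm (x_ n) <= C.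
Proof.
move=> mx hphi; apply: contrapT => unb.
have big (C : R) : exists n, C < nrm (x_ n).
  apply: contrapT => nC; apply: unb; exists (Num.max C 1); first by rewrite lt_max ltr01 orbT.
  by move=> n; rewrite le_max leNgt; apply/orP; left; apply/negP => h; apply: nC; exists n.
have /choice[i iP] : forall k : nat, exists n, (k%:R * 3 ^+ k : R) < nrm (x_ n) by move=> k; exact: big.
have /choice[psi psiP] : forall k, exists psi : A -> R^o,
    [/\ forall (a : R) x y, member A x -> member A y ->
        psi (a *: x + y) = a * psi x + psi y,
      forall x, member A x -> `|psi x| <= nrm x &
      psi (x_ (i k)) = nrm (x_ (i k))].
  by move=> k; exact: (hahn_banach sA (mx (i k))).
pose r k : R := 3^-1 ^+ k.
have r0 k : 0 < r k by rewrite exprn_gt0.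
pose step k (f : A -> R) : A -> R := fun y =>
  if r k * nrm (x_ (i k)) <= `|f (x_ (i k)) + r k * psi k (x_ (i k))|
  then f y + r k * psi k y else f y - r k * psi k y.
pose phi_ := fix phi_ k : A -> R := if k is k'.+1 then step k' (phi_ k') else fun=> 0.
have lin k (a : R) x y : member A x -> member A y ->
    phi_ k (a *: x + y) = a * phi_ k x + phi_ k y.
  move=> mx' my; elim: k => [|k ih] /=; first by rewrite mulr0 addr0.
  have [pl _ _] := psiP k.
  by rewrite /step; case: ifP => _; rewrite ih pl//; ring.
have diff k y : member A y -> `|phi_ k.+1 y - phi_ k y| <= r k * nrm y.
  move=> my /=; have [_ pb _] := psiP k.
  suff h : `|r k * psi k y| <= r k * nrm y.
    by rewrite /step; case: ifP => _; rewrite addrAC subrr add0r ?normrN.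
  by rewrite normrM gtr0_norm// ler_pM2l// pb.
have hump k : r k * nrm (x_ (i k)) <= `|phi_ k.+1 (x_ (i k))|.
  rewrite /= /step; case: ifP => // /negbT; rewrite -ltNge => h.
  have [_ _ pe] := psiP k.
  have := norm_add_or_sub (phi_ k (x_ (i k))) (r k * psi k (x_ (i k))).
  have -> : `|r k * psi k (x_ (i k))| = r k * nrm (x_ (i k)).
    by rewrite pe ger0_norm// mulr_ge0 ?nrm_ge0// ltW.
  by case=> // h2; move: h; rewrite ltNge h2.
(* The sum of 3^-l over l >= k is 3/2 * 3^-k, which bounds the tail of the series. Hence [u y]
   increases, [v y] decreases, and both enclose the limit; defining [phi y] as a supremum yields the
   limit together with the error bound. *)
pose u y k := phi_ k y - 3 / 2 * r k * nrm y.
pose v y k := phi_ k y + 3 / 2 * r k * nrm y.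
have rS k : r k.+1 = 3^-1 * r k by rewrite /r geometric_third.
have ndu y : member A y -> nondecreasing_seq (u y).
  move=> my; apply/nondecreasing_seqP => k; have := diff k _ my.
  by rewrite /u rS ler_norml => /andP[h _]; lra.
have niv y : member A y -> nonincreasing_seq (v y).
  move=> my; apply/nonincreasing_seqP => k; have := diff k _ my.
  by rewrite /v rS ler_norml => /andP[_ h]; lra.
have uv y k l : member A y -> u y k <= v y l.
  move=> my; apply: (@le_trans _ _ (u y (maxn k l))).
    by apply: (ndu _ my); rewrite leq_maxl.
  apply: (@le_trans _ _ (v y (maxn k l))); last first.
    by apply: (niv _ my); rewrite leq_maxr.
  have := mulr_ge0 (ltW (r0 (maxn k l))) (nrm_ge0 sA my).
  by rewrite /u /v => h; lra.
pose phi y : R^o := sup (range (u y)).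
have phiuv y k : member A y -> u y k <= phi y <= v y k.
  move=> my; apply/andP; split.
    apply: sup_upper_bound; last by exists k.
    by split; [exists (u y 0%N); exists 0%N|exists (v y 0%N) => _ [l _ <-]; exact: uv].
  apply: ge_sup; first by exists (u y 0%N); exists 0%N.
  by move=> _ [l _ <-]; exact: uv.
have near y k : member A y -> `|phi y - phi_ k y| <= 3 / 2 * r k * nrm y.
  move=> /(phiuv y k); rewrite /u /v ler_norml => /andP[h1 h2].
  by apply/andP; split; lra.
have rcvg : r @ \oo --> (0 : R).
  by apply: cvg_expr; rewrite ger0_norm ?invr_ge0// invf_lt1// ltr1n.
have cvgphi y : member A y -> phi_ k y @[k --> \oo] --> phi y.
  move=> my; apply/cvgrPdist_le => e e0.
  have : 3 / 2 * r k * nrm y @[k --> \oo] --> (0 : R).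
    rewrite (_ : 0 = 3 / 2 * 0 * nrm y :> R); last by rewrite mulr0 mul0r.
    by apply: cvgM; [apply: cvgM; [exact: cvg_cst|exact: rcvg]|exact: cvg_cst].
  move/cvgrPdist_le => /(_ e e0); apply: filterS => k.
  rewrite sub0r normrN; apply: le_trans; apply: le_trans (near _ _ my) _.
  exact: ler_norm.
have dphi : member (dual A) phi.
  apply: dualP => //.
    move=> a x y mx' my.
    have h1 := cvgphi _ (member_lin sA a mx' my).
    have h2 : phi_ k (a *: x + y) @[k --> \oo] --> a * phi x + phi y.
      rewrite (_ : (fun k => _) = (fun k => a * phi_ k x + phi_ k y)).
        by apply: cvgD; [apply: cvgM; [exact: cvg_cst|exact: cvgphi]|exact: cvgphi].
      by apply/funext => k; rewrite lin.
    exact: (cvg_unique _ h1 h2).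
  exists (3 / 2) => y my; have := near y 0%N my.
  by rewrite (nrmE sA)// -EFinM lee_fin /= subr0 /r expr0 mulr1.
have [C hC] := hphi _ dphi.
(* The tail beyond the k-th hump is at most 3/2 * 3^-(k+1), half of 3^-k, times the norm of the
   point. At least half of the hump, whose size is at least k, survives; the ratio 1/3 is chosen for
   this. *)
have low k : k%:R / 2 <= C.
  apply: (le_trans _ (hC (i k))).
  have h1 := near (x_ (i k)) k.+1 (mx _); have h2 := hump k.
  have h3 : `|phi_ k.+1 (x_ (i k))| <=
      `|phi (x_ (i k))| + `|phi (x_ (i k)) - phi_ k.+1 (x_ (i k))|.
    rewrite -{1}[phi_ k.+1 (x_ (i k))](subKr (phi (x_ (i k)))).
    exact: ler_normB.
  have h4 : k%:R <= r k * nrm (x_ (i k)).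
    by rewrite /r exprVn mulrC ler_pdivlMr ?exprn_gt0// ltW.
  rewrite rS in h1; lra.
have := archi_boundP (_ : 0 <= 2 * `|C|); rewrite ?mulr_ge0// => /(_ isT).
have := low (Num.bound (2 * `|C|)); have := ler_norm C; lra.
Qed.

End UniformBoundedness.

Section WeakConvergence.
Context {R : realType}.
Implicit Types A B : fspace R.

Lemma weak_cvg_bounded A (x_ : nat -> A) x : seminormed A -> weak_cvg x_ x ->
  exists2 C : R, 0 < C & forall n, nrm (x_ n) <= C.
Proof.
move=> sA [mx_ mx cx]; apply: uniform_boundedness => // phi /cx cphi.
have /cvg_seq_bounded[M [Mr hM]] : cvgn (phi \o x_) by apply/cvg_ex; exists (phi x).
exists (M + 1) => n; apply: (hM (M + 1)) => //; by rewrite ltrDl.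
Qed.

(** Of the domain only closure under linear combinations is asked, so that [Vcal] is a possible [A].
    Since [f] is linear only up to [same], linearity of the composite uses the bound of [phi] on
    B. *)
Lemma dual_comp A B (f : A -> B) (phi : B -> R^o) :
  (forall (a : R) x y, member A x -> member A y -> member A (a *: x + y)) ->
  seminormed B -> bounded_linear f -> member (dual B) phi ->
  member (dual A) (phi \o f).
Proof.
move=> lA sB [mf lf [C hC]] dphi; have [D D0 hD] := dual_bound sB dphi.
apply: dualP => [a x y mx my|]/=; last first.
  exists (D * C) => x mx; apply: (@le_trans _ _ (D%:E * snorm B (f x))%E).
    rewrite (nrmE sB (mf _ mx)). by rewrite -EFinM lee_fin; apply: hD; exact: mf.
  rewrite EFinM -muleA; apply: lee_wpmul2l; first by rewrite lee_fin.
  exact: hC.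
have m1 := mf _ (lA a _ _ mx my).
have m2 := member_lin sB a (mf _ mx) (mf _ my).
rewrite /= -(dual_lin dphi a (mf _ mx) (mf _ my)).
apply: subr0_eq; apply/eqP; rewrite -(dual_sub dphi)// -normr_le0.
have := hD _ (memberB sB m1 m2).
rewrite {1}/nrm (lf a _ _ mx my) /= mulr0; exact.
Qed.

Lemma weak_cvg_comp A B (f : A -> B) x_ x :
  (forall (a : R) x y, member A x -> member A y -> member A (a *: x + y)) ->
  seminormed B -> bounded_linear f -> weak_cvg x_ x -> weak_cvg (f \o x_) (f x).
Proof.
move=> lA sB bf [mx_ mx cx]; split.
- by move=> n; case: bf => mf _ _; exact: mf.
- by case: bf => mf _ _; exact: mf.
- by move=> phi dphi; apply: (cx (phi \o f)); exact: dual_comp.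
Qed.

(** The counterpart of [weak_cvg_comp] for a target such as [Vcal] that is not known to be
    seminormed: [f] is exactly linear and contracting, as for inclusions and coordinate maps. The
    lower bound 0 allows the constant of the functional to be enlarged to a nonnegative one. *)
Lemma weak_cvg_linear A B (f : A -> B) x_ x :
  (forall x, member A x -> member B (f x)) ->
  (forall (a : R) x y, f (a *: x + y) = a *: f x + f y) ->
  (forall x, member A x -> (0 <= snorm B (f x) <= snorm A x)%E) ->
  weak_cvg x_ x -> weak_cvg (f \o x_) (f x).
Proof.
move=> mf lf bf [mx_ mx cx]; split.
- by move=> n; exact: mf.
- exact: mf.
- move=> phi dphi; apply: (cx (phi \o f)); apply: dualP => [a y z my mz|]/=.
    by rewrite lf (dual_lin dphi)//; exact: mf.
  have [_ _ [C hC]] := dphi; exists (Num.max C 0) => y my.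
  have /andP[s0 sle] := bf _ my.
  apply: (le_trans (hC _ (mf _ my))).
  apply: (@le_trans _ _ ((Num.max C 0)%:E * snorm B (f y))%E).
    by apply: lee_wpmul2r => //; rewrite lee_fin le_max lexx.
  by apply: lee_wpmul2l => //; rewrite lee_fin le_max lexx orbT.
Qed.

Lemma increasing_index_ge (s : nat -> nat) n : increasing_index s -> (n <= s n)%N.
Proof.
by move=> hs; elim: n => // n ih; apply: leq_ltn_trans ih _; exact: hs.
Qed.

Lemma increasing_index_cvg (s : nat -> nat) :
  increasing_index s -> s n @[n --> \oo] --> \oo.
Proof.
move=> hs P [N _ hN]; exists N => // n /= Nn; apply: hN => /=.
exact: leq_trans Nn (increasing_index_ge _ hs).
Qed.

Lemma increasing_index_comp (s s' : nat -> nat) :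
  increasing_index s -> increasing_index s' -> increasing_index (s \o s').
Proof. by move=> hs hs' i j /hs' /hs. Qed.

Lemma cvg_subseq (T : topologicalType) (u : nat -> T) (l : T) (s : nat -> nat) :
  increasing_index s -> u @ \oo --> l -> (u \o s) @ \oo --> l.
Proof. by move=> /increasing_index_cvg hs ul; apply: cvg_comp hs ul. Qed.

Lemma weak_cvg_subseq A (x_ : nat -> A) x (s : nat -> nat) :
  increasing_index s -> weak_cvg x_ x -> weak_cvg (x_ \o s) x.
Proof.
move=> hs [mx_ mx cx]; split => // [n|phi /cx h]; first exact: mx_.
exact: (cvg_subseq hs h).
Qed.

Lemma extract_increasing (P : nat -> nat -> Prop) :
  (forall k N, exists2 n, (N <= n)%N & P k n) ->
  exists2 s, increasing_index s & forall k, P k (s k).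
Proof.
move=> hP.
have /choice[g gP] : forall p : nat * nat, exists n, (p.2 <= n)%N /\ P p.1 n.
  by move=> [k N]; have [n] := hP k N; exists n.
pose s := fix s k := if k is k'.+1 then g (k, (s k').+1) else g (0, 0)%N.
exists s; last by case=> [|k]; [have [] := gP (0, 0)%N|have [] := gP (k.+1, (s k).+1)].
by apply: (homo_ltn ltn_trans) => k /=; have [] := gP (k.+1, (s k).+1).
Qed.

(** Otherwise a neighbourhood of [l] is missed along a whole subsequence, none of whose subsequences
    converges to [l]. *)
Lemma subseq_principle (T : topologicalType) (u : nat -> T) (l : T) :
  (forall s, increasing_index s ->
     exists2 s', increasing_index s' & (u \o s \o s') @ \oo --> l) ->
  u @ \oo --> l.
Proof.
move=> h; apply: contrapT => nul.
have [U Ul nU] : exists2 U, nbhs l U & forall N, exists2 n, (N <= n)%N & ~ U (u n).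
  apply: contrapT => nU; apply: nul => U Ul; apply: contrapT => nu; apply: nU.
  exists U => // N; apply: contrapT => nN; apply: nu; exists N => // n /= Nn.
  by apply: contrapT => nUn; apply: nN; exists n.
have [s hs sU] := extract_increasing (fun _ => nU).
have [s' hs' /(_ _ Ul)[N _ /(_ N (leqnn N))]] := h _ hs.
exact: sU.
Qed.

End WeakConvergence.

(** * Almost everywhere convergence and nonmeasurable integrands *)

Section AlmostEverywhere.
Context d (T : measurableType d) (R : realType).
Variable mu : {measure set T -> \bar R}.

Lemma aeS (P Q : T -> Prop) : {ae mu, forall x, P x} ->
  (forall x, P x -> Q x) -> {ae mu, forall x, Q x}.
Proof. by move=> HP PQ; apply: filterS HP. Qed.

Lemma ae2 (P1 P2 Q : T -> Prop) : {ae mu, forall x, P1 x} ->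
  {ae mu, forall x, P2 x} ->
  (forall x, P1 x -> P2 x -> Q x) -> {ae mu, forall x, Q x}.
Proof. by move=> H1 H2 PQ; apply: filterS2 H1 H2. Qed.

Lemma ae3 (P1 P2 P3 Q : T -> Prop) : {ae mu, forall x, P1 x} ->
  {ae mu, forall x, P2 x} -> {ae mu, forall x, P3 x} ->
  (forall x, P1 x -> P2 x -> P3 x -> Q x) -> {ae mu, forall x, Q x}.
Proof. by move=> H1 H2 H3 PQ; apply: filterS3 H1 H2 H3. Qed.

Lemma ae4 (P1 P2 P3 P4 Q : T -> Prop) : {ae mu, forall x, P1 x} ->
  {ae mu, forall x, P2 x} -> {ae mu, forall x, P3 x} ->
  {ae mu, forall x, P4 x} ->
  (forall x, P1 x -> P2 x -> P3 x -> P4 x -> Q x) -> {ae mu, forall x, Q x}.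
Proof.
move=> H1 H2 H3 H4 PQ; have H : {ae mu, forall x, P3 x /\ P4 x} by exact: ae2 H3 H4 _.
by apply: ae3 H1 H2 H _ => x p1 p2 [p3 p4]; exact: PQ.
Qed.

End AlmostEverywhere.

Section LowerIntegral.
Context d (T : measurableType d) (R : realType).
Variable mu : {measure set T -> \bar R}.
Local Open Scope ereal_scope.
Import HBNNSimple.

(* No measurability: [\int] of a nonnegative function is a supremum over simple
   functions below it. *)
Lemma ae_le_lower_integral (D : set T) (f g : T -> \bar R) :
  (forall x, D x -> 0 <= f x) -> (forall x, D x -> 0 <= g x) ->
  {ae mu, forall x, D x -> f x <= g x} ->
  \int[mu]_(x in D) f x <= \int[mu]_(x in D) g x.
Proof.
move=> f0 g0 [N [mN N0 sN]].
rewrite !ge0_integralE//; apply: ge_ereal_sup => _ [h /= hf <-].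
(* Setting the simple function [h] to 0 on the null set [N] keeps its integral and brings it below
   [g]. *)
have mNC : measurable (~` N) by exact: measurableC.
have -> : sintegral mu h = sintegral mu (proj_nnsfun h mNC).
  rewrite -!integralT_nnsfun; apply: ge0_ae_eq_integral => //.
  - exact/measurable_EFinP.
  - exact/measurable_EFinP.
  - by move=> x _; rewrite lee_fin.
  - by move=> x _; rewrite lee_fin.
  - exists N; split => // x /= /not_implyP[_]; apply: contra_notP => Nx.
    by rewrite mindicE (_ : x \in ~` N) ?mulr1//; rewrite mem_set.
apply: ereal_sup_ubound; exists (proj_nnsfun h mNC) => // x.
have := hf x; rewrite /= mindicE /patch; have [Nx|Nx] := pselect (N x).
  have -> : (x \in ~` N) = false by rewrite memNset// => nNx; exact: nNx Nx.
  rewrite mulr0.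
  by case: ifPn => // /set_mem Dx _; exact: g0.
have -> : (x \in ~` N) by rewrite mem_set.
rewrite mulr1; case: ifPn => // /set_mem Dx /le_trans; apply.
by move: Nx; apply: contra_notP => fg; apply: sN => /= /(_ Dx).
Qed.

Lemma ae_eq_lower_integral (D : set T) (f g : T -> \bar R) :
  (forall x, D x -> 0 <= f x) -> (forall x, D x -> 0 <= g x) ->
  {ae mu, forall x, D x -> f x = g x} ->
  \int[mu]_(x in D) f x = \int[mu]_(x in D) g x.
Proof.
move=> f0 g0 fg; apply/eqP; rewrite eq_le; apply/andP; split.
  by apply: ae_le_lower_integral => //; apply: filterS fg => x /[apply] ->.
by apply: ae_le_lower_integral => //; apply: filterS fg => x /[apply] ->.
Qed.

Lemma ae_eq_integral_nonmeasurable (D : set T) (f g : T -> \bar R) :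
  {ae mu, forall x, D x -> f x = g x} ->
  \int[mu]_(x in D) f x = \int[mu]_(x in D) g x.
Proof.
move=> /ae_eq_funeposneg[fgp fgn]; rewrite integralE [RHS]integralE.
by congr (_ - _); exact: ae_eq_lower_integral.
Qed.

End LowerIntegral.

Section AlmostEverywhereSubsequences.
Context d (T : measurableType d) (R : realType).
Variable mu : {measure set T -> \bar R}.

(** Along indices where the integrals are at most 2^-(k+1), the sum of the functions has integral at
    most 1. It is therefore finite almost everywhere, and the terms of a convergent series tend to
    0. *)
Lemma ae_subseq_of_integral (D : set T) (f_ : nat -> T -> R) : measurable D ->
  (forall n, measurable_fun D (f_ n)) -> (forall n x, D x -> 0 <= f_ n x) ->
  (\int[mu]_(x in D) (f_ n x)%:E)%E @[n --> \oo] --> 0%E ->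
  exists2 s, increasing_index s &
    {ae mu, forall x, D x -> f_ (s n) x @[n --> \oo] --> 0}.
Proof.
move=> mD mf f0 If0.
have [s hs sI] : exists2 s, increasing_index s &
    forall k, (\int[mu]_(x in D) (f_ (s k) x)%:E <= (2^-1 ^+ k.+1)%:E)%E.
  apply: (extract_increasing (P := fun k n =>
    (\int[mu]_(x in D) (f_ n x)%:E <= (2^-1 ^+ k.+1)%:E)%E)) => k N.
  have e0 : 0 < 2^-1 ^+ k.+1 :> R by rewrite exprn_gt0.
  move/fine_cvgP : If0 => [[M1 _ fin] /cvgrPdist_le/(_ _ e0)[M2 _ small]].
  exists (maxn N (maxn M1 M2)); first by rewrite leq_maxl.
  set n := maxn _ _.
  have /fin h1 : (M1 <= n)%N by rewrite /n; lia.
  have /small : (M2 <= n)%N by rewrite /n; lia.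
  rewrite /= sub0r normrN => h2; rewrite -(fineK h1) lee_fin.
  exact: le_trans (ler_norm _) h2.
exists s => //.
pose F x := (\sum_(k <oo) (f_ (s k) x)%:E)%E.
have IF : (\int[mu]_(x in D) F x <= 1)%E.
  rewrite integral_nneseries//; last 2 first.
  - by move=> n; exact/measurable_EFinP.
  - by move=> n x Dx; rewrite lee_fin f0.
  apply: (@le_trans _ _ (\sum_(k <oo) (2^-1 ^+ k.+1 : R)%:E)%E).
    apply: lee_nneseries => [k _ _|k _]; last exact: sI.
    by apply: integral_ge0 => x Dx; rewrite lee_fin f0.
  have -> : (\sum_(k <oo) (2^-1 ^+ k.+1 : R)%:E = 1)%E; last by [].
  apply/cvg_lim => //.
  have := @cvg_geometric_eseries_half R 1 0; rewrite expr0 divr1.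
  set a := eseries _; set b := (fun n => _); suff -> : a = b by [].
  apply/funext => n; apply: eq_bigr => k _.
  by rewrite addn1 div1r natrX exprVn.
have mF : measurable_fun D F.
  apply: ge0_emeasurable_sum => [k x Dx _|k _]; first by rewrite lee_fin f0.
  exact/measurable_EFinP.
have F0 x : D x -> (0 <= F x)%E by move=> Dx; apply: nneseries_ge0 => k _ _; rewrite lee_fin f0.
have iF : mu.-integrable D F.
  apply/integrableP; split => //.
  under eq_integral => x /set_mem Dx do rewrite gee0_abs ?F0//.
  exact: le_lt_trans IF (ltry _).
apply: filterS (integrable_ae mD iF) => x h Dx; have {}h := h Dx.
apply: cvg_series_cvg_0.
apply: nondecreasing_is_cvgn.
  by apply/nondecreasing_seqP => n; rewrite /series/= big_nat_recr//= lerDl f0.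
exists (fine (F x)) => _ [n _ <-].
rewrite -lee_fin fineK// /series/= -sumEFin.
apply: (le_trans _ (nneseries_lim_ge n _)) => //.
by move=> k _ _; rewrite lee_fin f0.
Qed.

(* Convergence in measure in disguise; [minr _ 1] makes the dominated parts
   integrable. *)
Lemma ae_subseq_of_bounded_remainder (D : set T) (f_ a_ : nat -> T -> R)
    (g_ : R -> nat -> T -> R) (C : R) :
  measurable D -> (mu D < +oo)%E ->
  (forall n, measurable_fun D (f_ n)) -> (forall n, measurable_fun D (a_ n)) ->
  (forall (e : R) n, 0 < e -> measurable_fun D (g_ e n)) ->
  (forall n x, D x -> 0 <= f_ n x) -> (forall n x, D x -> 0 <= a_ n x) ->
  (forall (e : R) n x, 0 < e -> D x -> 0 <= g_ e n x) ->
  (forall (e : R) n x, 0 < e -> D x -> f_ n x <= e * a_ n x + g_ e n x) ->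
  (forall n, (\int[mu]_(x in D) (a_ n x)%:E <= C%:E)%E) ->
  (forall (e : R), 0 < e -> {ae mu, forall x, D x -> g_ e n x @[n --> \oo] --> 0}) ->
  exists2 s, increasing_index s &
    {ae mu, forall x, D x -> f_ (s n) x @[n --> \oo] --> 0}.
Proof.
move=> mD Dfin mf ma mg f0 a0 g0 fag aC gcvg.
pose m_ n x := Num.min (f_ n x) 1.
have mm n : measurable_fun D (m_ n) by exact: measurable_minr.
have m0 n x : D x -> 0 <= m_ n x by move=> Dx; rewrite /m_ le_min f0//=.
have Ig (e : R) : 0 < e -> (\int[mu]_(x in D) (Num.min (g_ e n x) 1)%:E)%E @[n --> \oo] --> 0%E.
  move=> e0.
  have := @dominated_convergence _ _ _ mu D mD
    (fun n x => (Num.min (g_ e n x) 1)%:E) (cst 0%E) (cst 1%E).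
  case.
  - by move=> n; apply/measurable_EFinP; apply: measurable_minr => //; exact: mg.
  - exact: measurable_cst.
  - apply: filterS (gcvg _ e0) => x h Dx; have {}h := h Dx; apply: cvg_EFin; first by near=> n.
    apply: (squeeze_cvgr _ (cvg_cst 0) h); apply: nearW => n.
    by apply/andP; split => /=; [rewrite le_min ler01 andbT; exact: g0|rewrite ge_min lexx].
  - by apply/integrableP; split; [exact: measurable_cst|rewrite /= normr1 integral_cst// mul1e].
  - apply/aeW => x n Dx /=; rewrite lee_fin ger0_norm; first by rewrite ge_min lexx orbT.
    by rewrite le_min g0//=.
  by move=> _ _; rewrite integral0.
have Im : (\int[mu]_(x in D) (m_ n x)%:E)%E @[n --> \oo] --> 0%E.
  apply/fine_cvgP.
  have bd n (e : R) : 0 < e -> (\int[mu]_(x in D) (m_ n x)%:E <= e%:E * C%:E +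
      \int[mu]_(x in D) (Num.min (g_ e n x) 1)%:E)%E.
    move=> e0; have mmin : measurable_fun D (fun x => (Num.min (g_ e n x) 1)%:E).
      by apply/measurable_EFinP; apply: measurable_minr => //; exact: mg.
    apply: (@le_trans _ _ (\int[mu]_(x in D) (e%:E * (a_ n x)%:E + (Num.min (g_ e n x) 1)%:E))%E).
      apply: ge0_le_integral => //.
      - by move=> x Dx; rewrite lee_fin m0.
      - exact/measurable_EFinP.
      - by apply: emeasurable_funD => //; apply: measurable_funeM; exact/measurable_EFinP.
      - move=> x Dx; rewrite -EFinM -EFinD lee_fin /m_.
        have := fag e n x e0 Dx; have := a0 n x Dx.
        have := g0 e n x e0 Dx => g1 a1 h; have ea : 0 <= e * a_ n x by rewrite mulr_ge0// ltW.
        by rewrite /Num.min; case: ifP => h1; case: ifP => h2; lra.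
    rewrite ge0_integralD//; last 3 first.
    - by move=> x Dx; rewrite mule_ge0// lee_fin ?(ltW e0)// a0.
    - by apply: measurable_funeM; exact/measurable_EFinP.
    - by move=> x Dx; rewrite lee_fin le_min g0//=.
    rewrite leeD2r// ge0_integralZl//; last 3 first.
    - exact/measurable_EFinP.
    - by move=> x Dx; rewrite lee_fin a0.
    - by rewrite lee_fin ltW.
    by rewrite lee_wpmul2l// lee_fin ltW.
  have I0 n : (0 <= \int[mu]_(x in D) (m_ n x)%:E)%E.
    by apply: integral_ge0 => x Dx; rewrite lee_fin m0.
  have fin n : (\int[mu]_(x in D) (m_ n x)%:E)%E \is a fin_num.
    rewrite ge0_fin_numE//; apply: (@le_lt_trans _ _ (\int[mu]_(x in D) 1)%E); last first.
      by rewrite integral_cst// mul1e.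
    apply: ge0_le_integral => //.
    - by move=> x Dx; rewrite lee_fin m0.
    - exact/measurable_EFinP.
    - by move=> x Dx; rewrite lee_fin /m_ ge_min lexx orbT.
  split; first exact: nearW.
  apply/cvgrPdist_le => e e0.
  have C0 : 0 <= C.
    rewrite -lee_fin; apply: le_trans (aC 0%N).
    by apply: integral_ge0 => x Dx; rewrite lee_fin a0.
  have C1 : 0 < C + 1 by rewrite ltr_pwDr.
  (* With this weight the dominated part contributes at most e / 2; adding 1 to [C] covers the case
     C = 0. *)
  have e1 : 0 < e / 2 / (C + 1) by rewrite !divr_gt0.
  have e2 : 0 < e / 2 by rewrite divr_gt0.
  move/fine_cvgP : (Ig _ e1) => [h1 /cvgrPdist_le/(_ _ e2) h2].
  near=> n; rewrite sub0r normrN /= ger0_norm ?fine_ge0// -lee_fin fineK//.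
  apply: (le_trans (bd n _ e1)).
  have /fineK <- : (\int[mu]_(x in D) (Num.min (g_ (e / 2 / (C + 1)) n x) 1)%:E)%E \is a fin_num.
    by near: n.
  rewrite -EFinM -EFinD lee_fin.
  have : `|0 - fine (\int[mu]_(x in D) (Num.min (g_ (e / 2 / (C + 1)) n x) 1)%:E)| <= e / 2.
    by near: n.
  rewrite sub0r normrN => /(le_trans (ler_norm _)) h3.
  have h4 : e / 2 / (C + 1) * C <= e / 2.
    by rewrite -mulrA ler_piMr ?(ltW e2)// mulrC ler_pdivrMr// mul1r lerDl.
  lra.
have [s hs cs] := ae_subseq_of_integral mD mm m0 Im.
exists s => //; apply: filterS cs => x h Dx; have {}h := h Dx.
apply/cvgrPdist_lt => e e0.
(* Below the threshold 1 the truncation is inactive, so [m_] equals [f_] there. *)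
have /cvgrPdist_lt/(_ (Num.min e 1)) := h; rewrite lt_min e0 ltr01 => /(_ isT).
apply: filterS => n; rewrite !sub0r !normrN !ger0_norm ?f0// ?m0//.
by rewrite /m_ /Num.min; case: ifP => h1; case: ifP => h2; lra.
Unshelve. all: by end_near.
Qed.

End AlmostEverywhereSubsequences.

(** * Bochner spaces *)

Section SimpleFunctions.
Context {R : realType}.
Local Notation mR := (measurableTypeR R).
Local Notation leb := (@lebesgue_measure R).
Implicit Types E : normedModType R.

Lemma simple_measurable_preimage E (s : R -> E) (B : set E) :
  simple_fun s -> measurable (s @^-1` B : set mR).
Proof.
move=> [fs ms].
have -> : s @^-1` B = \bigcup_(v in range s `&` B) (s @^-1` [set v]).
  apply/seteqP; split=> [t Bt|t [v [_ Bv] stv]]; last by rewrite /preimage /= stv.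
  by exists (s t) => //; split => //; exists t.
by apply: fin_bigcup_measurable => //; exact: finite_setIl.
Qed.

Lemma simple_map E E' (F : E -> E') (s : R -> E) :
  simple_fun s -> simple_fun (F \o s).
Proof.
move=> ss; split=> [|v].
  have [fs _] := ss; apply: (sub_finite_set _ (finite_image F fs)) => _ [t _ <-].
  by exists (s t) => //; exists t.
by rewrite comp_preimage; exact: simple_measurable_preimage.
Qed.

Lemma simple_pair E E' (s : R -> E) (s' : R -> E') :
  simple_fun s -> simple_fun s' -> simple_fun (fun t => (s t, s' t) : E * E').
Proof.
move=> [fs ms] [fs' ms']; split.
  apply: (sub_finite_set _ (finite_setX fs fs')) => _ [t _ <-].
  by split; exists t.
move=> [v v'].
rewrite (_ : _ @^-1` _ = s @^-1` [set v] `&` s' @^-1` [set v']); first exact: measurableI.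
by apply/seteqP; split => t /= [-> ->].
Qed.

Lemma simple_cst E (v : E) : simple_fun (fun=> v).
Proof.
split=> [|w].
  by apply: (sub_finite_set _ (finite_set1 v)) => _ [t _ <-].
have [->|vw] := pselect (v = w).
  by rewrite (_ : _ @^-1` _ = setT)//; apply/seteqP; split => t.
by rewrite (_ : _ @^-1` _ = set0)//; apply/seteqP; split => // t /= /vw.
Qed.

Lemma simple_restrict E (s : R -> E) (D : set mR) : measurable D ->
  simple_fun s -> simple_fun (fun t => if t \in D then s t else 0).
Proof.
move=> mD [fs ms]; split.
  apply: (sub_finite_set _ (_ : finite_set (range s `|` [set 0]))).
    move=> _ [t _ <-]; case: ifPn => _; last by right.
    by left; exists t.
  by rewrite finite_setU; split.
move=> v; rewrite (_ : _ @^-1` _ = (s @^-1` [set v] `&` D) `|`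
    (~` D `&` [set t | 0 = v])); last first.
  apply/seteqP; split=> t /=.
    case: ifPn => [/set_mem Dt <-|/negP nD <-]; first by left.
    by right; split => // Dt; apply: nD; exact: mem_set.
  by case=> [[sv Dt]|[nD v0]]; [rewrite mem_set|rewrite memNset].
apply: measurableU; first exact: measurableI.
apply: measurableI; first exact: measurableC.
have [->|v0] := pselect (0 = v).
  by rewrite (_ : [set _ | _] = setT)//; apply/seteqP; split => t.
by rewrite (_ : [set _ | _] = set0)//; apply/seteqP; split => // t /= /v0.
Qed.

(** The everywhere version of [strongly_measurable]. It is stable under continuous maps, and
    real-valued continuous images are genuinely measurable, as the integration theorems require. *)
Definition pointwise_simple E (g : R -> E) := exists2 s_ : nat -> R -> E,
  (forall n, simple_fun (s_ n)) & forall t, s_ n t @[n --> \oo] --> g t.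

Lemma pointwise_simple_measurable E (g : R -> E) (q : E -> R^o) :
  pointwise_simple g -> continuous q ->
  measurable_fun (setT : set mR) (q \o g : mR -> R).
Proof.
move=> [s_ ss sg] cq.
apply: (@measurable_fun_cvg _ _ _ _ (fun n => q \o s_ n)) => [n|t _].
  move=> _ B mB; rewrite setTI comp_preimage; exact: simple_measurable_preimage.
by apply: (continuous_cvg _ (cq _)); exact: sg.
Qed.

Lemma pointwise_simple_continuous E E' (g : R -> E) (F : E -> E') :
  pointwise_simple g -> continuous F -> pointwise_simple (F \o g).
Proof.
move=> [s_ ss sg] cF; exists (fun n => F \o s_ n) => [n|t]; first exact: simple_map.
by apply: (continuous_cvg _ (cF _)); exact: sg.
Qed.

Lemma pointwise_simple_pair E E' (g : R -> E) (g' : R -> E') :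
  pointwise_simple g -> pointwise_simple g' ->
  pointwise_simple (fun t => (g t, g' t) : E * E').
Proof.
move=> [s_ ss sg] [s'_ ss' sg']; exists (fun n t => (s_ n t, s'_ n t)) => [n|t].
  exact: simple_pair.
by apply: cvg_pair; [exact: sg|exact: sg'].
Qed.

Lemma pointwise_simple_lin E (a : R) (g g' : R -> E) :
  pointwise_simple g -> pointwise_simple g' ->
  pointwise_simple (fun t => a *: g t + g' t).
Proof.
move=> pg pg'.
apply: (pointwise_simple_continuous (F := fun p : E * E => a *: p.1 + p.2)
  (pointwise_simple_pair pg pg')).
move=> p; apply: cvgD; last exact: cvg_snd.
by apply: cvgZl_tmp; exact: cvg_fst.
Qed.

Lemma pointwise_simple_strongly E T (g : R -> E) :
  pointwise_simple g -> strongly_measurable T g.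
Proof.
by move=> [s_ ss sg]; exists s_ => //; apply: aeW => t _; exact: sg.
Qed.

Lemma strongly_measurable_ae E T (f g : R -> E) :
  {ae leb, forall t, t \in `]0, T[ -> f t = g t} ->
  strongly_measurable T g -> strongly_measurable T f.
Proof.
move=> fg [s_ ss sg]; exists s_ => //; apply: (ae2 fg sg) => t h1 h2 It.
by rewrite h1//; exact: h2.
Qed.

(** The function is replaced by 0 on the exceptional null set and outside ]0,T[. Vanishing outside
    turns integrals over ]0,T[ into integrals over the line, so that the inequalities of Minkowski
    and Hölder for [Lnorm] apply. *)
Lemma strongly_measurable_repr E T (f : R -> E) : strongly_measurable T f ->
  exists2 g, pointwise_simple g &
    (forall t : R, t \notin `]0, T[ -> g t = 0) /\
    {ae leb, forall t, t \in `]0, T[ -> f t = g t}.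
Proof.
move=> [s_ ss [N [mN N0 sN]]].
pose D : set mR := `]0, T[%classic `\` N.
have mD : measurable D by exact: measurableD.
exists (fun t => if t \in D then f t else 0).
  exists (fun n t => if t \in D then s_ n t else 0) => [n|t]; first exact: simple_restrict.
  case: ifPn => [/set_mem[It nN]|_]; last exact: cvg_cst.
  move: nN; apply: contra_notP => nc; apply: sN => /= h; apply: nc; exact: h It.
split=> [t It|].
  by rewrite memNset// => -[]; rewrite /= (negbTE It).
exists N; split => // t /= /not_implyP[It]; apply: contra_notP => nN.
by rewrite mem_set.
Qed.

Lemma strongly_measurable_lin E T (a : R) (f f' : R -> E) :
  strongly_measurable T f -> strongly_measurable T f' ->
  strongly_measurable T (a *: f + f').
Proof.
move=> /strongly_measurable_repr[g pg [_ fg]] /strongly_measurable_repr[g' pg' [_ fg']].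
apply: (@strongly_measurable_ae _ _ _ (fun t => a *: g t + g' t)); last first.
  exact/pointwise_simple_strongly/pointwise_simple_lin.
by apply: (ae2 fg fg') => t h h' It; rewrite -h// -h'.
Qed.

End SimpleFunctions.

Section L2Space.
Context {R : realType}.
Local Notation mR := (measurableTypeR R).
Local Notation leb := (@lebesgue_measure R).
Implicit Types (E : normedModType R) (T : R).

Lemma measurable_norm_repr E (g : R -> E) : pointwise_simple g ->
  measurable_fun (setT : set mR) (fun t : mR => `|g t|).
Proof.
move=> pg; apply: (pointwise_simple_measurable (q := fun v : E => `|v| : R^o) pg).
exact: norm_continuous.
Qed.

Lemma sq_integral_ae E T (f g : R -> E) :
  {ae leb, forall t, t \in `]0, T[ -> f t = g t} ->
  sq_integral T f = sq_integral T g.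
Proof.
move=> fg; apply: ae_eq_integral_nonmeasurable; apply: (aeS fg) => t h It.
by rewrite h.
Qed.

Lemma sq_integral_ge0 E T (f : R -> E) : (0 <= sq_integral T f)%E.
Proof. by apply: integral_ge0 => t _; rewrite lee_fin exprn_ge0. Qed.

Lemma sq_integral_Lnorm E T (g : R -> E) : (forall t : R, t \notin `]0, T[ -> g t = 0) ->
  sqrte (sq_integral T g) = 'N[leb]_2%:E[EFin \o (fun t : mR => `|g t|%R)]%E.
Proof.
move=> g0; rewrite unlock -poweR12_sqrt ?sq_integral_ge0//; congr (_ `^ _)%E.
rewrite /sq_integral [LHS]integral_mkcond; apply: eq_integral => t _ /=.
rewrite /patch; case: ifPn => [_|/negP tI].
  by rewrite normr_id powR_mulrn.
rewrite g0 ?normr0 ?powR0//.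
by apply/negP => It; apply: tI; exact: mem_set.
Qed.

Lemma sq_integral_le E E' T (f : R -> E) (f' : R -> E') :
  (forall t, `|f t| <= `|f' t|) -> (sq_integral T f <= sq_integral T f')%E.
Proof.
move=> h; apply: ae_le_lower_integral => [t _|t _|]; rewrite ?lee_fin ?exprn_ge0//.
by apply: aeW => t _; rewrite lee_fin lerXn2r// nnegrE.
Qed.

Lemma L2_repr E T (f : R -> E) : member (L2 T E) f ->
  exists2 g, pointwise_simple g & [/\ forall t : R, t \notin `]0, T[ -> g t = 0,
    {ae leb, forall t, t \in `]0, T[ -> f t = g t} &
    sq_integral T f = sq_integral T g].
Proof.
move=> [/strongly_measurable_repr[g pg [g0 fg]] _].
by exists g => //; split => //; exact: sq_integral_ae.
Qed.

(** The scalar Minkowski inequality applied to the functions |g| and |g'|. *)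
Lemma snorm_L2_triangle E T (g g' : R -> E) :
  pointwise_simple g -> (forall t : R, t \notin `]0, T[ -> g t = 0) ->
  pointwise_simple g' -> (forall t : R, t \notin `]0, T[ -> g' t = 0) ->
  (sqrte (sq_integral T (g + g')%R) <=
   sqrte (sq_integral T g) + sqrte (sq_integral T g'))%E.
Proof.
move=> pg g0 pg' g'0.
apply: (@le_trans _ _ (sqrte (sq_integral T (fun t => `|g t| + `|g' t| : R^o)))).
  rewrite lee_sqrt ?sq_integral_ge0//; apply: sq_integral_le => t /=.
  by rewrite (le_trans (ler_normD _ _))// ler_norm.
rewrite !sq_integral_Lnorm//; last by move=> t tI; rewrite g0// g'0// !normr0 addr0.
have := @minkowski_EFin _ _ _ leb (fun t : mR => `|g t|) (fun t : mR => `|g' t|) 2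
  (measurable_norm_repr pg) (measurable_norm_repr pg') (ler1n _ 2).
apply: le_trans; rewrite le_eqVlt; apply/orP; left; apply/eqP.
by apply: eq_Lnorm => t /=; rewrite ger0_norm// addr_ge0.
Qed.

Lemma sq_integralZ E T (a : R) (g : R -> E) : pointwise_simple g ->
  sq_integral T (a *: g) = ((a ^+ 2)%:E * sq_integral T g)%E.
Proof.
move=> pg; rewrite /sq_integral -ge0_integralZl//.
- by apply: eq_integral => t _; rewrite -EFinM /= normrZ exprMn real_normK// num_real.
- apply/measurable_EFinP/measurable_funX; apply: measurable_funS (measurable_norm_repr pg) => //.
- by rewrite lee_fin sqr_ge0.
Qed.

Lemma L2_seminormed E T : seminormed (L2 T E).
Proof.
have fin (f : R -> E) : (sq_integral T f < +oo)%E -> sqrte (sq_integral T f) \is a fin_num.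
  by move=> If; rewrite sqrte_fin_num ?sq_integral_ge0// ge0_fin_numE ?sq_integral_ge0.
have nZ (a : R) (f : R -> E) : member (L2 T E) f ->
    snorm (L2 T E) (a *: f) = (`|a|%:E * snorm (L2 T E) f)%E.
  move=> /L2_repr[g pg [g0 fg Ifg]] /=.
  rewrite (@sq_integral_ae _ _ _ (a *: g)); last first.
    by apply: (aeS fg) => t h It; exact: (congr1 (fun v => a *: v) (h It)).
  rewrite sq_integralZ// Ifg sqrteM ?lee_fin ?sqr_ge0//; congr (_ * _)%E.
  by rewrite /= sqrtr_sqr.
have nD (f f' : R -> E) : member (L2 T E) f -> member (L2 T E) f' ->
    (snorm (L2 T E) (f + f')%R <= snorm (L2 T E) f + snorm (L2 T E) f')%E.
  move=> /L2_repr[g pg [g0 fg Ifg]] /L2_repr[g' pg' [g'0 fg' Ifg']] /=.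
  rewrite (@sq_integral_ae _ _ _ (g + g')); last first.
    by apply: (ae2 fg fg') => t h h' It; exact: (congr2 +%R (h It) (h' It)).
  by rewrite Ifg Ifg'; exact: snorm_L2_triangle.
have m0 : member (L2 T E) 0.
  split.
    apply: pointwise_simple_strongly.
    by exists (fun _ _ => 0) => [n|t]; [exact: simple_cst|exact: cvg_cst].
  rewrite /sq_integral (eq_integral (cst 0%E)) ?integral0// => t _.
  by rewrite /= normr0 expr0n.
have mZ (a : R) f : member (L2 T E) f -> member (L2 T E) (a *: f).
  move=> mf; have [sf If] := mf; split.
    have [s0 _] := m0; have := strongly_measurable_lin a sf s0.
    by rewrite addr0.
  have := nZ a _ mf; rewrite /= => h.
  have : sqrte (sq_integral T (a *: f)) \is a fin_num by rewrite h fin_numM//= fin.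
  by rewrite sqrte_fin_num ?sq_integral_ge0// => /fin_numPlt/andP[].
split => //.
- move=> a f f' mf mf'; split; first by case: mf mf' => sf _ [sf' _]; exact: strongly_measurable_lin.
  have : (snorm (L2 T E) (a *: f + f') < +oo)%E.
    apply: (le_lt_trans (nD _ _ (mZ a _ mf) mf')).
    have [_ If1] := mZ a _ mf; have [_ If2] := mf'.
    have /fin_numPlt/andP[_ h1] := fin _ If1; have /fin_numPlt/andP[_ h2] := fin _ If2.
    exact: lte_add_pinfty.
  rewrite /= => h; have : sqrte (sq_integral T (a *: f + f')) \is a fin_num.
    by rewrite ge0_fin_numE ?sqrte_ge0.
  by rewrite sqrte_fin_num ?sq_integral_ge0// => /fin_numPlt/andP[].
- by move=> f [_ If]; exact: fin.
Qed.

(** Hölder's inequality against the indicator of ]0,T[, whose L^2 norm is the constant; it depends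
    neither on the space nor on the function. *)
Lemma L1_le_L2 T : exists2 K : R, 0 <= K &
  forall E (g : R -> E), pointwise_simple g ->
    (forall t : R, t \notin `]0, T[ -> g t = 0) ->
    (\int[leb]_(t in `]0%R, T[) `|g t|%:E <= K%:E * sqrte (sq_integral T g))%E.
Proof.
pose one : R -> R^o := \1_(`]0, T[%classic : set mR).
have one0 (t : R) : t \notin `]0, T[ -> one t = 0.
  by move=> tI; rewrite /one indicE memNset//= => h; rewrite /= h in tI.
have fin1 : sqrte (sq_integral T one) \is a fin_num.
  rewrite sqrte_fin_num ?sq_integral_ge0// ge0_fin_numE ?sq_integral_ge0//.
  apply: (@le_lt_trans _ _ (\int[leb]_(t in `]0%R, T[) (cst 1%E t))%E).
    apply: ae_le_lower_integral => [t _|//|]; first by rewrite lee_fin exprn_ge0.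
    apply: aeW => t _; rewrite /= lee_fin /one indicE.
    by case: (_ \in _); rewrite ?normr1 ?normr0 ?expr1n ?expr0n.
  rewrite integral_cst//= mul1e; rewrite /= lebesgue_measure_itv/=.
  by case: ifP => // _; rewrite -EFinB ltry.
exists (fine (sqrte (sq_integral T one))); first by rewrite fine_ge0// sqrte_ge0.
move=> E g pg g0; rewrite fineK// !sq_integral_Lnorm//.
have mone : measurable_fun (setT : set mR) (fun t : mR => `|one t|).
  apply: measurableT_comp => //; exact: measurable_indic.
have := @hoelder _ _ _ leb (fun t : mR => `|one t|) (fun t : mR => `|g t|) 2 2
  mone (measurable_norm_repr pg).
move=> h; apply: (le_trans _ (h _ _ _)) => //; last by lra.
- rewrite Lnorm1 [leLHS]integral_mkcond; apply: ae_le_lower_integral => //.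
    by move=> t _; rewrite /patch; case: ifPn => // _; rewrite lee_fin.
  apply: aeW => t _; rewrite /patch; case: ifPn => [It|_]; last exact: abse_ge0.
  by rewrite /= lee_fin normrM !normr_id /one indicE It normr1 mul1r.
Qed.
End L2Space.

(** * Duals of normed spaces and countable separating families *)

Section NormedDual.
Context {R : realType}.
Implicit Types E : normedModType R.

Lemma nspace_seminormed E : seminormed (nspace E).
Proof.
split => //=.
- by move=> x y _ _; rewrite -EFinD lee_fin ler_normD.
- by move=> a x _; rewrite -EFinM normrZ.
Qed.

Lemma ndual_lin E (psi : nspace E -> R^o) : member (dual (nspace E)) psi ->
  forall (a : R) x y, psi (a *: x + y) = a * psi x + psi y.
Proof. by move=> dpsi a x y; exact: (dual_lin dpsi). Qed.

Lemma ndual_sub E (psi : nspace E -> R^o) : member (dual (nspace E)) psi ->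
  forall x y, psi (x - y) = psi x - psi y.
Proof. by move=> dpsi x y; exact: (dual_sub dpsi). Qed.

Lemma ndual_bound E (psi : nspace E -> R^o) : member (dual (nspace E)) psi ->
  exists2 C : R, 0 <= C & forall x : E, `|psi x| <= C * `|x|.
Proof.
move=> /(dual_bound (@nspace_seminormed E))[C C0 hC]; exists C => // x.
exact: hC.
Qed.

Lemma bounded_sub_continuous E E' (f : E -> E') (C : R) :
  (forall x y, `|f x - f y| <= C * `|x - y|) -> continuous f.
Proof.
move=> hC x; apply/cvgrPdist_le => e e0.
have C1 : 0 < `|C| + 1 by rewrite ltr_pwDr.
near=> y; apply: (le_trans (hC _ _)); apply: (@le_trans _ _ ((`|C| + 1) * `|x - y|)).
  by rewrite ler_wpM2r// (le_trans (ler_norm C))// lerDl.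
rewrite -ler_pdivlMl//; near: y.
by move/cvgrPdist_le : (@cvg_id _ (nbhs x)); apply; rewrite mulr_gt0// invr_gt0.
Unshelve. all: by end_near.
Qed.

Lemma ndual_continuous E (psi : E -> R^o) : member (dual (nspace E)) psi ->
  continuous psi.
Proof.
move=> dpsi; have [C C0 hC] := ndual_bound dpsi.
by apply: (@bounded_sub_continuous _ _ _ C) => x y; rewrite -(ndual_sub dpsi).
Qed.

Lemma ndual_separates E (w : E) :
  (forall psi, member (dual (nspace E)) psi -> psi w = 0) -> w = 0.
Proof.
move=> h; have := @dual_eq0 _ (nspace E) w (@nspace_seminormed E) I h.
by move=> [] /eqP; rewrite normr_eq0 => /eqP.
Qed.

(** The functionals norm the points of a dense sequence. If all of them vanish at w and d is a dense
    point near w, then |d| = psi(d) = psi(d - w) <= |d - w|, hence |w| <= 2 |w - d|. Countability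
    makes it possible to unite the exceptional null sets of all functionals. *)
Lemma separable_dual E : separable_space E ->
  exists2 psi_ : nat -> E -> R^o, (forall n, member (dual (nspace E)) (psi_ n)) &
    forall w, (forall n, psi_ n w = 0) -> w = 0.
Proof.
move=> [D /countable_injP[f fi] dD].
pose e n := xget 0 [set d | D d /\ f d = n].
have eD d : D d -> e (f d) = d.
  move=> Dd; rewrite /e; case: xgetP => [d' -> [Dd' fd']|/(_ d)]; last by case; split.
  by apply: fi => //; exact: mem_set.
have /choice[psi psiP] : forall n, exists psi : nspace E -> R^o,
    member (dual (nspace E)) psi /\ (psi (e n) = `|e n| /\ forall y : E, `|psi y| <= `|y|).
  move=> n; have [psi dpsi [h1 h2]] := @dual_separates _ (nspace E) (@nspace_seminormed E) (e n) I.
  by exists psi; split => //; split => // y; exact: h2.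
exists psi => [n|w w0]; first by case: (psiP n).
apply/eqP; rewrite -normr_le0; apply/ler_addgt0Pr => r r0; rewrite add0r.
have [d [dw Dd]] : (ball w (r / 2) `&` D) !=set0.
  apply: dD; last by apply: ball_open; rewrite divr_gt0.
  by exists w; apply: ballxx; rewrite divr_gt0.
have [dpsi [h1 h2]] := psiP (f d).
rewrite eD// in h1; have := h2 (d - w); rewrite (ndual_sub dpsi) w0 h1 subr0 normr_id => h3.
have : `|w - d| < r / 2 by move: dw; rewrite -ball_normE.
have := ler_normD (w - d) d; rewrite subrK distrC; lra.
Qed.

End NormedDual.

Section IdentificationOfLimits.
Context d (T : measurableType d) (R : realType).
Variable mu : {measure set T -> \bar R}.

(* The sets where the sequence is bounded by [N] exhaust its set of convergence,
   and dominated convergence applies on each of them. *)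
Lemma ae_limit_of_integral_limit (D : set T) (h_ : nat -> T -> R) (h k : T -> R) :
  measurable D -> (mu D < +oo)%E ->
  (forall n, measurable_fun D (h_ n)) -> mu.-integrable D (EFin \o h) ->
  {ae mu, forall t, D t -> h_ n t @[n --> \oo] --> k t} ->
  (forall A, measurable A -> A `<=` D ->
    (\int[mu]_(t in A) (h_ n t)%:E)%E @[n --> \oo] --> (\int[mu]_(t in A) (h t)%:E)%E) ->
  {ae mu, forall t, D t -> h t = k t}.
Proof.
move=> mD Dfin mh_ ih [N0 [mN0 N00 sN0]] ihA.
pose D' := D `\` N0.
have mD' : measurable D' by exact: measurableD.
have D'D : D' `<=` D by move=> t [].
have cD' t : D' t -> h_ n t @[n --> \oo] --> k t.
  by move=> [Dt]; apply: contra_notP => nc; apply: sN0 => /= hc; apply: nc; exact: hc.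
pose B N := \bigcap_n (D' `&` (fun t => `|h_ n t|) @^-1` `]-oo, N%:R]%classic).
have mB N : measurable (B N).
  apply: bigcapT_measurable => n.
  have mn : measurable_fun D' (fun t => `|h_ n t|).
    by apply: measurableT_comp => //; exact: measurable_funS (mh_ n).
  exact: mn.
have BD' N : B N `<=` D' by move=> t /(_ 0%N I)[].
have Bbd N t n : B N t -> `|h_ n t| <= N%:R by move=> /(_ n I)[_]; rewrite /= in_itv.
have hk N : ae_eq mu (B N) (EFin \o h) (EFin \o k).
  have ihB : mu.-integrable (B N) (EFin \o h).
    by apply: (integrableS mD) => // t /BD' /D'D.
  (* Nothing is assumed about the measurability of [k]; on [B N] it is a pointwise limit of
     measurable functions. *)
  have mk : measurable_fun (B N) k.
    apply: (@measurable_fun_cvg _ _ _ _ h_) => [n|t Bt].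
      by apply: measurable_funS (mh_ n) => // t /BD' /D'D.
    exact: cD' (BD' _ _ Bt).
  apply: integral_ae_eq => //; first exact/measurable_EFinP.
  move=> A AB mA; have AD : A `<=` D by move=> t /AB /BD' /D'D.
  have muA : (mu A < +oo)%E by apply: le_lt_trans Dfin; apply: le_measure; rewrite ?inE.
  have c1 := ihA _ mA AD.
  have [|||||_ _ c2] := @dominated_convergence _ _ _ mu A mA
    (fun n t => (h_ n t)%:E) (EFin \o k) (cst N%:R%:E).
  - by move=> n; apply/measurable_EFinP; exact: measurable_funS (mh_ n).
  - by apply/measurable_EFinP; apply: measurable_funS mk.
  - apply: aeW => t At; apply: cvg_EFin; first exact: nearW.
    exact: cD' (BD' _ _ (AB _ At)).
  - apply/integrableP; split; first exact: measurable_cst.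
    by rewrite /= normr_nat integral_cst// lte_mul_pinfty// lee_fin.
  - by apply: aeW => t n At; rewrite /= lee_fin Bbd//; exact: AB.
  exact: (cvg_unique (@ereal_hausdorff R) c1 c2).
have hkA : {ae mu, forall t, forall N, B N t -> h t = k t}.
  by apply/ae_foralln => N; apply: (aeS (hk N)) => t /[apply] -[].
have DN : {ae mu, forall t, D t -> D' t}.
  by exists N0; split => // t /= /not_implyP[Dt]; apply: contra_notP => nN; split.
apply: (ae2 hkA DN) => t hkt D't Dt.
have [M [Mr hM]] : bounded_fun (h_ ^~ t).
  by apply: cvg_seq_bounded; apply/cvg_ex; exists (k t); exact: cD' (D't Dt).
have M1 : M < `|M| + 1 by rewrite (le_lt_trans (ler_norm M))// ltrDl.
apply: (hkt (Num.bound (`|M| + 1))) => n _; split; first exact: D't.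
rewrite /= in_itv/=; apply: (le_trans (hM _ M1 n I)).
by apply: ltW; apply: archi_boundP; rewrite addr_ge0.
Qed.

End IdentificationOfLimits.

Section L2Functionals.
Context {R : realType}.
Local Notation mR := (measurableTypeR R).
Local Notation leb := (@lebesgue_measure R).
Implicit Types (E : normedModType R) (T : R).

Lemma leb_itv_fin T : (leb (`]0%R, T[%classic : set mR) < +oo)%E.
Proof.
rewrite lebesgue_measure_itv/=.
by case: ifP => // _; rewrite -EFinB ltry.
Qed.

Lemma dual_measurable E (psi : E -> R^o) (g : R -> E) :
  member (dual (nspace E)) psi -> pointwise_simple g ->
  measurable_fun (setT : set mR) (psi \o g : mR -> R).
Proof.
move=> dpsi pg; apply: (pointwise_simple_measurable pg); exact: ndual_continuous.
Qed.

Lemma dual_integral_bound E T (psi : E -> R^o) : member (dual (nspace E)) psi ->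
  exists2 K : R, 0 <= K & forall g : R -> E, pointwise_simple g ->
    (forall t : R, t \notin `]0, T[ -> g t = 0) ->
    (\int[leb]_(t in `]0%R, T[) `|psi (g t)|%:E <= K%:E * sqrte (sq_integral T g))%E.
Proof.
move=> dpsi; have [K K0 hK] := @L1_le_L2 R T; have [C C0 hC] := ndual_bound dpsi.
exists (C * K); first exact: mulr_ge0.
move=> g pg g0; apply: (@le_trans _ _ (\int[leb]_(t in `]0%R, T[) (C%:E * `|g t|%:E))%E).
  apply: ae_le_lower_integral => [t _|t _|]; rewrite ?lee_fin ?mulr_ge0//.
  by apply: aeW => t _; rewrite -EFinM lee_fin hC.
rewrite ge0_integralZl//; last first.
- apply/measurable_EFinP; exact: measurable_funS (measurable_norm_repr pg).
by rewrite EFinM -muleA lee_wpmul2l// hK.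
Qed.

Lemma dual_integrable E T (psi : E -> R^o) (g : R -> E) :
  member (dual (nspace E)) psi -> pointwise_simple g ->
  (forall t : R, t \notin `]0, T[ -> g t = 0) -> (sq_integral T g < +oo)%E ->
  leb.-integrable (`]0, T[%classic : set mR) (EFin \o (psi \o g)).
Proof.
move=> dpsi pg g0 Ig; apply/integrableP; split.
  apply/measurable_EFinP; exact: measurable_funS (dual_measurable dpsi pg).
have [K K0 hK] := dual_integral_bound T dpsi.
apply: le_lt_trans (hK g pg g0) _; rewrite lte_mul_pinfty//.
have : sqrte (sq_integral T g) \is a fin_num.
  by rewrite sqrte_fin_num ?sq_integral_ge0// ge0_fin_numE ?sq_integral_ge0.
by move=> /fin_numPlt/andP[].
Qed.

(** The functional on L^2(0,T;E) represented by [psi] times the indicator of [A]. Varying [A]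
    localizes weak convergence in time. *)
Definition test_functional E T (A : set mR) (psi : E -> R^o) : L2 T E -> R^o :=
  fun f => fine (\int[leb]_(t in `]0%R, T[%classic `&` A) (psi (f t))%:E)%E.

Lemma test_functionalE E T (A : set mR) (psi : E -> R^o) (f g : R -> E) :
  {ae leb, forall t, t \in `]0, T[ -> f t = g t} ->
  test_functional (T := T) A psi f = test_functional (T := T) A psi g.
Proof.
move=> fg; congr fine; apply: ae_eq_integral_nonmeasurable.
by apply: (aeS fg) => t h [It _]; rewrite h.
Qed.

Lemma test_functional_dual E T (A : set mR) (psi : E -> R^o) :
  measurable A -> member (dual (nspace E)) psi ->
  member (dual (L2 T E)) (test_functional A psi).
Proof.
move=> mA dpsi.
have mD : measurable (`]0%R, T[%classic `&` A : set mR) by exact: measurableI.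
have iD g : pointwise_simple g -> (forall t : R, t \notin `]0, T[ -> g t = 0) ->
    (sq_integral T g < +oo)%E ->
    leb.-integrable (`]0%R, T[%classic `&` A : set mR) (EFin \o (psi \o g)).
  by move=> pg g0 Ig; apply: (integrableS _ _ _ (dual_integrable dpsi pg g0 Ig)).
apply: dualP.
  move=> a f f' mf mf'.
  have [g pg [g0 fg Ifg]] := L2_repr mf; have [g' pg' [g'0 fg' Ifg']] := L2_repr mf'.
  have [_ If] := mf; have [_ If'] := mf'; rewrite Ifg in If; rewrite Ifg' in If'.
  rewrite (test_functionalE A psi fg) (test_functionalE A psi fg').
  rewrite (@test_functionalE _ _ _ _ _ (a *: g + g')); last first.
    by apply: (ae2 fg fg') => t h h' It; exact: (congr2 (fun u v => a *: u + v) (h It) (h' It)).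
  have i1 := iD _ pg g0 If; have i2 := iD _ pg' g'0 If'.
  rewrite /test_functional.
  rewrite (eq_integral (fun t : mR => a%:E * (psi (g t))%:E + (psi (g' t))%:E)%E); last first.
    by move=> t _; rewrite -EFinM -EFinD; congr EFin; exact: (ndual_lin dpsi).
  rewrite integralD//; last exact: integrableZl.
  rewrite integralZl// fineD//; last 2 first.
  - by rewrite fin_numM//; exact: integrable_fin_num.
  - exact: integrable_fin_num.
  by rewrite fineM//; exact: integrable_fin_num.
have [K K0 hK] := dual_integral_bound T dpsi.
exists K => f mf; have [g pg [g0 fg Ifg]] := L2_repr mf.
have [_ If] := mf; rewrite Ifg in If.
rewrite (test_functionalE A psi fg) /= Ifg; apply: le_trans (hK _ pg g0).
rewrite /test_functional -abse_EFin fineK; last exact: integrable_fin_num (iD _ pg g0 If).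
apply: (le_trans (le_abse_integral _ mD _)).
  exact: measurable_int (iD _ pg g0 If).
apply: ge0_subset_integral => //.
apply: measurableT_comp => //; apply: measurable_int (dual_integrable dpsi pg g0 If).
Qed.

(** For fixed psi, the test functionals show that the integrals of psi(f_n) over every measurable
    set converge to those of psi(f), so the pointwise limit of psi(f_n) is psi(f). The null set in
    the hypothesis may depend on psi, as countably many psi separate the points of E. *)
Lemma L2_weak_limit_ae E T (f_ : nat -> L2 T E) (f : L2 T E) (g : R -> E) :
  separable_space E -> weak_cvg f_ f ->
  (forall psi, member (dual (nspace E)) psi ->
    {ae leb, forall t, t \in `]0, T[ -> psi (f_ n t) @[n --> \oo] --> (psi (g t) : R^o)}) ->
  {ae leb, forall t, t \in `]0, T[ -> f t = g t}.
Proof.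
move=> sE [mf_ mf cf] cg; have [psi_ dpsi sep] := separable_dual sE.
suff h n : {ae leb, forall t, t \in `]0, T[ -> psi_ n (f t) = psi_ n (g t)}.
  apply: (aeS (ae_foralln h)) => t {}h It; apply/eqP; rewrite -subr_eq0; apply/eqP.
  by apply: sep => n; rewrite (ndual_sub (dpsi n)) h// subrr.
have /choice[fr frP] : forall k, exists fr, [/\ pointwise_simple fr,
    forall t : R, t \notin `]0, T[ -> fr t = 0,
    {ae leb, forall t, t \in `]0, T[ -> f_ k t = fr t} & sq_integral T (f_ k) = sq_integral T fr].
  by move=> k; have [fr p [? ? ?]] := L2_repr (mf_ k); exists fr.
have [fl pl [l0 fl_ae Ifl]] := L2_repr mf.
have [_ If] := mf; rewrite Ifl in If.
have frae : {ae leb, forall t, forall k, t \in `]0, T[ -> f_ k t = fr k t}.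
  by apply: ae_foralln => k; have [] := frP k.
have : {ae leb, forall t, (`]0, T[%classic : set mR) t -> (psi_ n \o fl) t = psi_ n (g t)}.
  apply: (@ae_limit_of_integral_limit _ _ _ leb (`]0, T[%classic : set mR)
    (fun k => psi_ n \o fr k) (psi_ n \o fl)) => //.
  - exact: leb_itv_fin.
  - move=> k; have [p _ _ _] := frP k; exact: measurable_funS (dual_measurable (dpsi n) p).
  - exact: dual_integrable.
  - apply: (ae2 frae (cg _ (dpsi n))) => t h h' It.
    have -> : (fun k => (psi_ n \o fr k) t) = (fun k => psi_ n (f_ k t)).
      by apply/funext => k; rewrite /= h.
    exact: h'.
  - move=> A mA AI.
    have c := cf _ (test_functional_dual T mA (dpsi n)).
    have IA : `]0%R, T[%classic `&` A = A by rewrite setIC; apply/setIidPl.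
    rewrite (test_functionalE A _ fl_ae) in c.
    have iA h : pointwise_simple h -> (forall t : R, t \notin `]0, T[ -> h t = 0) ->
        (sq_integral T h < +oo)%E ->
        ((\int[leb]_(t in A) ((psi_ n \o h) t)%:E)%E \is a fin_num).
      move=> ph h0 Ih; apply: integrable_fin_num => //.
      apply: (integrableS _ _ _ (dual_integrable (dpsi n) ph h0 Ih)) => //.
    have := iA _ pl l0 If => /fineK <-; apply/fine_cvgP; split.
      apply: nearW => k; have [p p0 pe pI] := frP k; apply: iA => //.
      by rewrite -pI; case: (mf_ k).
    have IE : test_functional (T := T) A (psi_ n) fl =
        fine (\int[leb]_(t in A) ((psi_ n \o fl) t)%:E)%E by rewrite /test_functional IA.
    rewrite IE in c.
    rewrite [X in X @ _](_ : _ = test_functional (T := T) A (psi_ n) \o f_); last first.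
      apply/funext => k; have [p p0 pe pI] := frP k.
      by rewrite /= (test_functionalE A _ pe) /test_functional IA.
    exact: c.
by move=> h; apply: (ae2 h fl_ae) => t ht hf It; rewrite -ht//= hf.
Qed.

End L2Functionals.

(** * Linearity of Bochner integrals and of weak derivatives *)

Section BochnerLinearity.
Context {R : realType}.
Local Notation mR := (measurableTypeR R).
Local Notation leb := (@lebesgue_measure R).
Implicit Types (E : normedModType R) (T : R).

Definition mass T (B : set mR) : R := fine (leb (`]0, T[%classic `&` B)).

Lemma massE T (B : set mR) : measurable B -> leb (`]0, T[%classic `&` B) = (mass T B)%:E.
Proof.
move=> mB; rewrite fineK// ge0_fin_numE//.
apply: le_lt_trans (leb_itv_fin T); apply: le_measure; rewrite ?inE//; exact: measurableI.
Qed.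

Lemma mass_bigcup T (I : choiceType) (D : set I) (F : I -> set mR) :
  finite_set D -> trivIset D F -> (forall i, D i -> measurable (F i)) ->
  mass T (\bigcup_(i in D) F i) = \sum_(i \in D) mass T (F i).
Proof.
move=> fD tF mF; apply: EFin_inj; rewrite -massE; last exact: fin_bigcup_measurable.
rewrite setI_bigcupr measure_fin_bigcup//.
- rewrite -fsumEFin//; apply: eq_fsbigr => i /set_mem Di; exact: massE (mF _ Di).
- move=> i j Di Dj [x [[_ Fi] [_ Fj]]]; apply: tF => //; by exists x.
- by move=> i Di; apply: measurableI => //; exact: mF.
Qed.

(** The integral may be computed on the finer partition into level sets of [p]. Taking for [p] the
    pair of two simple functions gives a common refinement on which their integrals can be added. *)
Lemma simple_integral_comp E E' T (F : E -> E') (p : R -> E) : simple_fun p ->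
  simple_integral T (F \o p) =
  \sum_(w \in range p) mass T (p @^-1` [set w]) *: F w.
Proof.
move=> sp; have [fp mp] := sp; have [fFp mFp] := simple_map F sp.
have level v : mass T ((F \o p) @^-1` [set v]) *: v =
    \sum_(w \in range p)
      (if w \in F @^-1` [set v] then mass T (p @^-1` [set w]) *: F w else 0).
  rewrite -fsbig_mkcondr.
  have fI : finite_set (range p `&` F @^-1` [set v]) by exact: finite_setIl.
  have -> : (F \o p) @^-1` [set v] =
      \bigcup_(w in range p `&` F @^-1` [set v]) (p @^-1` [set w]).
    apply/seteqP; split => [t /= Fpt|t [w [_ Fw] pt]].
      by exists (p t) => //; split => //; exists t.
    by rewrite /= pt.
  rewrite mass_bigcup//; last first.
    by move=> i j _ _ [t [/= <- <-]].
  rewrite !fsbig_finite// scaler_suml; apply: eq_big_seq => w.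
  by rewrite in_fset_set// inE => -[_ /= ->].
rewrite /simple_integral.
rewrite (eq_fsbigr (fun v => \sum_(w \in range p)
  (if w \in F @^-1` [set v] then mass T (p @^-1` [set w]) *: F w else 0))); last first.
  by move=> v _; exact: level.
rewrite exchange_fsbig//; apply: eq_fsbigr => w /set_mem [t _ pt].
have Aw : range (F \o p) (F w) by exists t => //=; rewrite pt.
rewrite (fsbigD1 (F w))// fsbig1; last first.
  move=> v [_ /= vw]; rewrite ifF//; apply/negbTE; rewrite notin_setE /= => h.
  by apply: vw; rewrite h.
by rewrite /= addr0 mem_set.
Qed.

Lemma simple_integral_lin E T (a : R) (s s' : R -> E) : simple_fun s -> simple_fun s' ->
  simple_integral T (a *: s + s') = a *: simple_integral T s + simple_integral T s'.
Proof.
move=> ss ss'; have sp := simple_pair ss ss'; have [fp _] := sp.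
pose p t := (s t, s' t) : E * E.
have -> : a *: s + s' = (fun w : E * E => a *: w.1 + w.2) \o p by [].
have -> : simple_integral T s = simple_integral T (fst \o p) by [].
have -> : simple_integral T s' = simple_integral T (snd \o p) by [].
rewrite !(simple_integral_comp T _ sp) !fsbig_finite// scaler_sumr -big_split/=.
by apply: eq_bigr => w _; rewrite scalerDr !scalerA mulrC.
Qed.

Lemma bochner_integral_lin E T (a : R) (f f' : R -> E) I I' :
  strongly_measurable T f -> strongly_measurable T f' ->
  bochner_integral T f I -> bochner_integral T f' I' ->
  bochner_integral T (a *: f + f') (a *: I + I').
Proof.
move=> mf mf' [s_ [ss sf sI sc]] [s'_ [ss' sf' sI' sc']].
exists (fun n => a *: s_ n + s'_ n); split.
- move=> n; apply: (@simple_map _ _ _ (fun w : E * E => a *: w.1 + w.2) _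
    (simple_pair (ss n) (ss' n))).
- apply: (ae2 sf sf') => t h h' It; apply: cvgD; last exact: h'.
  by apply: cvgZl_tmp; exact: h.
(* Splitting the integral of a sum requires measurable integrands, so f and f' are exchanged for
   their representatives under the integral. *)
- have [g pg [g0 fg]] := strongly_measurable_repr mf.
  have [g' pg' [g'0 fg']] := strongly_measurable_repr mf'.
  have reE (u v : R -> E) (s : R -> E) : {ae leb, forall t, t \in `]0, T[ -> u t = v t} ->
      (\int[leb]_(t in `]0%R, T[) `|u t - s t|%:E = \int[leb]_(t in `]0%R, T[) `|v t - s t|%:E)%E.
    by move=> uv; apply: ae_eq_integral_nonmeasurable; apply: (aeS uv) => t h It; rewrite h.
  have mE (u s : R -> E) : pointwise_simple u -> simple_fun s ->
      measurable_fun (`]0, T[%classic : set mR) (fun t : mR => `|u t - s t|%:E).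
    move=> pu s1; apply/measurable_EFinP.
    apply: measurable_funS
      (measurable_norm_repr (_ : pointwise_simple (fun t => u t - s t))) => //.
    have := pointwise_simple_lin (-1) (_ : pointwise_simple s) pu.
    have ps : pointwise_simple s by exists (fun=> s) => // t; exact: cvg_cst.
    move=> /(_ ps); congr pointwise_simple; apply/funext => t.
    by rewrite scaleN1r addrC.
  apply: (@squeeze_cvge _ _ _ _ (cst 0%E) _ (fun n =>
      `|a|%:E * (\int[leb]_(t in `]0%R, T[) `|f t - s_ n t|%:E) +
      (\int[leb]_(t in `]0%R, T[) `|f' t - s'_ n t|%:E))%E).
  + apply: nearW => n; apply/andP; split; first by apply: integral_ge0 => t _; rewrite lee_fin.
    rewrite (reE _ _ _ fg) (reE _ _ _ fg').
    rewrite (reE _ (a *: g + g')); last first.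
      by apply: (ae2 fg fg') => t h h' It; exact: (congr2 (fun u v => a *: u + v) (h It) (h' It)).
    rewrite -ge0_integralZl//; last exact: mE.
    rewrite -ge0_integralD//; last 2 first.
    * by apply: measurable_funeM; exact: mE.
    * exact: mE.
    apply: ae_le_lower_integral => [t _|t _|]; rewrite ?lee_fin// ?adde_ge0 ?mule_ge0 ?lee_fin//.
    apply: aeW => t _; rewrite -EFinM -EFinD lee_fin.
    have -> : (a *: g + g') t - (a *: s_ n + s'_ n) t = a *: (g t - s_ n t) + (g' t - s'_ n t).
      rewrite scalerBr /=; change (a *: g t + g' t - (a *: s_ n t + s'_ n t) =
        a *: g t - a *: s_ n t + (g' t - s'_ n t)).
      by rewrite opprD addrACA.
    by rewrite (le_trans (ler_normD _ _))// normrZ.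
  + exact: cvg_cst.
  + rewrite -[0%E]adde0 -[X in (X + _)%E](mule0 `|a|%:E); apply: cvgeD => //.
    by apply: cvgeZl.
- rewrite (_ : (fun n => _) = (fun n => a *: simple_integral T (s_ n) + simple_integral T (s'_ n))).
    by apply: cvgD => //; exact: cvgZl_tmp.
  by apply/funext => n; exact: simple_integral_lin.
Qed.

Import HBNNSimple.

Lemma measurable_pointwise_simple (h : mR -> R) :
  measurable_fun setT h -> pointwise_simple (h : R -> R^o).
Proof.
have nonneg (u : mR -> R) : measurable_fun setT u -> (forall t, 0 <= u t) ->
    pointwise_simple (u : R -> R^o).
  move=> mu u0.
  have mu' : measurable_fun (setT : set mR) (EFin \o u) by exact/measurable_EFinP.
  exists (fun n (t : R) => nnsfun_approx measurableT mu' n t : R^o) => [n|t].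
    split; first exact: (@fimfunP _ _ (nnsfun_approx measurableT mu' n)).
    by move=> v; exact: measurable_funPTI.
  have := @cvg_nnsfun_approx _ mR R setT measurableT _ mu' (fun t _ => u0 t) t I.
  by move/fine_cvgP => [_].
move=> mh.
have mp : measurable_fun setT (fun t => Num.max (h t) 0) by exact: measurable_maxr.
have mn : measurable_fun setT (fun t => Num.max (- h t) 0).
  by apply: measurable_maxr => //; exact: measurableT_comp.
have p0 t : 0 <= Num.max (h t) 0 by rewrite le_max lexx orbT.
have n0 t : 0 <= Num.max (- h t) 0 by rewrite le_max lexx orbT.
have := pointwise_simple_lin (-1) (nonneg _ mn n0) (nonneg _ mp p0).
congr pointwise_simple; apply/funext => t; rewrite scaleN1r.
by rewrite /Num.max; case: ltP => h1; case: ltP => h2; lra.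
Qed.

Lemma strongly_measurable_mul E T (h : R -> R) (f : R -> E) :
  continuous h -> strongly_measurable T f -> strongly_measurable T (fun t => h t *: f t).
Proof.
move=> ch /strongly_measurable_repr[g pg [_ fg]].
apply: (@strongly_measurable_ae _ _ _ _ (fun t => h t *: g t)).
  by apply: (aeS fg) => t H It; rewrite H.
have ph : pointwise_simple (h : R -> R^o).
  by apply: measurable_pointwise_simple; exact: continuous_measurable_fun.
apply: pointwise_simple_strongly.
apply: (pointwise_simple_continuous (F := fun p : R^o * E => p.1 *: p.2)
  (pointwise_simple_pair ph pg)).
by move=> p; apply: cvgZ; [exact: cvg_fst|exact: cvg_snd].
Qed.

Lemma strongly_measurable_continuous E E' T (F : E -> E') (f : R -> E) :
  continuous F -> strongly_measurable T f -> strongly_measurable T (F \o f).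
Proof.
move=> cF /strongly_measurable_repr[g pg [_ fg]].
apply: (@strongly_measurable_ae _ _ _ _ (F \o g)).
  by apply: (aeS fg) => t H It; rewrite /= H.
exact/pointwise_simple_strongly/pointwise_simple_continuous.
Qed.

Lemma nbounded_linear_lin E E' (j : E -> E') :
  bounded_linear (A := nspace E) (B := nspace E') j ->
  forall (a : R) x y, j (a *: x + y) = a *: j x + j y.
Proof.
move=> [_ lj _] a x y; have [] := lj a x y I I.
by move=> /eqP; rewrite normr_eq0 subr_eq0 => /eqP.
Qed.

Lemma nbounded_linear_sub E E' (j : E -> E') :
  bounded_linear (A := nspace E) (B := nspace E') j ->
  forall x y, j (x - y) = j x - j y.
Proof.
move=> bj x y; rewrite addrC -scaleN1r (nbounded_linear_lin bj).
by rewrite scaleN1r addrC.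
Qed.

Lemma nbounded_linear_continuous E E' (j : E -> E') :
  bounded_linear (A := nspace E) (B := nspace E') j -> continuous j.
Proof.
move=> bj; have [_ _ [C hC]] := bj.
apply: (@bounded_sub_continuous _ _ _ _ C) => x y.
by rewrite -(nbounded_linear_sub bj) -lee_fin EFinM; exact: hC.
Qed.

Lemma scale_linE E (a : R) (h : R -> R) (f f' : R -> E) :
  a *: (fun t => h t *: f t) + (fun t => h t *: f' t) =
  (fun t => h t *: (a *: f + f') t).
Proof.
apply/funext => t.
have : a *: (h t *: f t) + h t *: f' t = h t *: (a *: f t + f' t).
  by rewrite scalerDr !scalerA mulrC.
exact.
Qed.

Lemma weak_derivative_lin E T (a : R) (f f' g g' : R -> E) :
  strongly_measurable T f -> strongly_measurable T f' ->
  strongly_measurable T g -> strongly_measurable T g' ->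
  weak_derivative T f g -> weak_derivative T f' g' ->
  weak_derivative T (a *: f + f') (a *: g + g').
Proof.
move=> mf mf' mg mg' wf wf' phi tphi.
have [I [If Ig]] := wf phi tphi; have [I' [If' Ig']] := wf' phi tphi.
have cphi n : continuous (derive1n n phi).
  move=> x; apply: differentiable_continuous; apply/derivable1_diffP.
  by have [h _] := tphi; exact: h.
exists (a *: I + I'); split.
  rewrite -(@scale_linE _ a (derive1 phi) f f').
  by apply: bochner_integral_lin => //; apply: strongly_measurable_mul => //; exact: (cphi 1%N).
rewrite -(@scale_linE _ a phi g g') opprD -scalerN.
by apply: bochner_integral_lin => //; apply: strongly_measurable_mul => //; exact: (cphi 0%N).
Qed.

(** Membership only asks that some weak derivative in L^2 exist, so linear combinations of given
    derivatives suffice, whichever derivative [time_derivative] selects. *)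
Lemma L2H1_lin (V E : normedModType R) T (j : V -> E) :
  continuous j -> (forall (a : R) x y, j (a *: x + y) = a *: j x + j y) ->
  forall (a : R) x y, member (L2H1 T j) x -> member (L2H1 T j) y ->
    member (L2H1 T j) (a *: x + y).
Proof.
move=> cj lj a x y [mx [g [mg wg]]] [my [g' [mg' wg']]].
split; first exact: (member_lin (L2_seminormed V T)).
exists (a *: g + g'); split; first exact: (member_lin (L2_seminormed E T)).
have -> : j \o (a *: x + y) = a *: (j \o x) + (j \o y) by apply/funext => t; exact: lj.
case: mx my mg mg' => [sx _] [sy _] [sg _] [sg' _].
by apply: weak_derivative_lin => //; exact: strongly_measurable_continuous.
Qed.

End BochnerLinearity.

(** * Compactness in time *)

Section Compactness.
Context {R : realType}.
Implicit Types (V : normedModType R) (B : fspace R).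

Lemma bounded_linear_nrm0 V B (j : V -> B) : seminormed B ->
  bounded_linear (A := nspace V) j -> nrm (j 0) = 0.
Proof.
move=> sB [mj _ [C hC]]; apply/eqP; rewrite eq_le nrm_ge0//; last exact: mj.
have := hC 0 I; rewrite (nrmE sB); last exact: mj.
by rewrite /= normr0 mule0 lee_fin => ->.
Qed.

(** A map into an [fspace] is linear only up to [same], so identities for its values are transferred
    to their seminorms through this lemma. *)
Lemma nrm_same B (x y : B) : seminormed B -> member B x -> member B y ->
  same x y -> nrm x = nrm y.
Proof.
move=> sB mx my xy; rewrite /nrm -[x](subrK y) addrC.
by rewrite (snorm_eq0D sB my (memberB sB mx my) xy).
Qed.

Lemma bounded_linear_nrmZ V B (j : V -> B) (a : R) v : seminormed B ->
  bounded_linear (A := nspace V) j -> nrm (j (a *: v)) = `|a| * nrm (j v).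
Proof.
move=> sB bj; have [mj lj _] := bj.
have := lj a v 0 I I; rewrite addr0 => h.
have mav := memberZ sB a (mj _ I : member B (j v)).
have m0 := mj _ I : member B (j 0).
have j0 : snorm B (j 0) = 0%E by rewrite (nrmE sB m0) bounded_linear_nrm0.
rewrite (nrm_same sB (mj _ I) (memberD sB mav m0) h).
by rewrite /nrm (snorm_eq0D sB mav m0 j0); exact: (nrmZ sB a (mj _ I)).
Qed.

Lemma bounded_linear_nrm_sub V B (j : V -> B) : seminormed B ->
  bounded_linear (A := nspace V) j ->
  exists C : R, forall v w : V, `|nrm (j v) - nrm (j w)| <= C * `|v - w|.
Proof.
move=> sB bj; have [mj lj [C hC]] := bj; exists C.
have le (v w : V) : nrm (j v) - nrm (j w) <= C * `|v - w|.
  rewrite lerBlDr; have := lj 1 (v - w) w I I.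
  rewrite !scale1r subrK => /(nrm_same sB (mj _ I)) -> //; last first.
    exact: (memberD sB (mj _ I) (mj _ I)).
  apply: (le_trans (nrmD sB (mj _ I) (mj _ I))); rewrite lerD2r.
  by have := hC (v - w) I; rewrite (nrmE sB (mj _ I)) /= -EFinM lee_fin.
by move=> v w; rewrite ler_norml lerNl opprB {1}distrC !le.
Qed.

(* If [nrm (j (w_ n)) > eps |w_ n| + eta] infinitely often, then along a
   subsequence the rescaled vectors [w_ n / max(1, |w_ n|)] have images of norm at
   least [min(eps, eta)] converging to an element that [sep] forces to vanish. *)
Lemma ehrling V B (j : V -> B) (Phi : set (V -> R)) (w_ : nat -> V) (eps : R) :
  seminormed B -> compact_embedding (A := nspace V) j ->
  (forall psi, Phi psi -> forall a v, psi (a *: v) = a * psi v) ->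
  (forall (v_ : nat -> V) y, member B y ->
     snorm B (j (v_ n) - y) @[n --> \oo] --> 0%E ->
     (forall psi, Phi psi -> psi (v_ n) @[n --> \oo] --> (0 : R)) ->
     snorm B y = 0%E) ->
  (forall psi, Phi psi -> psi (w_ n) @[n --> \oo] --> (0 : R)) -> 0 < eps ->
  Num.max (nrm (j (w_ n)) - eps * `|w_ n|) 0 @[n --> \oo] --> (0 : R).
Proof.
move=> sB [[bj _] cj] PhiZ sep w0 eps0; have [mj lj _] := bj.
apply: contrapT => ncvg.
have [eta eta0 neta] : exists2 eta : R, 0 < eta &
    forall N, exists2 n, (N <= n)%N & eps * `|w_ n| + eta < nrm (j (w_ n)).
  apply: contrapT => no; apply: ncvg; apply/cvgrPdist_le => e e0.
  apply: contrapT => ne; apply: no; exists e => // N.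
  apply: contrapT => nN; apply: ne; exists N => // n /= Nn.
  rewrite sub0r normrN ger0_norm ?le_max ?lexx ?orbT// ge_max (ltW e0) andbT.
  rewrite lerBlDl leNgt; apply/negP => h; apply: nN; by exists n.
have [s hs sP] := extract_increasing (fun _ => neta).
pose c n := Num.max 1 `|w_ (s n)|.
have c1 n : 1 <= c n by rewrite /c le_max lexx.
have c0 n : 0 < c n by exact: lt_le_trans ltr01 (c1 n).
pose x n := (c n)^-1 *: w_ (s n).
have x1 n : `|x n| <= 1.
  rewrite normrZ ger0_norm ?invr_ge0 ?(ltW (c0 n))// ler_pdivrMl// mulr1.
  by rewrite /c le_max lexx orbT.
have [s' [y [hs' my xy]]] := cj x 1 (fun n => conj I (x1 n : (snorm (nspace V) (x n) <= 1%:E)%E)).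
have y0 : snorm B y = 0%E.
  apply: (sep (x \o s') y my xy) => psi Ppsi.
  have h := cvg_subseq (increasing_index_comp hs hs') (w0 psi Ppsi).
  have hn : `|psi (w_ (s (s' n)))| @[n --> \oo] --> (0 : R).
    by rewrite -(normr0 R); exact: (cvg_norm h).
  apply/norm_cvg0P; apply: (squeeze_cvgr _ (cvg_cst 0) hn).
  apply: nearW => n; rewrite normr_ge0/= /x PhiZ// normrM.
  rewrite ger0_norm ?invr_ge0 ?(ltW (c0 _))// ler_piMl// invf_le1//.
have jx : nrm (j (x (s' n))) @[n --> \oo] --> (0 : R).
  have : nrm (j (x (s' n)) - y) @[n --> \oo] --> (0 : R) by move/fine_cvgP : xy => [].
  move=> h; apply: (squeeze_cvgr _ (cvg_cst 0) h); apply: nearW => n.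
  rewrite (nrm_ge0 sB (mj _ I))/=.
  rewrite -{1}[j (x (s' n))](subrK y) (le_trans (nrmD sB (memberB sB (mj _ I) my) my))//.
  by rewrite [nrm y]/nrm y0 addr0.
(* Both for |w| <= 1 and for |w| > 1, min(eps, eta) * max(1, |w|) is at most eps |w| + eta. *)
have low n : Num.min eps eta <= nrm (j (x n)).
  rewrite /x (bounded_linear_nrmZ _ _ sB bj) ger0_norm ?invr_ge0 ?(ltW (c0 n))//.
  rewrite ler_pdivlMl//; apply: (le_trans _ (ltW (sP n))).
  have m1 : Num.min eps eta <= eps by rewrite ge_min lexx.
  have m2 : Num.min eps eta <= eta by rewrite ge_min lexx orbT.
  have w1 := normr_ge0 (w_ (s n)).
  by rewrite /c maxEle; case: ifP => _; move: (Num.min eps eta) m1 m2 => m m1 m2; nra.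
have m0 : 0 < Num.min eps eta by rewrite lt_min eps0.
move/cvgrPdist_lt : jx => /(_ _ m0)[N _ /(_ N (leqnn N))] /=.
by rewrite sub0r normrN ger0_norm ?(nrm_ge0 sB (mj _ I))// ltNge low.
Qed.

Local Notation mR := (measurableTypeR R).
Local Notation leb := (@lebesgue_measure R).

(* Replaces the Aubin-Lions lemma: only the L^2(0,T;V) bound and the pointwise
   weak convergence are used. *)
Lemma compact_ae_subseq V B T (j : V -> B) (Phi : set (V -> R))
    (w_ : nat -> L2 T V) (C : R) :
  seminormed B -> compact_embedding (A := nspace V) j ->
  (forall psi, Phi psi -> forall a v, psi (a *: v) = a * psi v) ->
  (forall (v_ : nat -> V) y, member B y ->
     snorm B (j (v_ n) - y) @[n --> \oo] --> 0%E ->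
     (forall psi, Phi psi -> psi (v_ n) @[n --> \oo] --> (0 : R)) ->
     snorm B y = 0%E) ->
  (forall n, member (L2 T V) (w_ n)) -> (forall n, nrm (w_ n) <= C) ->
  {ae leb, forall t, t \in `]0, T[ ->
     forall psi, Phi psi -> psi (w_ n t) @[n --> \oo] --> (0 : R)} ->
  exists2 s, increasing_index s &
    {ae leb, forall t, t \in `]0, T[ -> nrm (j (w_ (s n) t)) @[n --> \oo] --> (0 : R)}.
Proof.
move=> sB cj PhiZ sep mw wC w0; have [[bj _] _] := cj; have [mj _ _] := bj.
have /choice[g gP] : forall k, exists g, [/\ pointwise_simple g,
    forall t : R, t \notin `]0, T[ -> g t = 0,
    {ae leb, forall t, t \in `]0, T[ -> w_ k t = g t} & sq_integral T (w_ k) = sq_integral T g].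
  by move=> k; have [g p [? ? ?]] := L2_repr (mw k); exists g.
have wg : {ae leb, forall t, forall k, t \in `]0, T[ -> w_ k t = g k t}.
  by apply: ae_foralln => k; have [] := gP k.
have [K K0 hK] := @L1_le_L2 R T.
pose I : set mR := `]0%R, T[%classic.
pose f_ n (t : mR) := nrm (j (g n t)).
pose a_ n (t : mR) := `|g n t|.
have mI : measurable I by exact: measurable_itv.
have mf n : measurable_fun setT (f_ n).
  have [C' hC'] := bounded_linear_nrm_sub sB bj; have [p _ _ _] := gP n.
  apply: (pointwise_simple_measurable (q := fun v => nrm (j v) : R^o) p).
  exact: bounded_sub_continuous hC'.
have ma n : measurable_fun setT (a_ n).
  by have [p _ _ _] := gP n; exact: measurable_norm_repr.
have f0 n t : 0 <= f_ n t by exact: (nrm_ge0 sB (mj _ Logic.I)).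
(* The remainder is the excess of the seminorm of j(g_n) over e |g_n|, which the Ehrling inequality
   sends to 0 at almost every t. The bound K * C on the L^1 norms of g_n comes from the L^2 bound by
   Hölder. *)
have [|||||||||s hs sP] := @ae_subseq_of_bounded_remainder _ mR R leb I f_ a_
    (fun e n t => Num.max (f_ n t - e * a_ n t) 0) (K * C) mI (leb_itv_fin T).
- by move=> n; exact: measurable_funS (mf n).
- by move=> n; exact: measurable_funS (ma n).
- move=> e n _; apply: (@measurable_funS _ _ _ _ setT) => //; apply: measurable_maxr => //.
  by apply: measurable_funB => //; apply: measurable_funM.
- by move=> n t _; exact: f0.
- by move=> n t _; exact: normr_ge0.
- by move=> e n t _ _; rewrite le_max lexx orbT.
- by move=> e n t _ _; rewrite -lerBlDl le_max lexx.
- move=> n; have [p p0 _ pI] := gP n; apply: (le_trans (hK _ _ p p0)).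
  rewrite EFinM lee_wpmul2l ?lee_fin// -pI.
  by have := nrmE (L2_seminormed V T) (mw n) => /= ->; rewrite lee_fin.
- move=> e e0; apply: (ae2 w0 wg) => t h h' It.
  apply: (@ehrling V B j Phi (fun n => g n t) e) => //.
  move=> psi /(h It); rewrite (_ : (fun n => psi (w_ n t)) = (fun n => psi (g n t)))//.
  by apply/funext => n; rewrite h'.
exists s => //; apply: (ae2 sP wg) => t h h' It; have := h It.
rewrite (_ : (fun n => f_ (s n) t) = (fun n => nrm (j (w_ (s n) t))))//.
by apply/funext => n; rewrite /f_ -h'.
Qed.

End Compactness.

(** * Function spaces and superposition operators *)

Section FunctionSpaces.
Context {R : realType}.

Lemma Cspace_seminormed (E : normedModType R) (T : R) : 0 <= T ->
  seminormed (Cspace T E).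
Proof.
move=> T0; have z0 : (0 : R) \in `[0, T] by rewrite in_itv/= lexx.
have bd (c : R -> E) : {within `[0, T], continuous c} ->
    exists M : R, forall t, t \in `[0, T] -> `|c t| <= M.
  move=> cc; have [|m _ hm] := @EVT_max R (fun t => `|c t|) 0 T T0.
    by move=> t; apply: (continuous_cvg _ (@norm_continuous _ _ _)); exact: cc.
  by exists `|c m|.
have ub (c : R -> E) t : t \in `[0, T] -> (`|c t|%:E <= snorm (Cspace T E) c)%E.
  by move=> tI; apply: ereal_sup_ubound; exists t.
have le (c : R -> E) (M : \bar R) : (forall t, t \in `[0, T] -> (`|c t|%:E <= M)%E) ->
    (snorm (Cspace T E) c <= M)%E.
  by move=> h; apply: ge_ereal_sup => _ [t tI <-]; exact: h.
have ge0 c : (0 <= snorm (Cspace T E) c)%E.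
  by apply: le_trans (ub c 0 z0); rewrite lee_fin.
have leZ (a : R) c : (snorm (Cspace T E) (a *: c) <= `|a|%:E * snorm (Cspace T E) c)%E.
  apply: le => t tI; rewrite normrZ EFinM lee_wpmul2l ?lee_fin//; exact: ub.
split.
- by move=> t; exact: cvg_cst.
- move=> a c c' cc cc' t; apply: cvgD; last exact: cc'.
  by apply: cvgZl_tmp; exact: cc.
- move=> c /bd[M hM]; rewrite ge0_fin_numE//.
  by apply: (@le_lt_trans _ _ M%:E); [apply: le => t /hM; rewrite lee_fin|exact: ltry].
- move=> c c' _ _; apply: le => t tI.
  apply: (@le_trans _ _ (`|c t| + `|c' t|)%:E); first by rewrite lee_fin ler_normD.
  by rewrite EFinD; apply: leeD; exact: ub.
- move=> a c _; apply/eqP; rewrite eq_le leZ/=.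
  have [->|a0] := eqVneq a 0; first by rewrite normr0 mul0e; exact: ge0.
  have := leZ a^-1 (a *: c); rewrite scalerA mulVf// scale1r normfV => h.
  rewrite -(@lee_pmul2l _ (`|a|^-1)%:E) ?lte_fin ?invr_gt0 ?normr_gt0//.
  by rewrite muleA -EFinM mulVf ?normr_eq0// mul1e.
Qed.

Lemma Lp_seminormed d (Z : measurableType d) (mu : {measure set Z -> \bar R})
  (p : \bar R) : (1 <= p)%E -> seminormed (Lp_space mu p).
Proof.
move=> p1; have [m0 mlin] := Lfun_submod_closed mu p1.
have mm (f : Z -> R) : f \in Lfun mu p -> measurable_fun setT f.
  by move=> /sub_Lfun_mfun; rewrite inE.
split => //=.
- by move=> f /sub_Lfun_finLfun; rewrite inE /= => h; rewrite ge0_fin_numE ?Lnorm_ge0.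
- move=> f g /mm mf /mm mg; exact: eminkowski.
- move=> a f mf; exact: (LnormZ (Lfun_Sub p1 mf) a).
Qed.

Lemma Linfty_ae_le d (Z : measurableType d) (mu : {measure set Z -> \bar R})
    (f : Z -> R) (C : R) : (snorm (Lp_space mu +oo%E) f <= C%:E)%E ->
  {ae mu, forall x, `|f x| <= C}.
Proof.
rewrite /= unlock; case: ifPn => [_|] h.
  by move/ess_supP : h => h; apply: (aeS h) => x; rewrite /= lee_fin.
(* When the whole space has measure 0 the L^oo norm is 0 by convention, and the whole space can
   serve as exceptional set. *)
move=> _; exists setT; split => //.
by apply/eqP; rewrite eq_le measure_ge0 andbT leNgt.
Qed.

End FunctionSpaces.

Section Nemytskii.
Context {R : realType}.

Lemma cvg_powR0 (x_ : nat -> R) (r : R) : 0 < r -> (forall n, 0 <= x_ n) ->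
  x_ n @[n --> \oo] --> (0 : R) -> x_ n `^ r @[n --> \oo] --> (0 : R).
Proof.
move=> r0 x0 cx; apply/cvgrPdist_le => e e0.
have e1 : 0 < e `^ r^-1 by rewrite powR_gt0.
move/cvgrPdist_le : cx => /(_ _ e1); apply: filterS => n.
rewrite !sub0r !normrN !ger0_norm ?powR_ge0// => h.
rewrite -[leRHS]powRr1 ?(ltW e0)// -(@mulVf _ r) ?gt_eqF// powRrM.
apply: ge0_ler_powR; rewrite ?nnegrE ?(ltW r0) ?(ltW e1)//.
Qed.

Context d (Z : measurableType d) (mu : {measure set Z -> \bar R}) (p : R).
Hypotheses (mufin : (mu setT < +oo)%E) (p1 : 1 <= p).

Let p0 : 0 < p. Proof. exact: lt_le_trans p1. Qed.

Lemma bounded_Lfun (g : Z -> R) (C : R) : measurable_fun setT g ->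
  (forall x, `|g x| <= C) -> g \in Lfun mu p%:E.
Proof.
move=> mg gC; rewrite inE/= /finite_norm; apply/andP; split; first by rewrite inE.
rewrite inE /= /finite_norm unlock; apply: poweR_lty.
apply: (@le_lt_trans _ _ (\int[mu]_x (cst (C `^ p)%:E x))%E).
  apply: ae_le_lower_integral => [x _|x _|]; rewrite ?poweR_ge0// ?lee_fin ?powR_ge0//.
  apply: aeW => x _; rewrite /= lee_fin; apply: ge0_ler_powR => //.
  - exact: ltW.
  - by rewrite nnegrE; exact: le_trans (gC x).
by rewrite integral_cst// lte_mul_pinfty// ?lee_fin ?powR_ge0.
Qed.

Lemma nrm_Lp_cvg0 (g_ : nat -> Lp_space mu p%:E) :
  (forall n, member (Lp_space mu p%:E) (g_ n)) ->
  (nrm (g_ n) @[n --> \oo] --> (0 : R)) <->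
  ((\int[mu]_x (`|g_ n x| `^ p)%:E)%E @[n --> \oo] --> 0%E).
Proof.
move=> mg; have sL := Lp_seminormed mu (p := p%:E) p1.
have pn0 : p != 0 by rewrite gt_eqF.
have E n : (\int[mu]_x (`|g_ n x| `^ p)%:E = ((nrm (g_ n)) `^ p)%:E)%E.
  by rewrite -poweR_EFin -(nrmE sL (mg n)) /= powR_Lnorm.
split=> h.
  rewrite (_ : (fun n => _) = (fun n => ((nrm (g_ n)) `^ p)%:E)); last exact/funext.
  apply: cvg_EFin; first exact: nearW.
  by apply: cvg_powR0 => // n; exact: (nrm_ge0 sL (mg n)).
move: h; rewrite (_ : (fun n => _) = (fun n => ((nrm (g_ n)) `^ p)%:E)); last exact/funext.
move/fine_cvgP => [_ h].
have := cvg_powR0 (r := p^-1) (x_ := fun n => (nrm (g_ n)) `^ p) _ _ h.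
rewrite invr_gt0 => /(_ p0 (fun n => powR_ge0 _ _)).
rewrite (_ : (fun n => _ `^ _) = (fun n => nrm (g_ n)))//.
by apply/funext => n; rewrite -powRrM mulfV// powRr1// (nrm_ge0 sL (mg n)).
Qed.

(** Strong convergence gives convergence almost everywhere along a subsequence; dominated
    convergence with the constant (2C)^p on a finite measure space concludes there, and the
    subsequence principle returns to the full sequence. The hypothesis on [h_] ranges over
    subsequences because its index is extracted together with that of [f_]. *)
Lemma nemytskii_cvg (f_ : nat -> Lp_space mu p%:E) (f : Lp_space mu p%:E)
    (h_ : nat -> R -> R) (h : R -> R) (C : R) :
  (forall n, member (Lp_space mu p%:E) (f_ n)) -> member (Lp_space mu p%:E) f ->
  (forall n, measurable_fun setT (h_ n)) -> measurable_fun setT h ->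
  (forall n z, `|h_ n z| <= C) -> (forall z, `|h z| <= C) ->
  (forall s (z_ : nat -> R) z, increasing_index s -> z_ n @[n --> \oo] --> z ->
     h_ (s n) (z_ n) @[n --> \oo] --> h z) ->
  nrm (f_ n - f) @[n --> \oo] --> (0 : R) ->
  nrm ((h_ n \o f_ n : Lp_space mu p%:E) - (h \o f)) @[n --> \oo] --> (0 : R).
Proof.
move=> mf_ mf mh_ mh bh_ bh ch cf; have sL := Lp_seminormed mu (p := p%:E) p1.
have mm (g : Z -> R) : g \in Lfun mu p%:E -> measurable_fun setT g.
  by move=> /sub_Lfun_mfun; rewrite inE.
have mhf n : member (Lp_space mu p%:E) (h_ n \o f_ n).
  by apply: (@bounded_Lfun _ C) => // [|x]; [apply: measurableT_comp => //; exact: mm (mf_ n)|exact: bh_].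
have mhf0 : member (Lp_space mu p%:E) (h \o f).
  by apply: (@bounded_Lfun _ C) => // [|x]; [apply: measurableT_comp => //; exact: mm|exact: bh].
apply: subseq_principle => s hs.
have cfs := cvg_subseq hs cf.
have mfs n : member (Lp_space mu p%:E) (f_ (s n) - f) by exact: (memberB sL).
have /(nrm_Lp_cvg0 mfs) Ics := cfs.
have [s' hs' aes'] := @ae_subseq_of_integral _ _ _ mu setT
  (fun n x => `|(f_ (s n) - f) x| `^ p) measurableT
  (fun n => measurableT_comp (measurable_powR p) (measurableT_comp (@normr_measurable R setT) (mm _ (mfs n))))
  (fun n x _ => powR_ge0 _ _) Ics.
exists s' => //.
have mk n : member (Lp_space mu p%:E) ((h_ (s (s' n)) \o f_ (s (s' n)) : Lp_space mu p%:E) - (h \o f)).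
  exact: (memberB sL).
apply/(nrm_Lp_cvg0 mk).
have C0 : 0 <= C by exact: le_trans (bh 0).
have := @dominated_convergence _ _ _ mu setT measurableT
  (fun n x => (`|((h_ (s (s' n)) \o f_ (s (s' n)) : Lp_space mu p%:E) - (h \o f)) x| `^ p)%:E)
  (cst 0%E) (cst ((2 * C) `^ p)%:E).
case.
- move=> n; apply/measurable_EFinP.
  exact: (measurableT_comp (measurable_powR p) (measurableT_comp (@normr_measurable R setT) (mm _ (mk n)))).
- exact: measurable_cst.
- apply: (aeS aes') => x /(_ I) cx _; apply: cvg_EFin; first exact: nearW.
  have c1 : `|(f_ (s (s' n)) - f) x| @[n --> \oo] --> (0 : R).
    have := cvg_powR0 (r := p^-1) _ _ cx; rewrite invr_gt0 => /(_ p0 (fun n => powR_ge0 _ _)).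
    rewrite (_ : (fun n => _ `^ _) = (fun n => `|(f_ (s (s' n)) - f) x|))//.
    by apply/funext => n; rewrite -powRrM mulfV ?gt_eqF// powRr1.
  have c2 : f_ (s (s' n)) x @[n --> \oo] --> f x.
    move/norm_cvg0P : c1 => c1.
    rewrite (_ : (fun n => _) = (fun n => (f_ (s (s' n)) - f) x + f x)); last first.
      by apply/funext => n; exact: (esym (subrK (f x) _)).
    by rewrite -[X in _ --> X]add0r; apply: cvgD; [exact: c1|exact: cvg_cst].
  have c3 := ch (s \o s') _ _ (increasing_index_comp hs hs') c2.
  apply: cvg_powR0 => //; rewrite -(normr0 R).
  apply: cvg_norm; rewrite -(subrr (h (f x))).
  by apply: cvgB; [exact: c3|exact: cvg_cst].
- apply/integrableP; split; first exact: measurable_cst.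
  by rewrite /= ger0_norm ?powR_ge0// integral_cst// lte_mul_pinfty// ?lee_fin ?powR_ge0.
- apply: aeW => x n _; rewrite /= lee_fin ger0_norm ?powR_ge0//.
  apply: ge0_ler_powR; rewrite ?nnegrE ?(ltW p0) ?mulr_ge0//.
  rewrite (le_trans (ler_normB _ _))//= mulr2n mulrDl mul1r lerD//.
by move=> _ _; rewrite integral0.
Qed.

End Nemytskii.

Section Networks.
Context {R : realType}.
Variables (sigma : R -> R) (csigma : continuous sigma).

Lemma ndual_comp (E E' : normedModType R) (f : E -> E') (psi : E' -> R^o) (C : R) :
  (forall (a : R) x y, f (a *: x + y) = a *: f x + f y) ->
  (forall x, `|f x| <= C * `|x|) ->
  member (dual (nspace E')) psi -> member (dual (nspace E)) (psi \o f).
Proof.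
move=> lf bf dpsi; apply: (dual_comp (A := nspace E) (B := nspace E')) => //.
- exact: nspace_seminormed.
- split=> // [a x y _ _|]; first by rewrite lf /same /= subrr normr0.
  by exists C => x _; rewrite -EFinM lee_fin.
Qed.

Lemma normr_fst (E E' : normedModType R) (x : E * E') : `|x.1| <= `|x|.
Proof. by rewrite prod_normE le_max lexx. Qed.

Lemma normr_snd (E E' : normedModType R) (x : E * E') : `|x.2| <= `|x|.
Proof. by rewrite prod_normE le_max lexx orbT. Qed.

Lemma le_mx_norm (m n : nat) (x : 'M[R]_(m, n)) a b : `|x a b| <= `|x|.
Proof.
rewrite [leRHS]mx_normrE.
exact: (le_bigmax _ (fun ij : 'I_m * 'I_n => `|x ij.1 ij.2|) (a, b)).
Qed.

Lemma dual_entry (m n : nat) (a : 'I_m) (b : 'I_n) :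
  member (dual (nspace 'M[R]_(m, n))) (fun M : 'M[R]_(m, n) => M a b : R^o).
Proof.
apply: dualP => [c x y _ _|]; first by rewrite !mxE.
exists 1 => x _; rewrite mul1e lee_fin; exact: le_mx_norm.
Qed.

Variables (I : Type) (F : set_system I) (FF : Filter F).

Lemma cvg_sum_seq (J : Type) (r : seq J) (f : J -> I -> R) (l : J -> R) :
  (forall b, f b t @[t --> F] --> l b) ->
  \sum_(b <- r) f b t @[t --> F] --> \sum_(b <- r) l b.
Proof.
move=> fl; elim: r => [|b r ih].
  by rewrite big_nil; under eq_fun do rewrite big_nil; exact: cvg_cst.
by rewrite big_cons; under eq_fun do rewrite big_cons; exact: cvgD.
Qed.

Lemma cvg_entries_affine (j i : nat) (om_ : I -> 'M[R]_(j, i)) (om : 'M[R]_(j, i))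
    (be_ : I -> 'cV[R]_j) (be : 'cV[R]_j) (z_ : I -> 'cV[R]_i) (z : 'cV[R]_i) (a : 'I_j) :
  (forall b, om_ t a b @[t --> F] --> om a b) ->
  be_ t a ord0 @[t --> F] --> be a ord0 ->
  (forall b, z_ t b ord0 @[t --> F] --> z b ord0) ->
  (om_ t *m z_ t + be_ t) a ord0 @[t --> F] --> (om *m z + be) a ord0.
Proof.
move=> com cbe cz; rewrite mxE (_ : (fun t => _) =
  (fun t => \sum_b om_ t a b * z_ t b ord0 + be_ t a ord0)); last first.
  by apply/funext => t; rewrite !mxE.
apply: cvgD => //; rewrite mxE.
by apply: cvg_sum_seq => b; apply: cvgM.
Qed.

(** Parameters converge only against functionals, but matrix entries are functionals, so every entry
    converges. The filter is arbitrary: sequences give convergence of the operators, and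
    neighbourhood filters give continuity, hence measurability, in the input. *)
Lemma network_cvg hs i (th_ : I -> params (R := R) i hs) th (z_ : I -> 'cV[R]_i) (z : 'cV[R]_i) :
  (forall psi, member (dual (nspace (params i hs))) psi ->
    psi (th_ t) @[t --> F] --> (psi th : R^o)) ->
  (forall a, z_ t a ord0 @[t --> F] --> z a ord0) ->
  network sigma (th_ t) (z_ t) @[t --> F] --> network sigma th z.
Proof.
elim: hs i th_ th z_ z => [|j hs ih] i th_ th z_ z cth cz /=.
  have entry1 a b : (th_ t).1 a b @[t --> F] --> th.1 a b.
    apply: (cth (fun x : 'M[R]_(1, i) * 'cV[R]_1 => x.1 a b : R^o)).
    apply: (ndual_comp (f := fst) (C := 1) _ _ (dual_entry a b)) => // x.
    by rewrite mul1r normr_fst.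
  have entry2 a b : (th_ t).2 a b @[t --> F] --> th.2 a b.
    apply: (cth (fun x : 'M[R]_(1, i) * 'cV[R]_1 => x.2 a b : R^o)).
    apply: (ndual_comp (f := snd) (C := 1) _ _ (dual_entry a b)) => // x.
    by rewrite mul1r normr_snd.
  by apply: cvg_entries_affine.
have fst1 psi : member (dual (nspace ('M[R]_(j, i) * 'cV[R]_j)%type)) psi ->
    psi (th_ t).1 @[t --> F] --> (psi th.1 : R^o).
  move=> dpsi; apply: (cth (psi \o fst)); apply: (ndual_comp (C := 1)) dpsi => // x.
  by rewrite mul1r normr_fst.
apply: ih => [psi dpsi|a].
  apply: (cth (psi \o snd)); apply: (ndual_comp (C := 1)) dpsi => // x.
  by rewrite mul1r normr_snd.
have entry1 a' b : (th_ t).1.1 a' b @[t --> F] --> th.1.1 a' b.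
  apply: (fst1 (fun x : 'M[R]_(j, i) * 'cV[R]_j => x.1 a' b : R^o)).
  apply: (ndual_comp (f := fst) (C := 1) _ _ (dual_entry a' b)) => // x.
  by rewrite mul1r normr_fst.
have entry2 a' b : (th_ t).1.2 a' b @[t --> F] --> th.1.2 a' b.
  apply: (fst1 (fun x : 'M[R]_(j, i) * 'cV[R]_j => x.2 a' b : R^o)).
  apply: (ndual_comp (f := snd) (C := 1) _ _ (dual_entry a' b)) => // x.
  by rewrite mul1r normr_snd.
rewrite mxE (_ : (fun t => _) =
  (fun t => sigma (((th_ t).1.1 *m z_ t + (th_ t).1.2) a ord0))); last first.
  by apply/funext => t; rewrite mxE.
by apply: continuous_cvg; [exact: csigma|exact: cvg_entries_affine].
Qed.

Lemma affine_bounded (j i : nat) (om : 'M[R]_(j, i)) (be : 'cV[R]_j) (z : 'cV[R]_i) A a :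
  `|om| <= A -> `|be| <= A -> (forall b, `|z b ord0| <= A) ->
  `|(om *m z + be) a ord0| <= i%:R * (A * A) + A.
Proof.
move=> hom hbe hz; rewrite !mxE (le_trans (ler_normD _ _))// lerD//; last first.
  by rewrite (le_trans _ hbe)//; exact: le_mx_norm.
rewrite (le_trans (ler_norm_sum _ _ _))//.
apply: (@le_trans _ _ (\sum_(b < i) A * A)); last by rewrite sumr_const card_ord mulr_natl.
apply: ler_sum => b _; rewrite normrM; apply: ler_pM => //.
by rewrite (le_trans _ hom)//; exact: le_mx_norm.
Qed.

Lemma continuous_bounded_itv (B : R) : exists C : R, forall x, `|x| <= B -> `|sigma x| <= C.
Proof.
have [B0|B0] := leP 0 B; last first.
  by exists 0 => x xB; have := le_lt_trans (le_trans (normr_ge0 x) xB) B0; rewrite ltxx.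
have [||c _ hc] := @EVT_max R (fun x => `|sigma x|) (- B) B.
- by lra.
- apply: continuous_subspaceT => x.
  by apply: (continuous_cvg _ (@norm_continuous _ R^o _)); exact: csigma.
by exists `|sigma c| => x; rewrite ler_norml => h; apply: hc; rewrite in_itv.
Qed.

Lemma network_bounded hs i (A : R) : exists C : R,
  forall (th : params (R := R) i hs) (z : 'cV[R]_i), `|th| <= A -> (forall a, `|z a ord0| <= A) ->
    `|network sigma th z| <= C.
Proof.
elim: hs i A => [|j hs ih] i A /=.
  exists (i%:R * (A * A) + A) => th z hth hz; apply: affine_bounded => //.
    exact: le_trans (normr_fst _) hth.
  exact: le_trans (normr_snd _) hth.
have [B hB] := continuous_bounded_itv (i%:R * (A * A) + A).
(* The maximum bounds the remaining parameters, by A, as well as the activations of the first layer,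
   by B. *)
have [C hC] := ih j (Num.max A B).
exists C => th z hth hz; apply: hC => [|a].
  by rewrite le_max (le_trans (normr_snd _) hth).
rewrite mxE le_max; apply/orP; right; apply: hB; apply: affine_bounded => //.
  exact: le_trans (le_trans (normr_fst _) (normr_fst _)) hth.
exact: le_trans (le_trans (normr_snd _) (normr_fst _)) hth.
Qed.

End Networks.

(** * Bounded sets have finite measure; almost every section of a null set is null *)

Section LebesgueMeasure.
Context {R : realType}.
Local Notation mR := (measurableTypeR R).
Local Notation leb := (@lebesgue_measure R).

(** Cubes live in tuples, where the measure is built recursively: [tcons] pulls a cube back to an
    interval times a cube of one dimension less, so finiteness of the measure follows by
    induction. *)
Definition box (n : nat) (k : R) : set (n.-tuple mR) :=
  [set t | forall i, `|tnth t i : R| <= k].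
Arguments box : clear implicits.

Lemma measurable_box n k : measurable (box n k).
Proof.
rewrite (_ : box n k = \bigcap_(i in [set: 'I_n]) ((@tnth n mR) ^~ i) @^-1` `[- k, k]%classic).
  apply: fin_bigcap_measurable => // i _.
  by rewrite -[X in measurable X]setTI; apply: measurable_tnth.
apply/seteqP; split=> t h i; first by move=> _; rewrite /= in_itv/= -ler_norml; exact: h.
by have := h i Logic.I; rewrite /= in_itv/= -ler_norml.
Qed.

Lemma lebesgue_tuple_box n k : (lebesgue_tuple R n (box n k) < +oo)%E.
Proof.
elim: n => [|n ih]; first by rewrite /= diracE; case: (_ \in _); rewrite ltry.
have E : (@tcons R n) @^-1` (box n.+1 k) = `[- k, k]%classic `*` box n k.
  apply/seteqP; split=> [[a t] h|[a t] [/= ha ht] i].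
    split=> [|i] /=; first by rewrite in_itv/= -ler_norml; exact: (h ord0).
    have := h (lift ord0 i); rewrite /tcons (tnth_nth 0) /= => {}h.
    by rewrite (tnth_nth 0).
  rewrite in_itv/= -ler_norml in ha.
  case: (unliftP ord0 i) => [j ->|->]; last by rewrite (tnth_nth 0).
  by have := ht j; rewrite !(tnth_nth 0).
have fin : (leb (`[(- k)%R, k]%classic : set mR) < +oo)%E.
  rewrite lebesgue_measure_itv/=.
  by case: ifP => // _; rewrite -EFinB ltry.
rewrite /= /transport /pushforward E /product_sfm product_measure1E//.
  apply: lte_mul_pinfty => //.
    by rewrite ge0_fin_numE.
exact: measurable_box.
Qed.

Lemma bounded_lebesgue_Rn d (Omega : set 'rV[R]_d) : measurable (Omega : set (Rn R d)) ->
  bounded_set Omega -> (lebesgue_Rn R d Omega < +oo)%E.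
Proof.
move=> mO [M [Mr hM]]; apply: (le_lt_trans _ (lebesgue_tuple_box d (`|M| + 1))).
rewrite /lebesgue_Rn /= /transport /pushforward; apply: le_measure.
- by rewrite inE -[X in measurable X]setTI; exact: measurable_Rn_of_tuple.
- by rewrite inE; exact: measurable_box.
move=> t /= Ot i.
have M1 : M < `|M| + 1 by rewrite (le_lt_trans (ler_norm M))// ltrDl.
have := hM _ M1 _ Ot; apply: le_trans.
rewrite -(Rn_of_tupleE t ord0 i); exact: le_mx_norm.
Qed.

Lemma lebesgue_on_fin d (Omega : set 'rV[R]_d) (OmegaP : bounded_lipschitz_domain Omega) :
  (lebesgue_on OmegaP setT < +oo)%E.
Proof.
rewrite /lebesgue_on /= /mrestr setTI; apply: bounded_lebesgue_Rn.
  exact: bounded_lipschitz_domain_measurable.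
by case: OmegaP.
Qed.

(** The measure of a null set in the cylinder unfolds to the integral over t of the measures of its
    sections; a nonnegative function with integral 0 vanishes almost everywhere. *)
Lemma ae_cylinder_sections (T : R) d (Omega : set 'rV[R]_d)
    (OmegaP : bounded_lipschitz_domain Omega) (P : mR * Rn R d -> Prop) :
  {ae lebesgue_cylinder T OmegaP, forall x, P x} ->
  {ae leb, forall t, t \in `]0, T[ -> {ae lebesgue_on OmegaP, forall x, P (t, x)}}.
Proof.
move=> [N [mN N0 sN]].
have mO := bounded_lipschitz_domain_measurable OmegaP.
pose C : set (mR * Rn R d) := `]0, T[%classic `*` Omega.
have mC : measurable C by apply: measurableX.
have mNC : measurable (N `&` C) by exact: measurableI.
have : (\int[leb]_t (lebesgue_Rn R d \o xsection (N `&` C)) t = 0)%E by [].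
have mx : measurable_fun setT (lebesgue_Rn R d \o xsection (N `&` C)).
  exact: measurable_fun_xsection.
rewrite (eq_integral (fun t => `|(lebesgue_Rn R d \o xsection (N `&` C)) t|%E)); last first.
  by move=> t _; rewrite gee0_abs.
move/(ae_eq_integral_abs leb measurableT mx) => h.
apply: (aeS h) => t /(_ I) /= h0 It.
exists (xsection N t); split.
- exact: measurable_xsection.
- rewrite /lebesgue_on /= /mrestr -h0; congr (_ _).
  apply/seteqP; split => x; rewrite /xsection /= !inE /=.
    by move=> [Nx Ox]; split => //; split.
  by move=> [Nx [_ Ox]].
- by move=> x /= nP; rewrite /xsection /= inE; apply: sN.
Qed.

Lemma locLip_continuous (sigma : R -> R) :
  (forall x : R, exists2 A : set R, nbhs x A &
     exists k : R, k.-lipschitz_A (sigma : R^o -> R^o)) -> continuous sigma.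
Proof.
move=> h x; have [A Ax [k lk]] := h x.
apply/cvgrPdist_le => e e0.
have k1 : 0 < `|k| + 1 by rewrite ltr_pwDr.
near=> y.
have Ay : A y by near: y.
have := lk (x, y) (conj (nbhs_singleton Ax) Ay) => /= /le_trans; apply.
apply: (@le_trans _ _ ((`|k| + 1) * `|x - y|)).
  by rewrite ler_wpM2r// (le_trans (ler_norm k))// lerDl.
rewrite -ler_pdivlMl//; near: y.
by move/cvgrPdist_le : (@cvg_id _ (nbhs x)); apply; rewrite mulr_gt0// invr_gt0.
Unshelve. all: by end_near.
Qed.

End LebesgueMeasure.

Lemma ae_countable d (Z : measurableType d) (R : realType)
    (mu : {measure set Z -> \bar R}) (J : Type) (D : set J) (P : J -> Z -> Prop) :
  countable D -> (forall v, {ae mu, forall t, P v t}) ->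
  {ae mu, forall t, forall v, D v -> P v t}.
Proof.
move=> /countable_injP[f fi] hP.
have h n : {ae mu, forall t, forall v, D v -> f v = n -> P v t}.
  have [[v [Dv fv]]|nv] := pselect (exists v, D v /\ f v = n); last first.
    by apply: aeW => t v Dv fv; exfalso; apply: nv; exists v.
  apply: (aeS (hP v)) => t Pt w Dw fw.
  by rewrite (fi w v) ?mem_set// fv.
by apply: (aeS (ae_foralln h)) => t ht v Dv; exact: ht Dv erefl.
Qed.

(** * Superposition of Carathéodory functions, up to null sets *)

Section AlmostEverywhereMeasurable.
Context {R : realType}.
Local Notation mR := (measurableTypeR R).
Local Notation leb := (@lebesgue_measure R).
Implicit Types (E : normedModType R) (T : R).

(** A notion for real functions only: it suffices for the norm of the PDE residual, which is all
    that extraction of an almost everywhere convergent subsequence asks for. *)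
Definition ae_measurable T (f : R -> R) := exists2 g : mR -> R,
  measurable_fun setT g & {ae leb, forall t, t \in `]0, T[ -> f t = g t}.

Lemma ae_measurable_norm E T (f : R -> E) : strongly_measurable T f ->
  ae_measurable T (fun t => `|f t|).
Proof.
move=> /strongly_measurable_repr[g pg [_ fg]].
exists (fun t => `|g t|); first exact: measurable_norm_repr.
by apply: (aeS fg) => t h It; rewrite h.
Qed.

Lemma ae_measurable_lim T (f_ : nat -> R -> R) (f : R -> R) :
  (forall n, ae_measurable T (f_ n)) ->
  {ae leb, forall t, t \in `]0, T[ -> f_ n t @[n --> \oo] --> f t} ->
  ae_measurable T f.
Proof.
move=> /(_ _)/cid2-/all_sig2[g mg fg] ff.
have : {ae leb, forall t, t \in `]0, T[ -> g n t @[n --> \oo] --> f t}.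
  apply: (ae2 ff (ae_foralln fg)) => t h h' It; have := h It.
  rewrite (_ : (fun n => f_ n t) = (fun n => g n t))//.
  by apply/funext => n; exact: h'.
move=> [N [mN N0 sN]].
pose D : set mR := `]0, T[%classic `\` N.
have mD : measurable D by exact: measurableD.
exists (fun t => f t * \1_D t).
  apply: (@measurable_fun_cvg _ _ _ _ (fun n (t : mR) => g n t * \1_D t)).
    by move=> n; apply: measurable_funM => //; exact: measurable_indic.
  move=> t _; rewrite indicE; case: (boolP (t \in D)) => [/set_mem[It nN]|_] /=; last first.
    by rewrite mulr0; under eq_fun do rewrite mulr0; exact: cvg_cst.
  rewrite mulr1; under eq_fun do rewrite mulr1.
  move: nN; apply: contra_notP => nc; apply: sN => /= h; apply: nc; exact: h It.
exists N; split => // t /= /not_implyP[It]; apply: contra_notP => nN.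
by rewrite indicE mem_set// mulr1.
Qed.

(** A simple function has finitely many values, so the exceptional sets of the corresponding [phi v]
    form one null set. Limits of simple functions then reach general arguments through continuity in
    [v]. *)
Lemma ae_measurable_simple E T (s : R -> E) (phi : E -> R -> R) :
  simple_fun s -> (forall v, ae_measurable T (phi v)) ->
  ae_measurable T (fun t => phi (s t) t).
Proof.
move=> ss /(_ _)/cid2-/all_sig2[g mg phig]; have [fs ms] := ss.
exists (fun t => g (s t) t).
  move=> _ B mB; rewrite setTI.
  have -> : (fun t => g (s t) t) @^-1` B =
      \bigcup_(v in range s) ((s @^-1` [set v]) `&` (g v @^-1` B)).
    apply/seteqP; split=> [t Bt|t [v _ [/= <-]]//].
    by exists (s t); [exists t|split].
  apply: fin_bigcup_measurable => // v _; apply: measurableI; first exact: ms.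
  by rewrite -[X in measurable X]setTI; exact: mg.
have : {ae leb, forall t, forall v, range s v -> t \in `]0, T[ -> phi v t = g v t}.
  by apply: ae_countable => //; exact: finite_set_countable.
move=> h; apply: (aeS h) => t ht It; apply: ht => //; by exists t.
Qed.

Lemma L2_ae_subseq E T (f_ : nat -> R -> E) :
  (forall n, ae_measurable T (fun t => `|f_ n t|)) ->
  sq_integral T (f_ n) @[n --> \oo] --> 0%E ->
  exists2 s, increasing_index s &
    {ae leb, forall t, t \in `]0, T[ -> f_ (s n) t @[n --> \oo] --> (0 : E)}.
Proof.
move=> /(_ _)/cid2-/all_sig2[g mg fg] If.
have Ig : (\int[leb]_(t in `]0%R, T[%classic) ((g n t) ^+ 2)%:E)%E @[n --> \oo] --> 0%E.
  rewrite (_ : (fun n => _) = (fun n => sq_integral T (f_ n)))//.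
  apply/funext => n; apply/esym; apply: ae_eq_lower_integral.
  - by move=> t _; rewrite lee_fin exprn_ge0.
  - by move=> t _; rewrite lee_fin sqr_ge0.
  - by apply: (aeS (fg n)) => t h It; rewrite h.
have [s hs sP] := @ae_subseq_of_integral _ mR R leb (`]0%R, T[%classic : set mR)
  (fun n t => g n t ^+ 2) (measurable_itv _)
  (fun n => measurable_funS measurableT (@subsetT _ _) (measurable_funX 2 (mg n)))
  (fun n t _ => sqr_ge0 _) Ig.
exists s => //; apply: (ae2 sP (ae_foralln fg)) => t h h' It.
apply/norm_cvg0P; have := h It => c.
have := cvg_powR0 (r := 2^-1) (x_ := fun n => g (s n) t ^+ 2) _ _ c.
rewrite invr_gt0 => /(_ (ltr0n _ 2) (fun n => sqr_ge0 _)).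
rewrite (_ : (fun n => _ `^ _) = (fun n => `|f_ (s n) t|))//.
by apply/funext => n; rewrite powR12_sqrt ?sqr_ge0// sqrtr_sqr -(h' (s n) It) normr_id.
Qed.

End AlmostEverywhereMeasurable.

(** * Weak convergence in products *)

Section Products.
Context {R : realType}.
Implicit Types A B : fspace R.

Lemma sqrteDl_ge (a b : \bar R) : (0 <= a)%E -> (0 <= b)%E -> (a <= sqrte (a ^+ 2 + b ^+ 2))%E.
Proof.
move=> a0 b0; rewrite -[leLHS]gee0_abs// -sqrte_sqr lee_sqrt ?adde_ge0 ?sqre_ge0//.
by rewrite leeDl// sqre_ge0.
Qed.

Lemma weak_cvg_fst A B (z_ : nat -> prod_space A B) z :
  (forall x, member A x -> (0 <= snorm A x)%E) ->
  (forall y, member B y -> (0 <= snorm B y)%E) ->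
  weak_cvg z_ z -> weak_cvg (fun n => (z_ n).1) z.1.
Proof.
move=> A0 B0; apply: (weak_cvg_linear (A := prod_space A B) (f := fst)) => //.
- by move=> x [].
- by move=> x [mx my]; rewrite A0//= sqrteDl_ge ?A0 ?B0.
Qed.

Lemma weak_cvg_snd A B (z_ : nat -> prod_space A B) z :
  (forall x, member A x -> (0 <= snorm A x)%E) ->
  (forall y, member B y -> (0 <= snorm B y)%E) ->
  weak_cvg z_ z -> weak_cvg (fun n => (z_ n).2) z.2.
Proof.
move=> A0 B0; apply: (weak_cvg_linear (A := prod_space A B) (f := snd)) => //.
- by move=> x [].
- by move=> x [mx my]; rewrite B0//= addeC sqrteDl_ge ?A0 ?B0.
Qed.

Lemma snorm_pairl A B (x : A) (y : B) : (0 <= snorm A x)%E -> snorm B y = 0%E ->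
  snorm (prod_space A B) (x, y) = snorm A x.
Proof. by move=> x0 y0; rewrite /= y0 mule0 adde0 -expe2 sqrte_sqr gee0_abs. Qed.

Lemma snorm_pairr A B (x : A) (y : B) : (0 <= snorm B y)%E -> snorm A x = 0%E ->
  snorm (prod_space A B) (x, y) = snorm B y.
Proof. by move=> y0 x0; rewrite /= x0 mule0 add0e -expe2 sqrte_sqr gee0_abs. Qed.

Lemma weak_cvg_pair A B (x_ : nat -> A) x (y_ : nat -> B) y :
  member A 0 -> snorm A 0 = 0%E -> (forall x, member A x -> (0 <= snorm A x)%E) ->
  member B 0 -> snorm B 0 = 0%E -> (forall y, member B y -> (0 <= snorm B y)%E) ->
  weak_cvg x_ x -> weak_cvg y_ y ->
  weak_cvg (A := prod_space A B) (fun n => (x_ n, y_ n)) (x, y).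
Proof.
move=> mA A0 Age mB B0 Bge [mx_ mx cx] [my_ my cy]; split => //.
  by move=> n; split; [exact: mx_|exact: my_].
move=> phi dphi; have lphi := dual_lin dphi; have [_ _ [C hC]] := dphi.
have split2 a b : member A a -> member B b -> phi (a, b) = phi (a, 0) + phi (0, b).
  move=> ma mb; have := lphi 1 (a, 0) (0, b) (conj ma mB) (conj mA mb).
  by rewrite mul1r => <-; congr phi; rewrite scale1r; congr pair; rewrite ?addr0 ?add0r.
rewrite (_ : (fun n => _) = (fun n => phi (x_ n, 0) + phi (0, y_ n))); last first.
  by apply/funext => n; exact: split2.
rewrite split2//; apply: cvgD.
- apply: (cx (fun a => phi (a, 0))); apply: dualP => [a u v mu mv|].
    rewrite -(lphi a (u, 0) (v, 0))//; congr phi; congr pair.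
    by rewrite /= scaler0 addr0.
  by exists C => a ma; have := hC (a, 0) (conj ma mB); rewrite snorm_pairl ?Age.
- apply: (cy (fun b => phi (0, b))); apply: dualP => [a u v mu mv|].
    rewrite -(lphi a (0, u) (0, v))//; congr phi; congr pair.
    by rewrite /= scaler0 addr0.
  by exists C => b mb; have := hC (0, b) (conj mA mb); rewrite snorm_pairr ?Bge.
Qed.

(** Approximate linearity at 0 makes f(0) of norm 0, and injectivity pulls this back. For [Vcal]
    this avoids computing the derivative that [xget] selects for the zero function. *)
Lemma snorm0_of_embedding A B (f : A -> B) : seminormed B -> embedding f ->
  member A 0 -> snorm A 0 = 0%E.
Proof.
move=> sB [[mf lf _] inj] m0; apply: inj => //.
have := lf 1 0 0 m0 m0; rewrite /same !scale1r addr0 opprD addrA subrr add0r.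
have := snormZ sB (-1) (mf _ m0); rewrite normrN1 mul1e scaleN1r => ->.
exact.
Qed.

End Products.

Lemma ndualZ (R : realType) (E : normedModType R) (psi : nspace E -> R^o) :
  member (dual (nspace E)) psi -> forall (a : R) x, psi (a *: x) = a * psi x.
Proof.
move=> dpsi a x; have psi0 : psi 0 = 0.
  by have := ndual_sub dpsi 0 0; rewrite !subrr.
by have := ndual_lin dpsi a x 0; rewrite psi0 !addr0.
Qed.

(** * From weak convergence in [Vcal] to convergence at almost every time *)

Section WeakLimitsInTime.
Context {R : realType} (S : setting R).
Local Notation leb := (@lebesgue_measure R).
Local Notation T := (horizon S).
Local Notation V := (sV S).
Local Notation H := (sH S).
Local Notation W := (sW S).
Local Notation L := (Lphat S).
Implicit Types u : Vcal S.

Let bVH : bounded_linear (A := nspace V) (B := nspace H) (@j_VH R S).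
Proof. exact: (j_VH_embedding S).1. Qed.

Let bHW : bounded_linear (A := nspace H) (B := nspace W) (@j_HW R S).
Proof. exact: (j_HW_embedding S).1. Qed.

Let bVL : bounded_linear (A := nspace V) (@j_VL R S).
Proof. exact: (j_VL_compact S).1.1. Qed.

Lemma Vcal_lin (a : R) u u' : member (Vcal S) u -> member (Vcal S) u' ->
  member (Vcal S) (a *: u + u').
Proof.
have bHVt := (j_HVt_embedding S).1; apply: L2H1_lin => [|b x y].
  move=> x; apply: continuous_comp; exact: nbounded_linear_continuous.
by rewrite /= (nbounded_linear_lin bVH) (nbounded_linear_lin bHVt).
Qed.

Lemma Linfty_seminormed :
  seminormed (Lp_space (lebesgue_cylinder T (OmegaP S)) +oo%E).
Proof. by apply: Lp_seminormed; rewrite leey. Qed.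

Lemma Vcal_snorm0 : member (Vcal S) 0 -> snorm (Vcal S) 0 = 0%E.
Proof.
exact: (snorm0_of_embedding Linfty_seminormed (space_time_embedding S)).
Qed.

Lemma Vcal_snorm_ge0 u : (0 <= snorm (Vcal S) u)%E.
Proof. exact: sqrte_ge0. Qed.

Lemma L_seminormed : seminormed L.
Proof. by apply: Lp_seminormed; rewrite lee_fin phat_ge1. Qed.

Lemma weak_cvg_L2V (u_ : nat -> Vcal S) u : weak_cvg u_ u ->
  weak_cvg (A := L2 T V) u_ u.
Proof.
apply: (weak_cvg_linear (A := Vcal S) (B := L2 T V) (f := id)) => //.
  by move=> x [].
move=> x [mx _]; apply/andP; split; first exact: sqrte_ge0.
rewrite /= lee_sqrt; first by rewrite leeDl// sq_integral_ge0.
by rewrite adde_ge0 ?sq_integral_ge0.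
Qed.

Lemma weak_cvg_space_time_bound (u_ : nat -> Vcal S) u : weak_cvg u_ u ->
  exists2 C : R, 0 <= C & (snorm _ (space_time u) <= C%:E)%E /\
    forall n, (snorm _ (space_time (u_ n)) <= C%:E)%E.
Proof.
move=> wu; have sI := Linfty_seminormed.
have [mu_ mu _] := wu; have [[ms _ _] _] := space_time_embedding S.
have [C C0 hC] := weak_cvg_bounded sI
  (weak_cvg_comp Vcal_lin sI (space_time_embedding S).1 wu).
exists (Num.max C (nrm (space_time u))); first by rewrite le_max ltW.
split=> [|n].
  by rewrite (nrmE sI (ms _ mu)) lee_fin le_max lexx orbT.
by rewrite (nrmE sI (ms _ (mu_ n))) lee_fin le_max; apply/orP; left; exact: hC.
Qed.

Lemma eval_dual (t : R) (psi : H -> R^o) : t \in `[0, T] ->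
  member (dual (nspace H)) psi ->
  member (dual (Cspace T H)) (fun c => psi (c t)).
Proof.
move=> tI dpsi; apply: (dual_comp (f := fun c : Cspace T H => c t : nspace H)) dpsi.
- exact: (member_lin (Cspace_seminormed H (ltW (horizon_gt0 S)))).
- exact: nspace_seminormed.
- split=> // [a x y _ _|]; first by rewrite /same /= subrr normr0.
  by exists 1 => c _; rewrite mul1e; apply: ereal_sup_ubound; exists t.
Qed.

Lemma weak_cvg_cont_rep (u_ : nat -> Vcal S) u (t : R) : weak_cvg u_ u ->
  t \in `[0, T] -> forall psi, member (dual (nspace H)) psi ->
  psi (cont_rep (u_ n) t) @[n --> \oo] --> (psi (cont_rep u t) : R^o).
Proof.
move=> wu tI psi dpsi; have sC := Cspace_seminormed H (ltW (horizon_gt0 S)).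
have [_ _ h] := weak_cvg_comp Vcal_lin sC (cont_rep_embedding S).1 wu.
exact: (h _ (eval_dual tI dpsi)).
Qed.

(** The exceptional set only accounts for the passage to continuous representatives, which converge
    weakly at every time; it therefore does not depend on psi. *)
Lemma weak_cvg_pointwise (u_ : nat -> Vcal S) u : weak_cvg u_ u ->
  {ae leb, forall t, t \in `]0, T[ -> forall psi, member (dual (nspace H)) psi ->
    psi (j_VH (u_ n t)) @[n --> \oo] --> (psi (j_VH (u t)) : R^o)}.
Proof.
move=> wu; have [mu_ mu _] := wu.
have h_ : {ae leb, forall t, forall n, t \in `]0, T[ -> cont_rep (u_ n) t = j_VH (u_ n t)}.
  by apply: ae_foralln => n; exact: cont_repE.
apply: (ae2 h_ (cont_repE mu)) => t hn h It psi dpsi.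
have tI : t \in `[0, T].
  by move: It; rewrite !in_itv/= => /andP[/ltW -> /ltW ->].
have := weak_cvg_cont_rep wu tI dpsi; rewrite h//.
rewrite (_ : (fun n => psi (cont_rep (u_ n) t)) = (fun n => psi (j_VH (u_ n t))))//.
by apply/funext => n; rewrite hn.
Qed.

(** Stated for a general compact target because it serves twice: for L^phat in the network term and
    for H under pseudomonotonicity. The hypothesis before weak convergence expresses that limits in
    B and weak limits in H are compatible. *)
Lemma compact_embedding_ae_subseq (B : fspace R) (j : V -> B)
    (u_ : nat -> Vcal S) u :
  seminormed B -> compact_embedding (A := nspace V) j ->
  (forall (v_ : nat -> V) y, member B y ->
     snorm B (j (v_ n) - y) @[n --> \oo] --> 0%E ->
     (forall psi, member (dual (nspace H)) psi ->
       psi (j_VH (v_ n)) @[n --> \oo] --> (0 : R)) ->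
     snorm B y = 0%E) ->
  weak_cvg u_ u ->
  exists2 s, increasing_index s &
    {ae leb, forall t, t \in `]0, T[ ->
      nrm (j (u_ (s n) t - u t)) @[n --> \oo] --> (0 : R)}.
Proof.
move=> sB cj sep wu; have sV := L2_seminormed V T.
have wV := weak_cvg_L2V wu; have [mu_ mu _] := wV.
have [C C0 hC] := weak_cvg_bounded sV wV.
pose Phi : set (V -> R) := [set psi \o @j_VH R S | psi in [set psi | member (dual (nspace H)) psi]].
have [|||||s hs sP] := @compact_ae_subseq R V B T j Phi (fun n => u_ n - u) (C + nrm (u : L2 T V)) sB cj.
- move=> _ [psi /= dpsi <-] a v; apply: ndualZ.
  by apply: dual_comp dpsi => //; exact: nspace_seminormed.
- move=> v_ y my jy hy; apply: (sep v_ y my jy) => psi dpsi.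
  by apply: (hy (psi \o @j_VH R S)); exists psi.
- by move=> n; exact: (memberB sV).
- move=> n; apply: (le_trans (nrmD sV (mu_ n) _)).
    by rewrite -scaleN1r; exact: (memberZ sV).
  by rewrite (nrmN sV)// lerD2r.
- apply: (aeS (weak_cvg_pointwise wu)) => t h It _ [psi dpsi <-] /=.
  rewrite (_ : (fun n => _) = (fun n => psi (j_VH (u_ n t)) - psi (j_VH (u t)))).
    by rewrite -(subrr (psi (j_VH (u t)))); apply: cvgB; [exact: h|exact: cvg_cst].
  by apply/funext => n; rewrite -(ndual_sub dpsi) -(nbounded_linear_sub bVH).
by exists s.
Qed.

(** L^phat and H are compared inside W, where their embeddings agree on V by [j_VLW]. A functional
    of W pulls back to both spaces, so it annihilates j_LW(y); injectivity of [j_LW] gives the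
    claim. *)
Lemma separation_L (v_ : nat -> V) (y : L) : member L y ->
  snorm L (j_VL (v_ n) - y) @[n --> \oo] --> 0%E ->
  (forall psi, member (dual (nspace H)) psi ->
    psi (j_VH (v_ n)) @[n --> \oo] --> (0 : R)) ->
  snorm L y = 0%E.
Proof.
move=> my jy wv; have [bLW injLW] := j_LW_embedding S.
have sL := L_seminormed; have [mVL _ _] := bVL.
apply: injLW => //; suff -> : j_LW y = 0 by rewrite /= normr0.
apply: ndual_separates => chi dchi.
have dchiL := dual_comp (member_lin sL) (@nspace_seminormed R W) bLW dchi.
have [C C0 hC] := dual_bound sL dchiL.
have dchiH := dual_comp (member_lin (@nspace_seminormed R H)) (@nspace_seminormed R W) bHW dchi.
have c1 : chi (j_LW (j_VL (v_ n))) @[n --> \oo] --> (0 : R).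
  rewrite (_ : (fun n => _) = (fun n => (chi \o @j_HW R S) (j_VH (v_ n)))); last first.
    by apply/funext => n; rewrite j_VLW.
  exact: wv.
have c2 : chi (j_LW (j_VL (v_ n))) @[n --> \oo] --> (chi (j_LW y) : R).
  apply/cvgrPdist_le => e e0; move/fine_cvgP : jy => [_ /cvgrPdist_le].
  have C1 : 0 < C + 1 by rewrite ltr_pwDr.
  move=> /(_ (e / (C + 1)) (divr_gt0 e0 C1)); apply: filterS => n.
  rewrite sub0r normrN => h; rewrite distrC.
  have := hC _ (memberB sL (mVL (v_ n) I) my).
  have -> := dual_sub dchiL (mVL (v_ n) I) my; move=> /le_trans; apply.
  rewrite (le_trans (ler_wpM2l C0 (le_trans (ler_norm _) h)))//.
  by rewrite mulrCA ler_piMr ?(ltW e0)// ler_pdivrMr// mul1r lerDl.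
exact: (cvg_unique _ c2 c1).
Qed.

Lemma separation_H (v_ : nat -> V) (y : H) :
  snorm (nspace H) (j_VH (v_ n) - y) @[n --> \oo] --> 0%E ->
  (forall psi, member (dual (nspace H)) psi ->
    psi (j_VH (v_ n)) @[n --> \oo] --> (0 : R)) ->
  snorm (nspace H) y = 0%E.
Proof.
move=> jy wv; suff -> : y = 0 by rewrite /= normr0.
apply: ndual_separates => psi dpsi.
have cy : j_VH (v_ n) @[n --> \oo] --> y.
  apply/cvgrPdist_le => e e0; move/fine_cvgP : jy => [_ /cvgrPdist_le/(_ _ e0)].
    by apply: filterS => n; rewrite sub0r normrN /= normr_id distrC.
have c2 : psi (j_VH (v_ n)) @[n --> \oo] --> (psi y : R^o).
  exact: (continuous_cvg _ (ndual_continuous dpsi (x := y)) cy).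
exact: (cvg_unique _ c2 (wv _ dpsi)).
Qed.

End WeakLimitsInTime.

(** * The network operator *)

Section NetworkOperator.
Context {R : realType} (S : setting R) (m : nat) (hs : seq nat).
Variables (sigma : R -> R) (csigma : continuous sigma).
Local Notation leb := (@lebesgue_measure R).
Local Notation T := (horizon S).
Local Notation V := (sV S).
Local Notation W := (sW S).
Local Notation L := (Lphat S).
Local Notation muO := (lebesgue_on (OmegaP S)).
Local Notation Par := (params (R := R) (m + 1) hs).

Let bVL : bounded_linear (A := nspace V) (@j_VL R S).
Proof. exact: (j_VL_compact S).1.1. Qed.

(** Truncating the input makes the network a bounded function on the whole line, hence a Nemytskii
    operator on all of L^phat, without changing it on functions essentially bounded by [C]. *)
Definition clamp (C z : R) : R := Num.max (- C) (Num.min C z).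

Lemma clamp_id C z : `|z| <= C -> clamp C z = z.
Proof. by rewrite ler_norml /clamp => /andP[h1 h2]; rewrite min_r// max_r. Qed.

Lemma clamp_le C z : 0 <= C -> `|clamp C z| <= C.
Proof.
move=> C0; rewrite ler_norml /clamp le_max lexx/= ge_max ge_min lexx/= andbT.
by rewrite (le_trans _ C0)// oppr_le0.
Qed.

Lemma clamp_cvg (I : Type) (F : set_system I) (FF : Filter F) C (z_ : I -> R) z :
  z_ t @[t --> F] --> z -> clamp C (z_ t) @[t --> F] --> clamp C z.
Proof.
move=> cz; have cc : {for z, continuous (clamp C : R^o -> R^o)}.
  apply: (@continuous_max _ R^o (cst (- C)) (cst C \min id)); first exact: cvg_cst.
  by apply: continuous_min; [exact: cvg_cst|exact: cvg_id].
exact: (continuous_cvg _ cc cz).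
Qed.

Definition scalar_net (theta : Par) (alpha : 'cV[R]_m) (z : R) : R :=
  network sigma theta (col_mx alpha z%:M).

Definition net (theta : Par) (alpha : 'cV[R]_m) (C z : R) : R :=
  scalar_net theta alpha (clamp C z).

Section Continuity.
Variables (I : Type) (F : set_system I) (FF : Filter F).
Variables (theta_ : I -> Par) (theta : Par).
Variables (alpha_ : I -> 'cV[R]_m) (alpha : 'cV[R]_m).
Hypothesis theta_cvg : forall psi, member (dual (nspace Par)) psi ->
  psi (theta_ t) @[t --> F] --> (psi theta : R^o).
Hypothesis alpha_cvg : forall psi, member (dual (nspace 'cV[R]_m)) psi ->
  psi (alpha_ t) @[t --> F] --> (psi alpha : R^o).

Lemma scalar_net_cvg (z_ : I -> R) (z : R) : z_ t @[t --> F] --> z ->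
  scalar_net (theta_ t) (alpha_ t) (z_ t) @[t --> F] --> scalar_net theta alpha z.
Proof.
move=> cz; apply: network_cvg => // a.
case: (splitP a) => [j aj|j aj].
  have -> : a = lshift 1 j by apply/val_inj.
  rewrite col_mxEu; under eq_fun do rewrite col_mxEu.
  exact: (alpha_cvg (dual_entry j ord0)).
have -> : a = rshift m j by apply/val_inj.
rewrite col_mxEd; under eq_fun do rewrite col_mxEd.
by rewrite !ord1 mxE eqxx mulr1n; under eq_fun do rewrite mxE eqxx mulr1n.
Qed.

Lemma net_cvg (C : R) (z_ : I -> R) (z : R) : z_ t @[t --> F] --> z ->
  net (theta_ t) (alpha_ t) C (z_ t) @[t --> F] --> net theta alpha C z.
Proof. by move=> cz; apply: scalar_net_cvg; exact: clamp_cvg. Qed.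

End Continuity.

Lemma scalar_net_measurable theta alpha : measurable_fun setT (scalar_net theta alpha).
Proof.
apply: continuous_measurable_fun => z.
apply: (@scalar_net_cvg _ _ _ (fun=> theta) theta (fun=> alpha) alpha _ _ id z) => //.
- by move=> psi _; exact: cvg_cst.
- by move=> psi _; exact: cvg_cst.
Qed.

Lemma net_measurable theta alpha C : measurable_fun setT (net theta alpha C).
Proof.
apply: continuous_measurable_fun => z.
apply: (@net_cvg _ _ _ (fun=> theta) theta (fun=> alpha) alpha _ _ C id z) => //.
- by move=> psi _; exact: cvg_cst.
- by move=> psi _; exact: cvg_cst.
Qed.

Lemma net_bounded (A C : R) : 0 <= C -> exists D : R,
  forall theta alpha z, `|theta| <= A -> `|alpha| <= A -> `|net theta alpha C z| <= D.
Proof.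
move=> C0; have [D hD] := network_bounded csigma hs (m + 1) (Num.max A C).
exists D => theta alpha z hth hal; apply: hD => [|a]; first by rewrite le_max hth.
case: (splitP a) => [j aj|j aj].
  have -> : a = lshift 1 j by apply/val_inj.
  by rewrite col_mxEu le_max (le_trans (le_mx_norm _ _ _) hal).
have -> : a = rshift m j by apply/val_inj.
by rewrite col_mxEd ord1 mxE eqxx mulr1n le_max clamp_le ?orbT.
Qed.

Lemma net_Lphat theta alpha C (f : L) : 0 <= C -> member L f ->
  member L (net theta alpha C \o f).
Proof.
move=> C0 mf; have [D hD] := net_bounded (Num.max `|theta| `|alpha|) C0.
apply: (@bounded_Lfun _ _ _ _ _ (lebesgue_on_fin (OmegaP S)) (phat_ge1 S) _ D).
  apply: measurableT_comp; first exact: net_measurable.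
  by have := sub_Lfun_mfun (mf : f \in Lfun muO (phat S)%:E); rewrite inE.
by move=> x; apply: hD; rewrite le_max lexx ?orbT.
Qed.

(** [j_LW] acts on representatives; its boundedness sends a difference of norm 0 to 0, and the
    target is a genuine normed space. *)
Lemma Lphat_ae_eq (f g : L) : member L f -> member L g ->
  {ae muO, forall x, f x = g x} -> j_LW f = j_LW g.
Proof.
move=> mf mg fg; have [[mj lj [C hC]] _] := j_LW_embedding S.
have sL := L_seminormed S; have mfg := memberB sL mf mg.
have fg0 : snorm L (f - g) = 0%E.
  rewrite /= unlock (_ : (\int[_]_x _)%E = 0%E).
    by rewrite poweR0r// invr_eq0 gt_eqF// (lt_le_trans ltr01 (phat_ge1 S)).
  rewrite -(integral0 muO setT); apply: ae_eq_integral_nonmeasurable.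
  apply: (aeS fg) => x h _ /=; rewrite (_ : (f - g) x = 0).
    by rewrite normr0 powR0// gt_eqF// (lt_le_trans ltr01 (phat_ge1 S)).
  by have := subrr (g x); rewrite -{1}h; exact.
have jD : j_LW f = j_LW (f - g) + j_LW g.
  have [] := lj 1 (f - g) g mfg mg; rewrite !scale1r subrK.
  by move=> /eqP; rewrite normr_eq0 subr_eq0 => /eqP.
have := hC _ mfg; rewrite fg0 mule0 /= lee_fin normr_le0 => /eqP j0.
by rewrite jD j0 add0r.
Qed.

Lemma Lfun_ae (f g : Rn R (dimn S) -> R) : f \in Lfun muO (phat S)%:E ->
  measurable_fun setT g -> {ae muO, forall x, g x = f x} ->
  g \in Lfun muO (phat S)%:E.
Proof.
move=> fL mg gf; have := sub_Lfun_finLfun fL; rewrite inE /= /finite_norm => Nf.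
rewrite inE/=; apply/andP; split; first by rewrite inE.
rewrite inE /= /finite_norm; apply: le_lt_trans Nf.
rewrite unlock le_eqVlt; apply/orP; left; apply/eqP; congr (_ `^ _)%E.
by apply: ae_eq_integral_nonmeasurable; apply: (aeS gf) => x h _; rewrite /= h.
Qed.

(** Passes from the joint function [space_time u], which carries the L^oo bound, to the V-valued
    function u, on which the compact embedding acts. At almost every t the two agree almost
    everywhere and are bounded by C, so clamping has no effect. *)
Lemma network_op_ae theta alpha (u : Vcal S) (C : R) : 0 <= C ->
  member (Vcal S) u -> (snorm _ (space_time u) <= C%:E)%E ->
  {ae leb, forall t, t \in `]0, T[ ->
    network_op (S := S) sigma theta alpha u t = j_LW (net theta alpha C \o j_VL (u t) : L)}.
Proof.
move=> C0 mu uC; have [[ms _ _] _] := space_time_embedding S.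
have mst : measurable_fun setT (space_time u).
  by have := ms u mu => /= /sub_Lfun_mfun; rewrite inE.
have [mVL _ _] := bVL.
apply: (ae2 (ae_cylinder_sections (Linfty_ae_le uC)) (space_timeE mu)) => t h1 h2 It.
have h1' := h1 It; have h2' := h2 It.
have mv := mVL (u t) I.
pose g x := network sigma theta (col_mx alpha (space_time u (t, x))%:M).
have E : {ae muO, forall x, g x = net theta alpha C (j_VL (u t) x)}.
  by apply: (ae2 h1' h2') => x b e; rewrite /net -e clamp_id.
apply: Lphat_ae_eq => //; last exact: net_Lphat.
(* [g] may be unbounded on a null set of points; its membership comes from equality almost
   everywhere with the clamped network and from measurability of sections of [space_time u]. *)
apply: (Lfun_ae (net_Lphat theta alpha C0 mv)) => //.
exact: (measurableT_comp (scalar_net_measurable theta alpha)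
  (measurableT_comp mst (pair1_measurable t))).
Qed.

Lemma j_LW_cvg (f_ : nat -> L) (f : L) : (forall n, member L (f_ n)) -> member L f ->
  nrm (f_ n - f) @[n --> \oo] --> (0 : R) -> j_LW (f_ n) @[n --> \oo] --> j_LW f.
Proof.
move=> mf_ mf cf; have [[mj lj [C hC]] _] := j_LW_embedding S.
have sL := L_seminormed S.
have jB n : j_LW (f_ n) - j_LW f = j_LW (f_ n - f).
  have [] := lj 1 (f_ n - f) f (memberB sL (mf_ n) mf) mf; rewrite !scale1r subrK.
  by move=> /eqP; rewrite normr_eq0 subr_eq0 => /eqP ->; rewrite addrK.
have c : C * nrm (f_ n - f) @[n --> \oo] --> (0 : R).
  by rewrite -(mulr0 C); apply: cvgM; [exact: cvg_cst|exact: cf].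
have : `|j_LW (f_ n) - j_LW f| @[n --> \oo] --> (0 : R).
  apply: (squeeze_cvgr _ (cvg_cst 0) c); apply: nearW => n.
  rewrite normr_ge0/= jB -lee_fin EFinM -(nrmE sL); first exact: hC (memberB sL (mf_ n) mf).
  exact: memberB.
by move/norm_cvg0P => /subr_cvg0.
Qed.

Lemma net_embedding_cvg (theta_ : nat -> Par) (theta : Par)
    (alpha_ : nat -> 'cV[R]_m) (alpha : 'cV[R]_m) (C : R) (v_ : nat -> V) (v : V) :
  0 <= C -> weak_cvg (A := nspace Par) theta_ theta ->
  weak_cvg (A := nspace 'cV[R]_m) alpha_ alpha ->
  nrm (j_VL (v_ n - v)) @[n --> \oo] --> (0 : R) ->
  j_LW (net (theta_ n) (alpha_ n) C \o j_VL (v_ n) : L) @[n --> \oo] -->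
    j_LW (net theta alpha C \o j_VL v : L).
Proof.
move=> C0 wth wal cv; have [mVL lVL _] := bVL; have sL := L_seminormed S.
have [A1 A10 hA1] := weak_cvg_bounded (@nspace_seminormed _ Par) wth.
have [A2 A20 hA2] := weak_cvg_bounded (@nspace_seminormed _ 'cV[R]_m) wal.
have [D hD] := net_bounded (Num.max (Num.max A1 A2) (Num.max `|theta| `|alpha|)) C0.
apply: j_LW_cvg; [by move=> n; exact: (net_Lphat _ _ C0 (mVL _ I))|exact: (net_Lphat _ _ C0 (mVL _ I))|].
apply: (nemytskii_cvg (lebesgue_on_fin (OmegaP S)) (phat_ge1 S) (C := D)) => //.
- by move=> n; exact: mVL.
- exact: mVL.
- by move=> n; exact: net_measurable.
- exact: net_measurable.
- move=> n z; apply: hD; rewrite !le_max.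
    by rewrite (hA1 n).
  by rewrite (hA2 n : `|_| <= _) orbT.
- by move=> z; apply: hD; rewrite !le_max lexx ?orbT.
- move=> s z_ z hsi cz; apply: net_cvg => //.
    by have [_ _ h] := weak_cvg_subseq hsi wth.
  by have [_ _ h] := weak_cvg_subseq hsi wal.
rewrite (_ : (fun n => nrm (j_VL (v_ n) - j_VL v)) = (fun n => nrm (j_VL (v_ n - v))))//.
apply/funext => n; have h := lVL 1 (v_ n - v) v I I.
have mw := mVL (v_ n - v) I; have mn := mVL (v_ n) I; have mv := mVL v I.
apply: (nrm_same sL (memberB sL mn mv) mw).
by move: h; rewrite !scale1r subrK /same opprD addrA addrAC.
Qed.

Lemma network_op_cvg (theta_ : nat -> Par) (theta : Par)
    (alpha_ : nat -> 'cV[R]_m) (alpha : 'cV[R]_m) (u_ : nat -> Vcal S) (u : Vcal S) :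
  weak_cvg (A := nspace Par) theta_ theta ->
  weak_cvg (A := nspace 'cV[R]_m) alpha_ alpha -> weak_cvg u_ u ->
  {ae leb, forall t, t \in `]0, T[ -> nrm (j_VL (u_ n t - u t)) @[n --> \oo] --> (0 : R)} ->
  {ae leb, forall t, t \in `]0, T[ ->
    network_op (S := S) sigma (theta_ n) (alpha_ n) (u_ n) t @[n --> \oo] -->
    network_op (S := S) sigma theta alpha u t}.
Proof.
move=> wth wal wu cu; have [C C0 [hC hC_]] := weak_cvg_space_time_bound wu.
have [mu_ mu _] := wu.
have h_ := ae_foralln (fun n => network_op_ae (theta_ n) (alpha_ n) C0 (mu_ n) (hC_ n)).
apply: (ae3 h_ (network_op_ae theta alpha C0 mu hC) cu) => t hn h c It.
rewrite h//; have := net_embedding_cvg C0 wth wal (c It).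
rewrite (_ : (fun n => j_LW _) = (fun n => network_op (S := S) sigma (theta_ n) (alpha_ n) (u_ n) t))//.
by apply/funext => n; rewrite hn.
Qed.

(** With constant parameters, [net_embedding_cvg] gives sequential continuity of v |-> j_LW(net(j_VL
    v)) from V to W; composing this map with simple approximations of u approximates the
    operator. *)
Lemma network_op_strongly_measurable (theta : Par) (alpha : 'cV[R]_m) (u : Vcal S) :
  member (Vcal S) u -> strongly_measurable T (network_op (S := S) sigma theta alpha u).
Proof.
move=> mu; have [[ms _ _] _] := space_time_embedding S.
have sI := Linfty_seminormed S; have sL := L_seminormed S.
have uC : (snorm _ (space_time u) <= (nrm (space_time u))%:E)%E by rewrite (nrmE sI (ms _ mu)).
have C0 := nrm_ge0 sI (ms _ mu).
pose G (v : V) : W := j_LW (net theta alpha (nrm (space_time u)) \o j_VL v : L).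
have [[su _] _] := mu.
have [g [s_ ss sg] [_ ug]] := strongly_measurable_repr su.
apply: (@strongly_measurable_ae _ _ _ _ (G \o g)).
  by apply: (ae2 (network_op_ae theta alpha C0 mu uC) ug) => t h h' It; rewrite h//= /G h'.
apply: pointwise_simple_strongly; exists (fun n => G \o s_ n) => [n|t]; first exact: simple_map.
have wcst (E : normedModType R) (x : E) : weak_cvg (A := nspace E) (fun=> x) x.
  by split => // psi _; exact: cvg_cst.
apply: (net_embedding_cvg C0 (wcst _ theta) (wcst _ alpha)).
have [B hB] := bounded_linear_nrm_sub sL bVL.
have := bounded_sub_continuous (E' := R^o) hB; move=> cj.
have c : s_ n t - g t @[n --> \oo] --> (0 : V).
  by rewrite -(subrr (g t)); apply: cvgB; [exact: sg|exact: cvg_cst].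
have := continuous_cvg _ (cj 0) c; rewrite (bounded_linear_nrm0 sL bVL); exact.
Qed.

End NetworkOperator.

(** * The nonlinearity *)

Section Nonlinearity.
Context {R : realType} (S : setting R).
Local Notation leb := (@lebesgue_measure R).
Local Notation mR := (measurableTypeR R).
Local Notation T := (horizon S).
Local Notation X := (sX S).
Local Notation V := (sV S).
Local Notation H := (sH S).
Local Notation W := (sW S).

Let bVH : bounded_linear (A := nspace V) (B := nspace H) (@j_VH R S).
Proof. exact: (j_VH_embedding S).1. Qed.

(** For simple u and b, measurability of [sF] in t at each of finitely many values suffices;
    continuity in the V-variable passes to the limit. In the equation, [b] collects the derivative
    and the network term. *)
Lemma residual_ae_measurable (la : X) (u : R -> V) (b : R -> W) :
  strongly_measurable T u -> strongly_measurable T b ->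
  ae_measurable T (fun t => `|sF t la (u t) - b t|).
Proof.
move=> /strongly_measurable_repr[g [s_ ss sg] [_ ug]].
move=> /strongly_measurable_repr[b' [sb_ ssb sbb] [_ bb]].
apply: (@ae_measurable_lim _ _ (fun k t => `|sF t la (s_ k t) - sb_ k t|)).
  move=> k; apply: (@ae_measurable_simple _ _ _ _ (fun p t => `|sF t la p.1 - p.2|)
    (simple_pair (ss k) (ssb k))) => -[v c] /=.
  apply: ae_measurable_norm.
  have := strongly_measurable_lin (-1) (pointwise_simple_strongly T (g := fun=> c) _)
    (sF_measurable la v).
  rewrite (_ : _ *: _ + _ = (fun t => sF t la v - c)).
    by apply; exists (fun _ _ => c) => [n|t]; [exact: simple_cst|exact: cvg_cst].
  by apply/funext => t; have : (-1) *: c + sF t la v = sF t la v - c by rewrite scaleN1r addrC.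
apply: (ae3 ug bb (sF_continuous la)) => t hu hb hc It.
rewrite hu// hb//; apply: cvg_norm; apply: cvgB; last exact: sbb.
apply: (continuous_cvg _ (hc It (g t))); exact: sg.
Qed.

Lemma dual_snorm_bound (E : normedModType R) (phi : nspace E -> R^o) (C : R) :
  member (dual (nspace E)) phi -> (snorm (dual (nspace E)) phi <= C%:E)%E ->
  forall y : E, `|phi y| <= C * `|y|.
Proof.
move=> dphi hC y; have [->|y0] := eqVneq y 0.
  by have := ndualZ dphi 0 0; rewrite scale0r mul0r => ->; rewrite !normr0 mulr0.
have y1 : 0 < `|y| by rewrite normr_gt0.
have : (`|phi (`|y|^-1 *: y)|%:E <= C%:E)%E.
  apply: le_trans hC; apply: ereal_sup_ubound; exists (`|y|^-1 *: y) => //; split => //.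
  by rewrite /= normrZ normfV normr_id mulVf ?gt_eqF.
by rewrite lee_fin (ndualZ dphi) normrM normfV normr_id ler_pdivrMl// mulrC.
Qed.

Lemma ndual_memberB (E : normedModType R) (phi psi : nspace E -> R^o) :
  member (dual (nspace E)) phi -> member (dual (nspace E)) psi ->
  member (dual (nspace E)) (phi - psi).
Proof.
move=> dphi dpsi; have [C C0 hC] := ndual_bound dphi; have [D D0 hD] := ndual_bound dpsi.
apply: dualP => [a x y _ _|].
  have -> : (phi - psi) (a *: x + y) = phi (a *: x + y) - psi (a *: x + y) by [].
  rewrite (ndual_lin dphi) (ndual_lin dpsi).
  have -> : (phi - psi) x = phi x - psi x by [].
  have -> : (phi - psi) y = phi y - psi y by [].
  by rewrite mulrBr opprD addrACA.
exists (C + D) => x _; rewrite /= lee_fin mulrDl.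
have -> : (phi - psi) x = phi x - psi x by [].
by rewrite (le_trans (ler_normB _ _))// lerD.
Qed.

Lemma ndual_memberN (E : normedModType R) (phi : nspace E -> R^o) :
  member (dual (nspace E)) phi -> member (dual (nspace E)) (- phi).
Proof.
move=> dphi; have [C C0 hC] := ndual_bound dphi.
apply: dualP => [a x y _ _|].
  have N z : (- phi) z = - phi z by [].
  by rewrite !N (ndual_lin dphi) opprD mulrN.
by exists C => x _; rewrite /= lee_fin; have -> : (- phi) x = - phi x by []; rewrite normrN.
Qed.

Lemma limn_esup_lt (x_ : nat -> R) (l e : R) :
  (limn_esup (fun n => (x_ n)%:E) <= l%:E)%E -> 0 < e ->
  \forall n \near \oo, x_ n < l + e.
Proof.
rewrite limn_esup_lim => hl e0.
have le : (limn (esups (fun n => (x_ n)%:E)) < (l + e)%:E)%E.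
  by apply: (le_lt_trans hl); rewrite lte_fin ltrDl.
have cv := @is_cvg_esups R (fun n => (x_ n)%:E).
have : \forall n \near \oo, (esups (fun n => (x_ n)%:E) n < (l + e)%:E)%E.
  move/cvg_ex : cv => [l' cl']; have ll := cvg_lim (@ereal_hausdorff R) cl'.
  rewrite ll in le.
  apply: (cl' [set x | (x < (l + e)%:E)%E]).
    by apply: open_nbhs_nbhs; split => //; exact: open_ereal_lt_ereal.
apply: filterS => n; rewrite -lte_fin; apply: le_lt_trans.
by apply: ereal_sup_ubound; exists n => /=.
Qed.

Section Pseudomonotone.
Variable (j : H -> dual (nspace W)).
Hypothesis bj : bounded_linear (A := nspace H) j.

Lemma duality_bound : exists2 C : R, 0 <= C & forall h w, `|j h w| <= C * `|h| * `|w|.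
Proof.
have [mj _ [C hC]] := bj; exists `|C| => // h w.
apply: dual_snorm_bound; first exact: mj.
apply: (le_trans (hC h I)); rewrite /= lee_fin ler_wpM2r//; exact: ler_norm.
Qed.

(** [j] is additive only up to dual norm 0, but a functional of dual norm 0 vanishes at every w. *)
Lemma duality_sub h h' w : j (h - h') w = j h w - j h' w.
Proof.
have [mj lj _] := bj; have := lj 1 (h - h') h' I I; rewrite !scale1r subrK => s0.
have mD : member (dual (nspace W)) (j h - (j (h - h') + j h')).
  rewrite opprD addrA; apply: ndual_memberB; last exact: mj.
  by apply: ndual_memberB; exact: mj.
have s0' : (snorm (dual (nspace W)) (j h - (j (h - h') + j h'))%R <= 0%:E)%E by rewrite s0.
have := dual_snorm_bound mD s0' w; rewrite mul0r normr_le0 => /eqP.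
have -> : (j h - (j (h - h') + j h')) w = j h w - (j (h - h') w + j h' w) by [].
by move=> /eqP; rewrite subr_eq0 => /eqP ->; rewrite addrK.
Qed.

End Pseudomonotone.

Lemma weak_cvg_pointwise_pair (la_ : nat -> X) la (h_ : nat -> H) h :
  weak_cvg (A := nspace X) la_ la -> weak_cvg (A := nspace H) h_ h ->
  weak_cvg (A := prod_space (nspace X) (nspace H)) (fun n => (la_ n, h_ n)) (la, h) /\
  weak_cvg (A := prod_space (nspace H) (nspace X)) (fun n => (h_ n, la_ n)) (h, la).
Proof.
move=> wl wh; split; apply: weak_cvg_pair => //=; by rewrite normr0.
Qed.

Lemma weakly_continuous_cvg (la_ : nat -> X) la (u_ : nat -> Vcal S) u :
  weakly_continuous_nonlinearity S ->
  weak_cvg (A := nspace X) la_ la -> weak_cvg u_ u ->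
  {ae leb, forall t, t \in `]0, T[ -> forall chi, member (dual (nspace W)) chi ->
    chi (sF t (la_ n) (u_ n t)) @[n --> \oo] --> (chi (sF t la (u t)) : R^o)}.
Proof.
move=> [FH [FHE FHc]] wl wu; apply: (ae2 (weak_cvg_pointwise wu) FHc) => t hu hF It chi dchi.
have wh : weak_cvg (A := nspace H) (fun n => j_VH (u_ n t)) (j_VH (u t)) by split => //; exact: hu.
have [_ _ h] := hF It _ _ (weak_cvg_pointwise_pair wl wh).1.
have := h _ dchi; rewrite -FHE//.
rewrite (_ : (fun n => chi _) = (fun n => chi (sF t (la_ n) (u_ n t))))//.
by apply/funext => n; rewrite FHE.
Qed.

(** The test element is v = j(w) - chi: then j(w_k) - v is j(w_k - w) + chi, whose first part tends
    to 0 against F_k, and the hypothesis bounds the upper limit of chi(F_k) by chi(F). The same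
    bound for - chi controls the lower limit. *)
Lemma pseudomonotone_pointwise (t : R) (j : H -> dual (nspace W))
    (la_ : nat -> X) (la : X) (w_ : nat -> V) (w : V) :
  bounded_linear (A := nspace H) j ->
  (0 <= limn_einf (fun k => (j (j_VH (w_ k - w)) (sF t (la_ k) (w_ k)))%:E) ->
    forall v, member (dual (nspace W)) v ->
      limn_esup (fun k => ((j (j_VH (w_ k)) - v : _ -> _) (sF t (la_ k) (w_ k)))%:E)
      <= ((j (j_VH w) - v : _ -> _) (sF t la w))%:E)%E ->
  j (j_VH (w_ k - w)) (sF t (la_ k) (w_ k)) @[k --> \oo] --> (0 : R) ->
  forall chi, member (dual (nspace W)) chi ->
    chi (sF t (la_ k) (w_ k)) @[k --> \oo] --> (chi (sF t la w) : R^o).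
Proof.
move=> bj hyp c0.
have [mj _ _] := bj.
have liminf0 : (0 <= limn_einf (fun k => (j (j_VH (w_ k - w)) (sF t (la_ k) (w_ k)))%:E))%E.
  have c0' : (j (j_VH (w_ k - w)) (sF t (la_ k) (w_ k)))%:E @[k --> \oo] --> 0%E.
    by apply: cvg_EFin; first exact: nearW.
  by have [-> _] := cvg_limn_einf_sup c0'.
have {}hyp := hyp liminf0.
have upper chi e : member (dual (nspace W)) chi -> 0 < e ->
    \forall k \near \oo, chi (sF t (la_ k) (w_ k)) < chi (sF t la w) + e.
  move=> dchi e0; have e2 : 0 < e / 2 by rewrite divr_gt0.
  have := hyp (j (j_VH w) - chi) (ndual_memberB (mj _ I) dchi).
  have -> : (j (j_VH w) - (j (j_VH w) - chi)) (sF t la w) = chi (sF t la w).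
    have -> : (j (j_VH w) - (j (j_VH w) - chi)) (sF t la w) =
      j (j_VH w) (sF t la w) - (j (j_VH w) (sF t la w) - chi (sF t la w)) by [].
    by rewrite subKr.
  move=> /limn_esup_lt/(_ e2) h1.
  move/cvgrPdist_lt : c0 => /(_ _ e2) h2.
  near=> k.
  have h2k : `|0 - j (j_VH (w_ k - w)) (sF t (la_ k) (w_ k))| < e / 2 by near: k.
  have h1k : (j (j_VH (w_ k)) - (j (j_VH w) - chi)) (sF t (la_ k) (w_ k)) <
    chi (sF t la w) + e / 2 by near: k.
  have h3 : (j (j_VH (w_ k)) - (j (j_VH w) - chi)) (sF t (la_ k) (w_ k)) =
      j (j_VH (w_ k - w)) (sF t (la_ k) (w_ k)) + chi (sF t (la_ k) (w_ k)).
    rewrite (nbounded_linear_sub bVH) (duality_sub bj).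
    have -> : (j (j_VH (w_ k)) - (j (j_VH w) - chi)) (sF t (la_ k) (w_ k)) =
      j (j_VH (w_ k)) (sF t (la_ k) (w_ k)) -
      (j (j_VH w) (sF t (la_ k) (w_ k)) - chi (sF t (la_ k) (w_ k))) by [].
    by rewrite opprB addrCA addrC.
  rewrite h3 in h1k; move: h2k; rewrite sub0r normrN ltr_norml => /andP[h4 _].
  lra.
move=> chi dchi; apply/cvgrPdist_lt => e e0.
have h1 := upper chi e dchi e0; have h2 := upper (- chi) e (ndual_memberN dchi) e0.
near=> k.
have a1 : chi (sF t (la_ k) (w_ k)) < chi (sF t la w) + e by near: k.
have : (- chi) (sF t (la_ k) (w_ k)) < (- chi) (sF t la w) + e by near: k.
have -> : (- chi) (sF t (la_ k) (w_ k)) = - chi (sF t (la_ k) (w_ k)) by [].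
have -> : (- chi) (sF t la w) = - chi (sF t la w) by [].
by move=> a2; rewrite ltr_norml; apply/andP; split; lra.
Unshelve. all: by end_near.
Qed.

(* [d_] is bounded in L^2, so [|d_| |h_|] tends to 0 along a subsequence by
   [|d h| <= eps |d|^2 + |h|^2 / (4 eps)]. *)
Lemma ae_subseq_product (E E' : normedModType R) (d_ : nat -> L2 T E) (h_ : nat -> R -> E')
    (C : R) :
  (forall n, member (L2 T E) (d_ n)) -> (forall n, nrm (d_ n) <= C) ->
  (forall n, strongly_measurable T (h_ n)) ->
  {ae leb, forall t, t \in `]0, T[ -> h_ n t @[n --> \oo] --> (0 : E')} ->
  exists2 s, increasing_index s &
    {ae leb, forall t, t \in `]0, T[ -> `|d_ (s n) t| * `|h_ (s n) t| @[n --> \oo] --> (0 : R)}.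
Proof.
move=> md dC mh ch.
have /(_ _)/cid2-/all_sig2[gd mgd gdE] := fun n => ae_measurable_norm (md n).1.
have /(_ _)/cid2-/all_sig2[gh mgh ghE] := fun n => ae_measurable_norm (mh n).
have dE := ae_foralln gdE; have hE := ae_foralln ghE.
pose J : set mR := `]0%R, T[%classic.
have sq n : (\int[leb]_(t in J) (gd n t ^+ 2)%:E <= (C ^+ 2)%:E)%E.
  have -> : (\int[leb]_(t in J) (gd n t ^+ 2)%:E = sq_integral T (d_ n))%E.
    apply/esym; apply: ae_eq_lower_integral => [t _|t _|].
    - by rewrite lee_fin exprn_ge0.
    - by rewrite lee_fin sqr_ge0.
    - by apply: (aeS (gdE n)) => t h It; rewrite h.
  have := nrmE (L2_seminormed E T) (md n); rewrite /= => e.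
  rewrite -[X in (X <= _)%E](sqr_sqrte (sq_integral_ge0 _ _)) e -EFin_expe lee_fin.
  by rewrite lerXn2r// nnegrE ?(le_trans _ (dC n))// (nrm_ge0 (L2_seminormed E T) (md n)).
have mJ n (f : mR -> R) : measurable_fun setT f -> measurable_fun J f.
  by move=> mf; exact: measurable_funS mf.
have [|||||||||s hs sP] := @ae_subseq_of_bounded_remainder _ mR R leb J
    (fun n t => `|gd n t| * `|gh n t|) (fun n t => gd n t ^+ 2)
    (fun e n t => gh n t ^+ 2 / (4 * e)) (C ^+ 2) (measurable_itv _) (leb_itv_fin T).
- move=> n; apply: measurable_funS (_ : measurable_fun setT _) => //.
  by apply: measurable_funM; exact: measurableT_comp.
- by move=> n; apply: measurable_funS (measurable_funX 2 (mgd n)).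
- move=> e n _; apply: measurable_funS (_ : measurable_fun setT _) => //.
  by apply: measurable_funM => //; exact: measurable_funX.
- by move=> n t _; rewrite mulr_ge0.
- by move=> n t _; exact: sqr_ge0.
- by move=> e n t e0 _; rewrite divr_ge0 ?sqr_ge0// mulr_ge0// ltW.
- move=> e n t e0 _; rewrite -[gd n t ^+ 2]real_normK ?num_real// -[gh n t ^+ 2]real_normK ?num_real//.
  have -> : e * `|gd n t| ^+ 2 + `|gh n t| ^+ 2 / (4 * e) =
      `|gd n t| * `|gh n t| + e * (`|gd n t| - `|gh n t| / (2 * e)) ^+ 2.
    by field; rewrite gt_eqF.
  by rewrite lerDl mulr_ge0 ?sqr_ge0// ltW.
- exact: sq.
- move=> e e0; apply: (ae2 hE ch) => t h c It.
  have c1 : gh n t @[n --> \oo] --> (0 : R).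
    rewrite (_ : (fun n => gh n t) = (fun n => `|h_ n t|)); last first.
      by apply/funext => n; rewrite h.
    by rewrite -(@normr0 _ E'); exact: (cvg_norm (c It)).
  rewrite -[X in _ --> X](_ : (0 ^+ 2 / (4 * e) : R) = 0); last by rewrite expr0n mul0r.
  by apply: cvgM; [exact: cvgM|exact: cvg_cst].
exists s => //; apply: (ae3 sP dE hE) => t c e1 e2 It; have := c It.
rewrite (_ : (fun n => `|gd (s n) t| * `|gh (s n) t|) = (fun n => `|d_ (s n) t| * `|h_ (s n) t|))//.
by apply/funext => n; rewrite -e1// -e2// !normr_id.
Qed.

End Nonlinearity.

Lemma snorm_prod_sqr (R : realType) (A B : fspace R) (x : prod_space A B) :
  (snorm (prod_space A B) x ^+ 2 = snorm A x.1 ^+ 2 + snorm B x.2 ^+ 2)%E.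
Proof. by apply: sqr_sqrte; rewrite adde_ge0// sqre_ge0. Qed.

Lemma snorm_L2_sqr (R : realType) (T : R) (E : normedModType R) (f : R -> E) :
  (snorm (L2 T E) f ^+ 2 = sq_integral T f)%E.
Proof. by apply: sqr_sqrte; exact: sq_integral_ge0. Qed.

Section Closedness.
Context {R : realType} (S : setting R) (m : nat) (hs : seq nat).
Variables (sigma : R -> R) (csigma : continuous sigma).
Local Notation leb := (@lebesgue_measure R).
Local Notation T := (horizon S).
Local Notation X := (sX S).
Local Notation V := (sV S).
Local Notation H := (sH S).
Local Notation W := (sW S).
Local Notation Par := (params (R := R) (m + 1) hs).

Let bVH : bounded_linear (A := nspace V) (B := nspace H) (@j_VH R S).
Proof. exact: (j_VH_embedding S).1. Qed.

Lemma pseudomonotone_cvg (la_ : nat -> X) la (u_ : nat -> Vcal S) u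
    (d_ n_ : nat -> R -> W) (N : R -> W) (C : R) :
  pseudomonotone_nonlinearity S ->
  weak_cvg (A := nspace X) la_ la -> weak_cvg u_ u ->
  (forall n, member (L2 T W) (d_ n)) -> (forall n, nrm (d_ n : L2 T W) <= C) ->
  {ae leb, forall t, t \in `]0, T[ -> n_ n t @[n --> \oo] --> N t} ->
  {ae leb, forall t, t \in `]0, T[ ->
    d_ n t - sF t (la_ n) (u_ n t) - n_ n t @[n --> \oo] --> (0 : W)} ->
  exists2 s, increasing_index s &
    {ae leb, forall t, t \in `]0, T[ -> forall chi, member (dual (nspace W)) chi ->
      chi (sF t (la_ (s n)) (u_ (s n) t)) @[n --> \oo] --> (chi (sF t la (u t)) : R^o)}.
Proof.
move=> [cH [j [bj _] hyp]] wl wu md dC cn cr.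
have [s1 hs1 c1] := compact_embedding_ae_subseq (@nspace_seminormed _ H) cH
  (fun v_ y _ => @separation_H _ _ v_ y) wu.
have [mu_ mu _] := wu.
have mh n : strongly_measurable T (fun t => j_VH (u_ (s1 n) t - u t)).
  apply: (strongly_measurable_continuous (F := @j_VH R S) (f := u_ (s1 n) - u)).
    exact: nbounded_linear_continuous.
  have [[su_ _] _] := mu_ (s1 n); have [[su _] _] := mu.
  have := strongly_measurable_lin (-1) su su_.
  by rewrite scaleN1r addrC.
have ch : {ae leb, forall t, t \in `]0, T[ ->
    j_VH (u_ (s1 n) t - u t) @[n --> \oo] --> (0 : H)}.
  by apply: (aeS c1) => t h It; apply/norm_cvg0P; exact: h.
have [s2 hs2 c2] := ae_subseq_product (fun n => md (s1 n)) (fun n => dC (s1 n)) mh ch.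
have hs12 := increasing_index_comp hs1 hs2.
exists (s1 \o s2) => //.
have [D D0 hD] := duality_bound bj.
apply: (ae4 hyp (weak_cvg_pointwise wu) c2).
  apply: (ae3 cn cr ch) => t h1 h2 h3; exact: (conj h1 (conj h2 h3)).
move=> t hj hu hc [hn [hr hh]] It chi dchi.
apply: (pseudomonotone_pointwise (j := j) (w_ := fun n => u_ (s1 (s2 n)) t)
  (la_ := fun n => la_ (s1 (s2 n)))) => //.
  apply: hj => //.
  have wh : weak_cvg (A := nspace H) (fun n => j_VH (u_ n t)) (j_VH (u t)).
    by split => //; exact: hu.
  have wl' := weak_cvg_subseq hs12 wl; have wh' := weak_cvg_subseq hs12 wh.
  exact: (weak_cvg_pointwise_pair wl' wh').2.
apply/norm_cvg0P.
pose h n := j_VH (u_ (s1 (s2 n)) t - u t).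
pose d n := d_ (s1 (s2 n)) t.
pose nn n := n_ (s1 (s2 n)) t.
pose r n := d_ (s1 (s2 n)) t - sF t (la_ (s1 (s2 n))) (u_ (s1 (s2 n)) t) - nn n.
have ch0 : h n @[n --> \oo] --> (0 : H) by exact: (cvg_subseq hs2 (hh It)).
have cn0 : nn n @[n --> \oo] --> N t by exact: (cvg_subseq hs12 (hn It)).
have cr0 : r n @[n --> \oo] --> (0 : W) by exact: (cvg_subseq hs12 (hr It)).
(* The nonlinearity is d - nn - r. The terms nn and r converge at this t, so their products with h
   vanish directly; d is bounded only in L^2, and its product with h is the one handled by the
   extraction [s2]. *)
have cb : D * (`|d n| * `|h n| + `|h n| * (`|nn n| + `|r n|)) @[n --> \oo] --> (0 : R).
  rewrite (_ : 0 = D * (0 + `|0 : H| * (`|N t| + `|0 : W|)) :> R); last first.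
    by rewrite normr0 mul0r addr0 mulr0.
  apply: cvgM; first exact: cvg_cst.
  apply: cvgD; first exact: (hc It).
  by apply: cvgM; [exact: cvg_norm|apply: cvgD; exact: cvg_norm].
apply: (squeeze_cvgr _ (cvg_cst 0) cb); apply: nearW => n; rewrite normr_ge0/=.
apply: (le_trans (hD _ _)); rewrite -mulrA; apply: ler_wpM2l => //.
rewrite -/(h n) [`|d n| * _]mulrC -mulrDr; apply: ler_wpM2l => //.
have -> : sF t (la_ (s1 (s2 n))) (u_ (s1 (s2 n)) t) = d n - nn n - r n.
  by rewrite /r opprB addrA subrK subKr.
rewrite (le_trans (ler_normB _ _))// addrA lerD2r; exact: ler_normB.
Qed.

Lemma nonlinearity_cvg (la_ : nat -> X) la (u_ : nat -> Vcal S) u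
    (d_ n_ : nat -> R -> W) (N : R -> W) (C : R) :
  weakly_continuous_nonlinearity S \/ pseudomonotone_nonlinearity S ->
  weak_cvg (A := nspace X) la_ la -> weak_cvg u_ u ->
  (forall n, member (L2 T W) (d_ n)) -> (forall n, nrm (d_ n : L2 T W) <= C) ->
  {ae leb, forall t, t \in `]0, T[ -> n_ n t @[n --> \oo] --> N t} ->
  {ae leb, forall t, t \in `]0, T[ ->
    d_ n t - sF t (la_ n) (u_ n t) - n_ n t @[n --> \oo] --> (0 : W)} ->
  exists2 s, increasing_index s &
    {ae leb, forall t, t \in `]0, T[ -> forall chi, member (dual (nspace W)) chi ->
      chi (sF t (la_ (s n)) (u_ (s n) t)) @[n --> \oo] --> (chi (sF t la (u t)) : R^o)}.
Proof.
move=> [wc|pm] wl wu md dC cn cr; last exact: pseudomonotone_cvg pm wl wu md dC cn cr.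
by exists id => //; exact: weakly_continuous_cvg.
Qed.

Lemma cvg0_sqr (x_ : nat -> \bar R) : x_ n @[n --> \oo] --> 0%E ->
  (x_ n ^+ 2)%E @[n --> \oo] --> 0%E.
Proof.
move=> cx; rewrite (_ : (0 : \bar R)%E = (0 * 0)%E); last by rewrite mule0.
by under eq_fun do rewrite expe2; apply: cvgeM => //; rewrite mule_def_fin.
Qed.

Lemma squeeze_cvg0e (x_ y_ : nat -> \bar R) : (forall n, (0 <= x_ n <= y_ n)%E) ->
  y_ n @[n --> \oo] --> 0%E -> x_ n @[n --> \oo] --> 0%E.
Proof.
by move=> xy cy; apply: (squeeze_cvge _ (cvg_cst 0%E) cy); exact: nearW.
Qed.

(** Along a subsequence the observations converge to [ydag] almost everywhere, while they converge
    weakly to [sM u]; weak limits in L^2 are identified pointwise. *)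
Lemma observation_closed (ydag : Ycal S) (u_ : nat -> Vcal S) u :
  member (Ycal S) ydag -> weak_cvg u_ u ->
  snorm (Ycal S) (sM (u_ n) - ydag) @[n --> \oo] --> 0%E ->
  same (sM u) ydag.
Proof.
move=> my wu c0; have sY := L2_seminormed (sY S) T.
have wM := weak_cvg_comp (@Vcal_lin R S) sY (sM_bounded_linear S) wu.
have [mM_ mM _] := wM.
have mD n : member (Ycal S) (sM (u_ n) - ydag) by exact: (memberB sY (mM_ n) my).
have I0 : sq_integral T (sM (u_ n) - ydag) @[n --> \oo] --> 0%E.
  apply: squeeze_cvg0e (cvg0_sqr c0) => n.
  by rewrite sq_integral_ge0 (snorm_L2_sqr T (sM (u_ n) - ydag)) lexx.
have [s hsi cs] := L2_ae_subseq (fun n => ae_measurable_norm (mD n).1) I0.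
have := L2_weak_limit_ae (g := ydag) (Y_separable S) (weak_cvg_subseq hsi wM).
move=> h; have {}h : {ae leb, forall t, t \in `]0, T[ -> sM u t = ydag t}.
  apply: h => chi dchi; apply: (aeS cs) => t c It.
  apply: (continuous_cvg _ (ndual_continuous dchi (x := ydag t))).
  have c2 : (sM (u_ (s n)) - ydag) t + ydag t @[n --> \oo] --> 0 + ydag t.
    by apply: cvgD; [exact: c It|exact: cvg_cst].
  rewrite add0r in c2.
  rewrite [X in X @ _ --> _](_ : _ = (fun n => (sM (u_ (s n)) - ydag) t + ydag t)); first exact: c2.
  by apply/funext => n; exact: (esym (subrK (ydag t) _)).
rewrite /same /= (@sq_integral_ae _ _ _ _ (fun=> 0)); last first.
  apply: (aeS h) => t e It; have : sM u t - ydag t = 0 by rewrite e// subrr.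
  exact.
by have := snorm0 sY => /= <-.
Qed.

Lemma initial_value_closed (u0_ : nat -> sU0 S) u0 (u_ : nat -> Vcal S) u :
  weak_cvg (A := nspace (sU0 S)) u0_ u0 -> weak_cvg u_ u ->
  cont_rep (u_ n) 0 - j_U0H (u0_ n) @[n --> \oo] --> (0 : H) ->
  cont_rep u 0 - j_U0H u0 = 0.
Proof.
move=> wu0 wu c0; apply: ndual_separates => psi dpsi.
(* Continuous representatives converge weakly at every point of the closed interval, in particular
   at time 0. *)
have T0 : (0 : R) \in `[0, T] by rewrite in_itv/= lexx ltW// horizon_gt0.
have c1 := weak_cvg_cont_rep wu T0 dpsi.
have [_ _ h] := weak_cvg_comp (member_lin (@nspace_seminormed _ (sU0 S)))
  (@nspace_seminormed _ H) (j_U0H_embedding S).1 wu0.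
have c2 := h psi dpsi.
have c3 : psi (cont_rep (u_ n) 0 - j_U0H (u0_ n)) @[n --> \oo] --> (psi 0 : R^o).
  exact: (continuous_cvg _ (ndual_continuous dpsi (x := 0)) c0).
have psi0 : psi 0 = 0 by have := ndual_sub dpsi 0 0; rewrite !subrr.
rewrite psi0 in c3.
have c4 : psi (cont_rep (u_ n) 0 - j_U0H (u0_ n)) @[n --> \oo] -->
    (psi (cont_rep u 0 - j_U0H u0) : R^o).
  rewrite (ndual_sub dpsi) [X in X @ _ --> _](_ : _ =
    (fun n => psi (cont_rep (u_ n) 0) - psi (j_U0H (u0_ n)))).
    by apply: cvgB; [exact: c1|exact: c2].
  by apply/funext => n; exact: (ndual_sub dpsi).
exact: (cvg_unique _ c4 c3).
Qed.

(** Three nested extractions: [s1] makes the residual vanish almost everywhere, [s2] gives strong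
    convergence in L^phat and with it the network term, [s3] the nonlinearity. The network comes
    before the nonlinearity because case (B) recovers the latter from the derivative, the residual
    and the network term. *)
Lemma equation_closed (la_ : nat -> X) la (al_ : nat -> 'cV[R]_m) al
    (u_ : nat -> Vcal S) u (th_ : nat -> Par) th :
  weakly_continuous_nonlinearity S \/ pseudomonotone_nonlinearity S ->
  weak_cvg (A := nspace X) la_ la -> weak_cvg (A := nspace 'cV[R]_m) al_ al ->
  weak_cvg u_ u -> weak_cvg (A := nspace Par) th_ th ->
  sq_integral T (ddt (u_ n) - F_op (la_ n) (u_ n) -
    network_op (S := S) sigma (th_ n) (al_ n) (u_ n)) @[n --> \oo] --> 0%E ->
  {ae leb, forall t, t \in `]0, T[ ->
    ddt u t = sF t la (u t) + network_op (S := S) sigma th al u t}.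
Proof.
move=> FAB wl wal wu wth I0; have sW := L2_seminormed W T.
have [mu_ mu _] := wu.
have wd := weak_cvg_comp (@Vcal_lin R S) sW (ddt_bounded_linear S) wu.
have [md_ md _] := wd.
pose r_ n : R -> W := ddt (u_ n) - F_op (la_ n) (u_ n) -
  network_op (S := S) sigma (th_ n) (al_ n) (u_ n).
have mr n : ae_measurable T (fun t => `|r_ n t|).
  pose b : R -> W := ddt (u_ n) - network_op (S := S) sigma (th_ n) (al_ n) (u_ n).
  have mb : strongly_measurable T b.
    have := strongly_measurable_lin (-1)
      (network_op_strongly_measurable csigma (th_ n) (al_ n) (mu_ n)) (md_ n).1.
    by rewrite scaleN1r addrC.
  have [[su _] _] := mu_ n.
  have := residual_ae_measurable (la_ n) su mb.
  congr (ae_measurable _ _); apply/funext => t; rewrite distrC; congr (`|_|).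
  change (ddt (u_ n) t - network_op (S := S) sigma (th_ n) (al_ n) (u_ n) t - sF t (la_ n) (u_ n t) =
    ddt (u_ n) t - sF t (la_ n) (u_ n t) - network_op (S := S) sigma (th_ n) (al_ n) (u_ n) t).
  by rewrite addrAC.
have [s1 hs1 c1] := L2_ae_subseq mr I0.
have wu1 := weak_cvg_subseq hs1 wu.
have [s2 hs2 c2] := compact_embedding_ae_subseq (L_seminormed S) (j_VL_compact S)
  (@separation_L _ S) wu1.
have hs12 := increasing_index_comp hs1 hs2.
have [C C0 hC] := weak_cvg_bounded sW wd.
have cN := network_op_cvg csigma (weak_cvg_subseq hs12 wth) (weak_cvg_subseq hs12 wal)
  (weak_cvg_subseq hs12 wu) c2.
have [|s3 hs3 c3] := nonlinearity_cvg
  (d_ := fun n => ddt (u_ (s1 (s2 n))))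
  FAB (weak_cvg_subseq hs12 wl) (weak_cvg_subseq hs12 wu)
  (fun n => md_ (s1 (s2 n))) (fun n => hC (s1 (s2 n))) cN.
  apply: (aeS c1) => t h It; have := cvg_subseq hs2 (h It); exact.
have hs123 := increasing_index_comp hs12 hs3.
apply: (L2_weak_limit_ae (W_separable S) (weak_cvg_subseq hs123 wd)) => chi dchi.
apply: (ae3 c1 cN c3) => t h1 h2 h3 It.
pose d n := ddt (u_ (s1 (s2 (s3 n)))) t.
pose f n := sF t (la_ (s1 (s2 (s3 n)))) (u_ (s1 (s2 (s3 n))) t).
pose g n := network_op (S := S) sigma (th_ (s1 (s2 (s3 n)))) (al_ (s1 (s2 (s3 n))))
  (u_ (s1 (s2 (s3 n)))) t.
have cr : chi (d n - f n - g n) @[n --> \oo] --> (0 : R).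
  have e : chi 0 = 0 by have := ndual_sub dchi 0 0; rewrite !subrr.
  rewrite -[X in _ --> X]e.
  apply: (continuous_cvg _ (ndual_continuous dchi (x := 0))).
  exact: (cvg_subseq (increasing_index_comp hs2 hs3) (h1 It)).
have cf : chi (f n) @[n --> \oo] --> (chi (sF t la (u t)) : R) by exact: (h3 It chi dchi).
have cg : chi (g n) @[n --> \oo] --> (chi (network_op (S := S) sigma th al u t) : R).
  apply: (continuous_cvg _ (ndual_continuous dchi (x := _))).
  exact: (cvg_subseq hs3 (h2 It)).
have chiD x y : chi (x + y) = chi x + chi y.
  by have := ndual_lin dchi 1 x y; rewrite scale1r mul1r.
(* The derivative is residual plus nonlinearity plus network term, so its pointwise weak limit is
   the sum of the three limits. *)
have : chi (d n - f n - g n) + chi (f n) + chi (g n) @[n --> \oo] -->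
    0 + chi (sF t la (u t)) + chi (network_op (S := S) sigma th al u t).
  by apply: cvgD => //; apply: cvgD.
rewrite add0r -chiD.
rewrite (_ : (fun n => _ + _) = (fun n => chi (d n)))//.
by apply/funext => n; rewrite -!chiD; congr chi; rewrite [_ - g n + f n]addrAC !subrK.
Qed.

Lemma pde_closed (la_ : nat -> X) la (al_ : nat -> 'cV[R]_m) al
    (u0_ : nat -> sU0 S) u0 (u_ : nat -> Vcal S) u (th_ : nat -> Par) th :
  weakly_continuous_nonlinearity S \/ pseudomonotone_nonlinearity S ->
  weak_cvg (A := nspace X) la_ la -> weak_cvg (A := nspace 'cV[R]_m) al_ al ->
  weak_cvg (A := nspace (sU0 S)) u0_ u0 -> weak_cvg u_ u ->
  weak_cvg (A := nspace Par) th_ th ->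
  snorm _ (pde_op sigma ((la_ n, al_ n, u0_ n, u_ n) : state_space S m)
    (th_ n : Theta m hs)) @[n --> \oo] --> 0%E ->
  same (pde_op sigma ((la, al, u0, u) : state_space S m) (th : Theta m hs)) 0.
Proof.
move=> FAB wl wal wu0 wu wth /cvg0_sqr c0.
have split2 n : (snorm _ (pde_op sigma ((la_ n, al_ n, u0_ n, u_ n) : state_space S m)
    (th_ n : Theta m hs)) ^+ 2 =
  sq_integral T (ddt (u_ n) - F_op (la_ n) (u_ n) -
    network_op (S := S) sigma (th_ n) (al_ n) (u_ n))%R +
  (`|cont_rep (u_ n) 0 - j_U0H (u0_ n)| ^+ 2)%:E)%E.
  by rewrite snorm_prod_sqr snorm_L2_sqr.
have I0 : sq_integral T (ddt (u_ n) - F_op (la_ n) (u_ n) -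
    network_op (S := S) sigma (th_ n) (al_ n) (u_ n)) @[n --> \oo] --> 0%E.
  apply: squeeze_cvg0e c0 => n.
  by rewrite sq_integral_ge0 andTb split2 leeDl// lee_fin exprn_ge0.
have e1 := equation_closed FAB wl wal wu wth I0.
have e2 : cont_rep u 0 - j_U0H u0 = 0.
  apply: (initial_value_closed wu0 wu); apply/norm_cvg0P.
  have J0 : (`|cont_rep (u_ n) 0 - j_U0H (u0_ n)| ^+ 2)%:E @[n --> \oo] --> 0%E.
    apply: squeeze_cvg0e c0 => n.
    by rewrite lee_fin exprn_ge0// andTb split2 leeDr// sq_integral_ge0.
  move/fine_cvgP : J0 => [_ J0].
  have := cvg_powR0 (r := 2^-1) (x_ := fun n => `|cont_rep (u_ n) 0 - j_U0H (u0_ n)| ^+ 2) _ _ J0.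
  rewrite invr_gt0 => /(_ (ltr0n _ 2) (fun n => exprn_ge0 _ (normr_ge0 _))).
  rewrite (_ : (fun n => _ `^ _) = (fun n => `|cont_rep (u_ n) 0 - j_U0H (u0_ n)|))//.
  by apply/funext => n; rewrite powR12_sqrt ?exprn_ge0// sqrtr_sqr normr_id.
rewrite /same subr0; set q := pde_op _ _ _.
have q1 : snorm (Wcal S) q.1 = 0%E.
  rewrite -(snorm0 (L2_seminormed W T)); congr sqrte; apply: sq_integral_ae.
  apply: (aeS e1) => t e It.
  change (ddt u t - sF t la (u t) - network_op (S := S) sigma th al u t = 0).
  by rewrite e// -addrA -opprD subrr.
have q2 : snorm (nspace H) q.2 = 0%E by rewrite /q /= e2 normr0.
change (sqrte (snorm (Wcal S) q.1 ^+ 2 + snorm (nspace H) q.2 ^+ 2) = 0)%E.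
by rewrite q1 q2 expe2 mule0 adde0 sqrte0.
Qed.

End Closedness.

(** * Lower limits and the penalized problem *)

Section LowerLimits.
Context {R : realType}.
Implicit Types u v : nat -> \bar R.
Local Open Scope ereal_scope.

Lemma einfs_le u n k : (n <= k)%N -> einfs u n <= u k.
Proof. by move=> nk; apply: ereal_inf_lbound; exists k. Qed.

Lemma le_einfs u n (x : \bar R) : (forall k, (n <= k)%N -> x <= u k) -> x <= einfs u n.
Proof. by move=> h; apply: le_ereal_inf_tmp => _ [k /= nk <-]; exact: h. Qed.

Lemma limn_einf_le u v : (forall n, u n <= v n) -> limn_einf u <= limn_einf v.
Proof.
move=> uv; rewrite !limn_einf_lim; apply: lee_lim; [exact: is_cvg_einfs|exact: is_cvg_einfs|].
apply: nearW => n; apply: le_einfs => k nk; exact: le_trans (einfs_le u nk) (uv k).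
Qed.

Lemma limn_einf_ge0 u : (forall n, 0 <= u n) -> 0 <= limn_einf u.
Proof.
move=> u0; rewrite limn_einf_lim; apply: lime_ge; first exact: is_cvg_einfs.
by apply: nearW => n; apply: le_einfs.
Qed.

(** Nonnegativity keeps the sum of the two lower limits from being of the form +oo - oo. *)
Lemma limn_einf_superadditive u v : (forall n, 0 <= u n) -> (forall n, 0 <= v n) ->
  limn_einf u + limn_einf v <= limn_einf (fun n => u n + v n).
Proof.
move=> u0 v0; have lu := limn_einf_ge0 u0; have lv := limn_einf_ge0 v0.
rewrite !limn_einf_lim in lu lv *.
have c : einfs u n + einfs v n @[n --> \oo] --> limn (einfs u) + limn (einfs v).
  by apply: cvgeD; [exact: ge0_adde_def|exact: is_cvg_einfs|exact: is_cvg_einfs].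
rewrite -(cvg_lim (@ereal_hausdorff R) c); apply: lee_lim.
- by apply/cvg_ex; eexists; exact: c.
- exact: is_cvg_einfs.
- apply: nearW => n; apply: le_einfs => k nk.
  by apply: leeD; exact: einfs_le.
Qed.

Lemma limn_einf_sum (I : Type) (r : seq I) (u : I -> nat -> \bar R) :
  (forall i n, 0 <= u i n) ->
  \sum_(i <- r) limn_einf (u i) <= limn_einf (fun n => \sum_(i <- r) u i n).
Proof.
move=> u0; elim: r => [|i r ih].
  by rewrite big_nil; apply: limn_einf_ge0 => n; rewrite big_nil.
rewrite big_cons [X in _ <= limn_einf X](_ : _ =
  (fun n => u i n + \sum_(j <- r) u j n)); last first.
  by apply/funext => n; rewrite big_cons.
apply: le_trans (limn_einf_superadditive (u0 i) _); first by rewrite leeD2l.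
by move=> n; exact: sume_ge0.
Qed.

Lemma cvg0_of_sqr_le (x_ d_ : nat -> \bar R) : (forall n, 0 <= x_ n) ->
  (forall n, x_ n ^+ 2 <= d_ n) -> d_ n @[n --> \oo] --> 0 -> x_ n @[n --> \oo] --> 0.
Proof.
move=> x0 xd cd.
have : x_ n ^+ 2 @[n --> \oo] --> 0.
  by apply: squeeze_cvg0e cd => n; rewrite sqre_ge0 xd.
move/fine_cvgP => [fin c]; apply/fine_cvgP; split.
  apply: filterS fin => n; rewrite -[x_ n]gee0_abs// -sqrte_sqr.
  by rewrite sqrte_fin_num ?sqre_ge0// sqrte_sqr gee0_abs.
have := cvg_powR0 (r := 2^-1) (x_ := fun n => fine (x_ n ^+ 2)) _ _ c.
rewrite invr_gt0 => /(_ (ltr0n _ 2) (fun n => fine_ge0 (sqre_ge0 _))).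
rewrite (_ : (fun n => _ `^ _)%R = fine \o x_)//.
apply/funext => n /=; rewrite powR12_sqrt ?fine_ge0 ?sqre_ge0//.
have := x0 n; case: (x_ n) => [r| |] //=; last by rewrite sqrtr0.
by rewrite lee_fin => r0; rewrite -expr2 sqrtr_sqr ger0_norm.
Qed.

Lemma cvg0_of_penalty (x_ : nat -> \bar R) (b_ : nat -> R) (c : R) :
  (forall n, 0 <= x_ n) -> (forall n, (0 < b_ n)%R) -> (b_ n @[n --> \oo] --> +oo)%R ->
  (forall n, (b_ n)%:E * x_ n ^+ 2 <= c%:E) -> x_ n @[n --> \oo] --> 0.
Proof.
move=> x0 b0 cb h; apply: (@cvg0_of_sqr_le _ (fun n => (c / b_ n)%:E)) => // [n|].
  have bc : ((b_ n)%:E * (c / b_ n)%:E = c%:E)%E.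
    by rewrite -EFinM mulrCA divff ?gt_eqF// mulr1.
  by rewrite -(@lee_pmul2l _ (b_ n)%:E) ?lte_fin// bc.
apply: cvg_EFin; first exact: nearW.
rewrite -(mulr0 c); apply: cvgM; first exact: cvg_cst.
by apply/gtr0_cvgV0 => //; exact: nearW.
Qed.

End LowerLimits.

(** * Weak convergence in finite powers *)

Section PowerSpaces.
Context {R : realType} (K : nat) (A : fspace R).
Hypotheses (A0 : member A 0) (nA0 : snorm A 0 = 0%E)
  (A_ge0 : forall x, member A x -> (0 <= snorm A x)%E).

Definition single (k : 'I_K) (a : A) : power_space K A := fun l => if l == k then a else 0.

Lemma member_single k a : member A a -> member (power_space K A) (single k a).
Proof. by move=> ma l; rewrite /single; case: ifP. Qed.

Lemma snorm_single k a : member A a -> snorm (power_space K A) (single k a) = snorm A a.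
Proof.
move=> ma; rewrite /= (bigD1 k)//= big1 => [|l lk].
  by rewrite /single eqxx adde0 -expe2 sqrte_sqr gee0_abs// A_ge0.
by rewrite /single (negbTE lk) nA0 mule0.
Qed.

Lemma dual_power (phi : power_space K A -> R^o) x : member (dual (power_space K A)) phi ->
  member (power_space K A) x -> phi x = \sum_(k < K) phi (single k (x k)).
Proof.
move=> dphi mx; have lphi := dual_lin dphi.
(* Keeping only the coordinates listed in [r] allows an induction that adds one coordinate at a
   time. *)
pose part (r : seq 'I_K) : power_space K A := fun l => if l \in r then x l else 0.
have mpart r : member (power_space K A) (part r) by move=> l; rewrite /part; case: ifP.
have phi0 : phi (part [::]) = 0.
  have := lphi (-1) _ _ (mpart [::]) (mpart [::]).
  rewrite mulN1r addNr => <-; congr phi; apply/funext => l.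
  by have : 0 = -1 *: 0 + 0 :> A by rewrite scaler0 addr0.
have step r : uniq r -> phi (part r) = \sum_(k <- r) phi (single k (x k)).
  elim: r => [|k r ih] /=; first by rewrite big_nil phi0.
  move=> /andP[kr ur]; rewrite big_cons -ih//.
  rewrite -[phi (single _ _)]mul1r -lphi//; last exact: member_single.
  congr phi; apply/funext => l.
  have -> : (1 *: single k (x k) + part r) l = single k (x k) l + part r l.
    by rewrite scale1r.
  rewrite /part /single in_cons; case: eqP => [->|_] /=; last by rewrite add0r.
  by rewrite (negbTE kr) addr0.
rewrite -(step (index_enum 'I_K) (index_enum_uniq _)).
by congr phi; apply/funext => l; rewrite /part mem_index_enum.
Qed.

Lemma weak_cvg_power (x_ : nat -> power_space K A) x :
  (forall k, weak_cvg (fun n => x_ n k) (x k)) -> weak_cvg x_ x.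
Proof.
move=> cx; have mx_ n : member (power_space K A) (x_ n) by move=> k; case: (cx k).
have mx : member (power_space K A) x by move=> k; case: (cx k).
split => // phi dphi; have lphi := dual_lin dphi; have [_ _ [C hC]] := dphi.
rewrite (dual_power dphi mx).
rewrite (_ : (fun n => phi (x_ n)) = (fun n => \sum_(k < K) phi (single k (x_ n k)))); last first.
  by apply/funext => n; exact: dual_power.
apply: cvg_sum_seq => k; have [_ _ h] := cx k.
apply: (h (fun a => phi (single k a))); apply: dualP => [a u v mu mv|].
  rewrite -(lphi a (single k u) (single k v)); try exact: member_single.
  congr phi; apply/funext => l.
  have -> : (a *: single k u + single k v) l = a *: single k u l + single k v l by [].
  by rewrite /single; case: ifP => // _; rewrite scaler0 addr0.
by exists C => u mu; have := hC _ (member_single k mu); rewrite snorm_single.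
Qed.

Lemma weak_cvg_power_proj (x_ : nat -> power_space K A) x k :
  weak_cvg x_ x -> weak_cvg (fun n => x_ n k) (x k).
Proof.
apply: (weak_cvg_linear (A := power_space K A) (B := A) (f := fun x => x k)) => //.
move=> z mz; rewrite A_ge0//= -[leLHS]gee0_abs ?A_ge0// -sqrte_sqr.
rewrite lee_sqrt; last by apply: sume_ge0 => l _; exact: sqre_ge0.
by rewrite (bigD1 k)//= leeDl// sume_ge0// => l _; exact: sqre_ge0.
Qed.

Lemma power_member0 : member (power_space K A) 0.
Proof. by move=> k; exact: A0. Qed.

Lemma power_snorm0 : snorm (power_space K A) 0 = 0%E.
Proof. by rewrite /= big1 ?sqrte0// => k _; rewrite nA0 mule0. Qed.

End PowerSpaces.

Lemma prod_snorm0 (R : realType) (A B : fspace R) :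
  snorm A 0 = 0%E -> snorm B 0 = 0%E -> snorm (prod_space A B) 0 = 0%E.
Proof.
move=> a b; change (sqrte (snorm A 0 ^+ 2 + snorm B 0 ^+ 2) = 0)%E.
by rewrite a b expe2 mule0 adde0 sqrte0.
Qed.

Lemma prod_ge0 (R : realType) (A B : fspace R) (x : prod_space A B) :
  member (prod_space A B) x -> (0 <= snorm (prod_space A B) x)%E.
Proof. by move=> _; exact: sqrte_ge0. Qed.

(** * The space of states and parameters *)

Section DecisionVariables.
Context {R : realType} (S : setting R) (m K : nat) (hs : seq nat).
Local Notation St := (state_space S m).
Local Notation Th := (Theta (R := R) m hs).
Local Notation Var := (variables S m K hs).

Lemma state_lin (a : R) (p q : St) : member St p -> member St q -> member St (a *: p + q).
Proof.
case: p => [[[? ?] ?] u]; case: q => [[[? ?] ?] u'] [_ mu] [_ mu'].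
by split => //; exact: Vcal_lin mu mu'.
Qed.

Lemma state_ge0 (p : St) : (0 <= snorm St p)%E.
Proof. exact: sqrte_ge0. Qed.

(** Membership of 0 is obtained as (-1) p + p, so some member must be at hand; this is the role of
    [p] in [variables_weak_cvg] below. *)
Lemma state_member0 p : member St p -> member St 0.
Proof. by move=> mp; have := state_lin (-1) mp mp; rewrite scaleN1r addNr. Qed.

Lemma state_snorm0 p : member St p -> snorm St 0 = 0%E.
Proof.
move=> mp; have [_ m0] := state_member0 mp.
have n0 (E : normedModType R) : snorm (nspace E) 0 = 0%E by rewrite /= normr0.
by apply: prod_snorm0; [apply: prod_snorm0; [exact: prod_snorm0|]|exact: Vcal_snorm0].
Qed.

Lemma weak_cvg_state (q_ : nat -> St) q : weak_cvg q_ q ->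
  [/\ weak_cvg (A := nspace (sX S)) (fun n => (q_ n).1.1.1) q.1.1.1,
      weak_cvg (A := nspace 'cV[R]_m) (fun n => (q_ n).1.1.2) q.1.1.2,
      weak_cvg (A := nspace (sU0 S)) (fun n => (q_ n).1.2) q.1.2 &
      weak_cvg (fun n => (q_ n).2) q.2].
Proof.
have n0 (E : normedModType R) (x : nspace E) : member _ x -> (0 <= snorm (nspace E) x)%E.
  by move=> _; rewrite /= lee_fin.
have v0 u : member (Vcal S) u -> (0 <= snorm (Vcal S) u)%E by move=> _; exact: Vcal_snorm_ge0.
move=> wq; have w1 := weak_cvg_fst (@prod_ge0 _ _ _) v0 wq.
have w2 := weak_cvg_snd (@prod_ge0 _ _ _) v0 wq.
have w11 := weak_cvg_fst (@prod_ge0 _ _ _) (@n0 _) w1.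
have w12 := weak_cvg_snd (@prod_ge0 _ _ _) (@n0 _) w1.
by split => //; [exact: (weak_cvg_fst (@n0 _) (@n0 _) w11)|exact: (weak_cvg_snd (@n0 _) (@n0 _) w11)].
Qed.

Lemma weak_cvg_variables (z_ : nat -> Var) z : weak_cvg z_ z ->
  (forall k, weak_cvg (A := St) (fun n => (z_ n).1 k) (z.1 k)) /\
  weak_cvg (A := Th) (fun n => (z_ n).2) z.2.
Proof.
move=> wz; have T0 (th : Th) : member Th th -> (0 <= snorm Th th)%E.
  by move=> _; rewrite /= lee_fin.
have P0 (x : power_space K St) : member _ x -> (0 <= snorm (power_space K St) x)%E.
  by move=> _; exact: sqrte_ge0.
have w2 := @weak_cvg_snd R (power_space K St) Th z_ z P0 T0 wz.
split=> [k|]; last by exact w2.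
apply: (weak_cvg_power_proj _ k (@weak_cvg_fst R (power_space K St) Th z_ z P0 T0 wz)).
by move=> x _; exact: state_ge0.
Qed.

Lemma variables_weak_cvg (z_ : nat -> Var) z (p : St) : member St p ->
  (forall k, weak_cvg (A := St) (fun n => (z_ n).1 k) (z.1 k)) ->
  weak_cvg (A := Th) (fun n => (z_ n).2) z.2 -> weak_cvg z_ z.
Proof.
move=> mp w1 w2; have s0 := state_snorm0 mp; have m0 := state_member0 mp.
have sge x : member St x -> (0 <= snorm St x)%E by move=> _; exact: state_ge0.
have wp := weak_cvg_power m0 s0 sge w1.
have T0 : snorm Th 0 = 0%E by rewrite /= normr0.
have Tge x : member Th x -> (0 <= snorm Th x)%E by move=> _; rewrite /= lee_fin.
have Pge (x : power_space K St) : member _ x -> (0 <= snorm (power_space K St) x)%E.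
  by move=> _; exact: sqrte_ge0.
have w := @weak_cvg_pair R (power_space K St) Th _ _ _ _
  (power_member0 m0) (power_snorm0 K s0) Pge I T0 Tge wp w2.
rewrite (_ : z_ = fun n => ((z_ n).1, (z_ n).2)); last by apply/funext => n; case: (z_ n).
by case: z w w1 w2 wp => z1 z2 w _ _ _; exact: w.
Qed.

End DecisionVariables.

Lemma ge0_le_sume (R : realType) (I : finType) (i : I) (F : I -> \bar R) :
  (forall j, 0 <= F j)%E -> (F i <= \sum_j F j)%E.
Proof. by move=> F0; rewrite (bigD1 i)//= leeDl// sume_ge0. Qed.

(** * The penalized functional *)

Section Penalized.
Context {R : realType} (S : setting R) (m K : nat) (hs : seq nat).
Variables (sigma : R -> R) (R1 : state_space S m -> \bar R) (R2 : Theta (R := R) m hs -> \bar R).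
Local Notation St := (state_space S m).
Local Notation Th := (Theta (R := R) m hs).
Local Notation Var := (variables S m K hs).
Hypotheses (R1_ge0 : forall q, member St q -> (0 <= R1 q)%E)
  (R2_ge0 : forall theta, (0 <= R2 theta)%E).

Definition regularizer (z : Var) : \bar R := (\sum_(k < K) R1 (z.1 k) + R2 z.2)%E.

Lemma regularizer_ge (z : Var) k : member Var z -> (R1 (z.1 k) + R2 z.2 <= regularizer z)%E.
Proof.
move=> [mz _]; rewrite /regularizer leeD2r// (bigD1 k)//= leeDl//.
by apply: sume_ge0 => l _; exact: R1_ge0.
Qed.

(** Precompactness concerns one state paired with the parameters, so a subsequence is extracted for
    each index in turn. Every index brings its own weak limit of the parameters; the one of the
    first index, which exists as K > 0, is used. *)
Lemma regularizer_precompact (c : R) (z_ : nat -> Var) : (0 < K)%N ->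
  weakly_precompact_sublevels (A := prod_space St Th) (fun p => (R1 p.1 + R2 p.2)%E) ->
  (forall n, member Var (z_ n)) -> (forall n, (regularizer (z_ n) <= c%:E)%E) ->
  exists (s : nat -> nat) (z : Var), increasing_index s /\ weak_cvg (z_ \o s) z.
Proof.
move=> hK cpt mz zc.
have P0 (q : St) : member St q -> (0 <= snorm St q)%E by move=> _; exact: state_ge0.
have T0 (th : Th) : member Th th -> (0 <= snorm Th th)%E by move=> _; rewrite /= lee_fin.
have [s hsi hs_] : exists2 s, increasing_index s & forall k, k \in index_enum 'I_K ->
    exists w : St * Th, weak_cvg (A := St) (fun n => (z_ (s n)).1 k) w.1 /\
      weak_cvg (A := Th) (fun n => (z_ (s n)).2) w.2.
  elim: (index_enum 'I_K) => [|k r [s hsi ih]]; first by exists id.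
  have [n|s' [w [hsi' hw]]] := cpt c (fun n => ((z_ (s n)).1 k, (z_ (s n)).2)).
    split; first by case: (mz (s n)) => h _; split => //; exact: h.
    exact: le_trans (regularizer_ge k (mz _)) (zc _).
  exists (s \o s'); first exact: increasing_index_comp.
  move=> l; rewrite in_cons => /predU1P[->|lr].
    exists w; split; first exact: (@weak_cvg_fst R St Th _ _ P0 T0 hw).
    exact: (@weak_cvg_snd R St Th _ _ P0 T0 hw).
  have [w' [h1 h2]] := ih l lr; exists w'.
  by split; [exact: (weak_cvg_subseq hsi' h1)|exact: (weak_cvg_subseq hsi' h2)].
have {}hs_ k := hs_ k (mem_index_enum k).
have [g hg] := choice hs_.
pose k0 := Ordinal hK.
exists s, ((fun k => (g k).1), (g k0).2); split; first exact: hsi.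
apply: (@variables_weak_cvg R S m K hs _ _ (g k0).1).
- by have [[_ h _] _] := hg k0.
- by move=> k; exact: (hg k).1.
- exact: (hg k0).2.
Qed.

Lemma objectiveE (betae betaM : R) (y : 'I_K -> Ycal S) (z : Var) :
  objective sigma R1 R2 betae betaM y z =
  (\sum_(k < K) betae%:E * snorm _ (pde_op sigma (z.1 k) z.2) ^+ 2 +
   \sum_(k < K) betaM%:E * snorm (Ycal S) (sM (z.1 k).2 - y k)%R ^+ 2 + regularizer z)%E.
Proof. by rewrite /objective !big_split/= addeA. Qed.

Lemma objective_bounds (betae betaM : R) (y : 'I_K -> Ycal S) (z : Var) (c : \bar R) :
  0 <= betae -> 0 <= betaM -> member Var z ->
  (objective sigma R1 R2 betae betaM y z <= c)%E ->
  [/\ forall k, (betae%:E * snorm _ (pde_op sigma (z.1 k) z.2) ^+ 2 <= c)%E,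
      forall k, (betaM%:E * snorm (Ycal S) (sM (z.1 k).2 - y k)%R ^+ 2 <= c)%E &
      (regularizer z <= c)%E].
Proof.
move=> be0 bM0 mz; rewrite objectiveE => zc.
have J0 : (0 <= regularizer z)%E.
  by rewrite adde_ge0// sume_ge0// => k _; apply: R1_ge0; case: mz.
have e0 k : (0 <= betae%:E * snorm _ (pde_op sigma (z.1 k) z.2) ^+ 2)%E.
  by rewrite mule_ge0// sqre_ge0.
have m0 k : (0 <= betaM%:E * snorm (Ycal S) (sM (z.1 k).2 - y k)%R ^+ 2)%E.
  by rewrite mule_ge0// sqre_ge0.
have se0 := sume_ge0 (fun k (_ : true) => e0 k).
have sm0 := sume_ge0 (fun k (_ : true) => m0 k).
split=> [k|k|]; apply: le_trans zc.
- apply: le_trans (ge0_le_sume k e0) _.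
  by rewrite -addeA leeDl// adde_ge0.
- apply: le_trans (ge0_le_sume k m0) _.
  by apply: (le_trans _ (leeDl _ J0)); rewrite leeDr.
- by rewrite leeDr// adde_ge0.
Qed.

(** At a feasible point the PDE term vanishes and the observation residual is the data error,
    because [sM] of the state and [ydag] are the same element. *)
Lemma objective_feasible (betae betaM : R) (y ydag : 'I_K -> Ycal S) (z : Var) :
  0 <= betaM -> member Var z -> (forall k, member (Ycal S) (y k)) ->
  (forall k, member (Ycal S) (ydag k)) -> fits_exactly sigma ydag z ->
  objective sigma R1 R2 betae betaM y z =
  (betaM%:E * (\sum_(k < K) snorm (Ycal S) (y k - ydag k)%R ^+ 2) + regularizer z)%E.
Proof.
move=> bM0 [mz _] my mydag fz; rewrite objectiveE big1 ?add0e; last first.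
  move=> k _; have [h _] := fz k; move: h; rewrite /same subr0 => ->.
  by rewrite expe2 !mule0.
congr (_ + _)%E; rewrite ge0_sume_distrr; last by move=> k _; exact: sqre_ge0.
apply: eq_bigr => k _; congr (_ * _ ^+ 2)%E.
have sY := L2_seminormed (sY S) (horizon S); have [_ h] := fz k.
have mM : member (Ycal S) (sM (z.1 k).2).
  by have [h1 _ _] := sM_bounded_linear S; apply: h1; case: (mz k).
rewrite (_ : sM (z.1 k).2 - y k = - (y k - ydag k) + (sM (z.1 k).2 - ydag k)); last first.
  by rewrite opprB [RHS]addrC addrA subrK.
have mD := memberB sY (my k) (mydag k).
rewrite (snorm_eq0D sY _ (memberB sY mM (mydag k)) h); last first.
  by rewrite -scaleN1r; exact: (memberZ sY).
rewrite -[LHS]/(snorm (L2 _ _) _) -scaleN1r (snormZ sY)// normrN1 mul1e //.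
Qed.

End Penalized.

(** * Weak limits of solutions *)

Section LimitOfSolutions.
Context {R : realType} (S : setting R) (m K : nat) (hs : seq nat).
Variables (sigma : R -> R) (R1 : state_space S m -> \bar R) (R2 : Theta (R := R) m hs -> \bar R).
Local Notation St := (state_space S m).
Local Notation Var := (variables S m K hs).
Local Notation J := (regularizer (S := S) (m := m) (K := K) (hs := hs) R1 R2).
Hypotheses (R1_ge0 : forall q, member St q -> (0 <= R1 q)%E)
  (R2_ge0 : forall theta, (0 <= R2 theta)%E)
  (R1_wlsc : weakly_lsc R1) (R2_wlsc : weakly_lsc R2).

Lemma regularizer_wlsc (z_ : nat -> Var) (z : Var) : weak_cvg z_ z ->
  (J z <= limn_einf (fun n => J (z_ n)))%E.
Proof.
move=> wz; have [w1 w2] := weak_cvg_variables wz; have [mz_ _ _] := wz.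
have R1z k n : (0 <= R1 ((z_ n).1 k))%E by apply: R1_ge0; have [h _] := mz_ n; exact: h.
apply: (le_trans _ (limn_einf_superadditive (u := fun n => \sum_(k < K) R1 ((z_ n).1 k))
  (v := fun n => R2 (z_ n).2) _ _)%E); last 2 first.
- by move=> n; apply: sume_ge0.
- by move=> n.
rewrite /regularizer; apply: leeD; last exact: (R2_wlsc w2).
apply: (le_trans _ (limn_einf_sum (index_enum 'I_K) (fun k => R1z k))).
by apply: lee_sum => k _; exact: (R1_wlsc (w1 k)).
Qed.

Lemma fits_exactly_closed (ydag : 'I_K -> Ycal S) (z_ : nat -> Var) (z : Var) :
  continuous sigma -> weakly_continuous_nonlinearity S \/ pseudomonotone_nonlinearity S ->
  (forall k, member (Ycal S) (ydag k)) -> weak_cvg z_ z ->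
  (forall k, snorm _ (pde_op sigma ((z_ n).1 k) (z_ n).2) @[n --> \oo] --> 0%E) ->
  (forall k, snorm (Ycal S) (sM ((z_ n).1 k).2 - ydag k) @[n --> \oo] --> 0%E) ->
  fits_exactly sigma ydag z.
Proof.
move=> csigma FAB mydag wz c1 c2 k; have [w1 w2] := weak_cvg_variables wz.
have [wl wa wu0 wu] := weak_cvg_state (w1 k); split; last first.
  exact: (observation_closed (mydag k) wu (c2 k)).
have eta (q : St) : q = (q.1.1.1, q.1.1.2, q.1.2, q.2) :> St by case: q => [[[? ?] ?] ?].
rewrite (eta (z.1 k)); apply: (pde_closed csigma FAB wl wa wu0 wu w2).
have := c1 k; apply: cvg_trans; apply: near_eq_cvg; apply: nearW => n.
by rewrite -eta.
Qed.

End LimitOfSolutions.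

Theorem proposition8 (R : realType) (S : setting R) (m K : nat) (hK : (0 < K)%N)
  (sigma : R -> R) (hs : seq nat)
  (R1 : state_space S m -> \bar R) (R2 : Theta (R := R) m hs -> \bar R)
  (sigma_locLip : forall x : R, exists2 A : set R, nbhs x A &
     exists k : R, k.-lipschitz_A (sigma : R^o -> R^o))
  (F_AB : weakly_continuous_nonlinearity S \/ pseudomonotone_nonlinearity S)
  (R1_ge0 : forall q, member (state_space S m) q -> (0 <= R1 q)%E)
  (R2_ge0 : forall theta, (0 <= R2 theta)%E)
  (R1_wlsc : weakly_lsc R1)
  (R2_wlsc : weakly_lsc R2)
  (R_sublevels : weakly_precompact_sublevels
     (A := prod_space (state_space S m) (Theta m hs))
     (fun p => (R1 p.1 + R2 p.2)%E))
  (ydag : 'I_K -> Ycal S)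
  (ydag_Y : forall k, member (Ycal S) (ydag k))
  (exact_solution : exists zhat : variables S m K hs,
     [/\ member (variables S m K hs) zhat, fits_exactly sigma ydag zhat,
         forall k, (R1 (zhat.1 k) < +oo)%E & (R2 zhat.2 < +oo)%E])
  (y : nat -> 'I_K -> Ycal S)
  (y_Y : forall n k, member (Ycal S) (y n k))
  (betae betaM : nat -> R)
  (betae_gt0 : forall n, 0 < betae n)
  (betaM_gt0 : forall n, 0 < betaM n)
  (delta2 : nat -> \bar R)
  (delta2E : forall n,
     delta2 n = (\sum_(k < K) snorm (Ycal S) (y n k - ydag k)%R ^+ 2)%E)
  (delta2_cvg0 : delta2 n @[n --> \oo] --> 0%E)
  (betae_cvg : betae n @[n --> \oo] --> +oo)
  (betaM_cvg : betaM n @[n --> \oo] --> +oo)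
  (betaM_delta2_cvg0 : ((betaM n)%:E * delta2 n)%E @[n --> \oo] --> 0%E)
  (z : nat -> variables S m K hs)
  (z_sol : forall n, solves_P sigma R1 R2 (betae n) (betaM n) (y n) (z n)) :
  [/\ exists (s : nat -> nat) (z0 : variables S m K hs),
        increasing_index s /\ weak_cvg (z \o s) z0,
      forall (s : nat -> nat) (z0 : variables S m K hs),
        increasing_index s -> weak_cvg (z \o s) z0 ->
        solves_Pdagger sigma R1 R2 ydag z0 &
      (forall z1 z2, solves_Pdagger sigma R1 R2 ydag z1 ->
         solves_Pdagger sigma R1 R2 ydag z2 -> same z1 z2) ->
      exists2 z0, solves_Pdagger sigma R1 R2 ydag z0 & weak_cvg z z0].
Proof.
have csigma := locLip_continuous sigma_locLip.
have sYs := L2_seminormed (sY S) (horizon S).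
pose J := regularizer (S := S) (m := m) (K := K) (hs := hs) R1 R2.
have mz n : member (variables S m K hs) (z n) by case: (z_sol n).
have J_ge0 z' : member (variables S m K hs) z' -> (0 <= J z')%E.
  move=> [mz' _]; apply: adde_ge0; last exact: R2_ge0.
  by apply: sume_ge0 => k _; apply: R1_ge0; exact: mz'.
(* Comparison with a feasible point, used twice: with the given exact solution for the uniform
   bound, and with an arbitrary competitor for minimality of the limit. *)
have z_le n z' : member (variables S m K hs) z' -> fits_exactly sigma ydag z' ->
    (objective sigma R1 R2 (betae n) (betaM n) (y n) (z n) <= (betaM n)%:E * delta2 n + J z')%E.
  move=> mz' fz'; have [_ _ min] := z_sol n; apply: (le_trans (min z' mz' I)).
  by rewrite (objective_feasible R1 R2 (betae n) (ltW (betaM_gt0 n)) mz' (y_Y n) ydag_Y fz') delta2E.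
have b_ n := objective_bounds R1_ge0 R2_ge0 (ltW (betae_gt0 n)) (ltW (betaM_gt0 n)) (mz n).
have [c hc] : exists c : R, forall n,
    (objective sigma R1 R2 (betae n) (betaM n) (y n) (z n) <= c%:E)%E.
  have [zhat [mzhat fzhat R1hat R2hat]] := exact_solution.
  have Jfin : J zhat \is a fin_num.
    rewrite ge0_fin_numE ?J_ge0//; apply: lte_add_pinfty; last exact: R2hat.
    by apply: lte_sum_pinfty => k _; exact: R1hat.
  have d_fin n : ((betaM n)%:E * delta2 n)%E \is a fin_num.
    rewrite fin_numM// delta2E; apply/sum_fin_numP => k _ _.
    rewrite expe2 fin_numM//; exact: (snorm_fin sYs (memberB sYs (y_Y n k) (ydag_Y k))).
  have /fine_cvgP[_ /cvgP/cvg_seq_bounded[C [_ hC]]] := betaM_delta2_cvg0.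
  exists (C + 1 + fine (J zhat)) => n; apply: (le_trans (z_le n _ mzhat fzhat)).
  rewrite EFinD fineK// leeD2r// -[leLHS]fineK// lee_fin.
  by apply: le_trans (ler_norm _) _; apply: hC; rewrite // ltrDl.
have [e_le M_le J_le] : [/\
    forall n k, ((betae n)%:E * snorm _ (pde_op sigma ((z n).1 k) (z n).2) ^+ 2 <= c%:E)%E,
    forall n k, ((betaM n)%:E * snorm (Ycal S) (sM ((z n).1 k).2 - y n k)%R ^+ 2 <= c%:E)%E &
    forall n, (J (z n) <= c%:E)%E].
  by split=> n; [have [h _ _] := b_ _ _ _ n (hc n)|have [_ h _] := b_ _ _ _ n (hc n)
    |have [_ _ h] := b_ _ _ _ n (hc n)].
have e_cvg k : snorm _ (pde_op sigma ((z n).1 k) (z n).2) @[n --> \oo] --> 0%E.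
  by apply: (cvg0_of_penalty _ betae_gt0 betae_cvg (e_le ^~ k)) => n; exact: sqrte_ge0.
have M_cvg k : snorm (Ycal S) (sM ((z n).1 k).2 - ydag k) @[n --> \oo] --> 0%E.
  have c1 : snorm (Ycal S) (sM ((z n).1 k).2 - y n k) @[n --> \oo] --> 0%E.
    by apply: (cvg0_of_penalty _ betaM_gt0 betaM_cvg (M_le ^~ k)) => n; exact: sqrte_ge0.
  have c2 : snorm (Ycal S) (y n k - ydag k) @[n --> \oo] --> 0%E.
    apply: (cvg0_of_sqr_le _ _ delta2_cvg0) => n; first exact: sqrte_ge0.
    rewrite delta2E; apply: (ge0_le_sume k) => l; exact: sqre_ge0.
  have c12 : snorm (Ycal S) (sM ((z n).1 k).2 - y n k)%R + snorm (Ycal S) (y n k - ydag k)%R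
      @[n --> \oo] --> (0 + 0)%E by exact: cvgeD c1 c2.
  rewrite adde0 in c12; apply: squeeze_cvg0e c12 => n.
  apply/andP; split; first exact: sqrte_ge0.
  have mM : member (Ycal S) (sM ((z n).1 k).2).
    by have [h _ _] := sM_bounded_linear S; apply: h; have [h' _] := mz n; case: (h' k).
  rewrite -[sM _ - ydag k](subrKA (y n k)).
  exact: (snormD sYs (memberB sYs mM (y_Y n k)) (memberB sYs (y_Y n k) (ydag_Y k))).
have limit_sol (s : nat -> nat) (z0 : variables S m K hs) :
    increasing_index s -> weak_cvg (z \o s) z0 -> solves_Pdagger sigma R1 R2 ydag z0.
  move=> hsi wz0; have [_ mz0 _] := wz0; split=> //.
    apply: (fits_exactly_closed csigma F_AB ydag_Y wz0) => k.
      exact: (cvg_subseq hsi (e_cvg k)).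
    exact: (cvg_subseq hsi (M_cvg k)).
  move=> z' mz' fz'.
  (* J(z0) <= liminf J(z_n) <= lim (betaM delta^2 + J(z')) = J(z'), where J(z') may be +oo. *)
  have cJ : ((betaM (s n))%:E * delta2 (s n) + J z')%E @[n --> \oo] --> (0 + J z')%E.
    apply: cvgeD; [by []|exact: (cvg_subseq hsi betaM_delta2_cvg0)|exact: cvg_cst].
  rewrite add0e in cJ.
  have -> : (\sum_(k < K) R1 (z'.1 k) + R2 z'.2 =
      limn_einf (fun n => (betaM (s n))%:E * delta2 (s n) + J z'))%E.
    by rewrite (cvg_limn_einf_sup cJ).1.
  apply: (le_trans (regularizer_wlsc R1_ge0 R2_ge0 R1_wlsc R2_wlsc wz0)).
  (* Here the bound [c] of [objective_bounds] is the objective value itself, which dominates the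
     regularizer. *)
  apply: limn_einf_le => n; have [_ _ h] := b_ sigma (y (s n)) _ (s n) (lexx _).
  exact: (le_trans h (z_le _ _ mz' fz')).
have sub_cvg (s : nat -> nat) : exists (s' : nat -> nat) (z0 : variables S m K hs),
    increasing_index s' /\ weak_cvg (z \o s \o s') z0.
  exact: (regularizer_precompact R1_ge0 hK R_sublevels (fun n => mz (s n)) (fun n => J_le (s n))).
split; [exact: sub_cvg id|exact: limit_sol|].
move=> uniq; have [s0 [z0 [hs0 wz0]]] := sub_cvg id.
have sol0 := limit_sol _ _ hs0 wz0; exists z0 => //; have [_ mz0 _] := wz0.
(* The subsequence principle is applied to the real sequence phi(z_n): a further subsequence has a
   weak limit z1 solving the limit problem, hence [same] as z0, and phi takes one value on both. *)
split=> // phi dphi; apply: subseq_principle => s hsi.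
have [s' [z1 [hs' wz1]]] := sub_cvg s; exists s' => //.
have sol1 := limit_sol _ _ (increasing_index_comp hsi hs') wz1.
have [_ mz1 c1] := wz1.
suff -> : phi z0 = phi z1 by exact: c1.
(* The bound of [phi] is available only on members, so the difference must first be shown to be
   one. *)
have mzB : member (variables S m K hs) (z0 - z1).
  split=> // k; rewrite (_ : (z0 - z1).1 k = (-1) *: z1.1 k + z0.1 k).
    by apply: state_lin; [case: mz1 => h _|case: mz0 => h _]; exact: h.
  by rewrite scaleN1r addrC.
exact: (dual_same dphi mz0 mz1 mzB (uniq _ _ sol0 sol1)).
Qed.
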